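(* If $X$ is a connected aspherical CW-complex which is locally finite or countable, then $AC(X\times Y)=AC(Y)$ for any connected CW-complex $Y$ which is locally finite or countable.
   Context: A CW-complex is locally finite if every point is contained in a finite number of (closed) cells, and countable if it has countably many cells. A space $X$ is aspherical if it is path connected and $\pi_n(X)=0$ for all $n\geq 2$. For a path connected, locally path connected and semilocally simply connected space $X$ (for example a connected CW-complex), an open subset $U\subseteq X$ is nice if it is path connected and the inclusion induces the trivial map $\pi_1(U,x)\to\pi_1(X,x)$ for every $x\in U$; the nice open sets form a basis of the topology. Let $I=[0,1]$ and let $X^I$ be the space of all continuous paths $I\to X$ with the compact-open topology. $\Pi(X)$ is the set of homotopy classes relative to endpoints $[\gamma]$ of paths $\gamma:I\to X$, with the topology having as basis the sets $S(U,V,[\gamma])=\{[\delta_1*\gamma*\delta_2]\}$, where $U,V\subseteq X$ are nice open sets, $\gamma$ is a path with $\gamma(0)\in U$ and $\gamma(1)\in V$, and $\delta_1$ (resp. $\delta_2$) ranges over the paths contained in $U$ ending at $\gamma(0)$ (resp. contained in $V$ starting at $\gamma(1)$); $*$ is concatenation. Let $q:X^I\to\Pi(X)$ be the quotient map $q(\gamma)=[\gamma]$. The (normalized) asphericity complexity $AC(X)$ is the minimum integer $k\ge 0$ such that $\Pi(X)$ can be covered by open subsets $U_0,\dots,U_k$, each admitting a continuous map $s_j:U_j\to X^I$ with $q\circ s_j$ equal to the inclusion $U_j\hookrightarrow\Pi(X)$ ($AC(X)=\infty$ if there is no such $k$). *)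

(* Defs.v *)
From HB Require Import structures.
From mathcomp Require Import all_boot all_order all_algebra generic_quotient.
From mathcomp Require Import all_classical all_reals all_analysis.

Set Implicit Arguments.
Unset Strict Implicit.
Unset Printing Implicit Defensive.

Import Order.TTheory GRing.Theory Num.Theory.
Import numFieldNormedType.Exports.
(* gives [continuousType Z X] the compact-open topology *)
Import ArrowAsCompactOpen.

Local Open Scope classical_set_scope.
Local Open Scope ring_scope.
Local Open Scope quotient_scope.

Definition unitI (R : realType) : Type := set_type `[0:R, 1%R].
HB.instance Definition _ (R : realType) :=
  Topological.copy (unitI R) (set_type `[0:R, 1%R]).

Section unit_interval.
Context {R : realType}.

Lemma clampI_subproof (x : R) : Num.max 0 (Num.min 1 x) \in `[0:R, 1%R]%classic.
Proof.
by rewrite inE/= in_itv/= le_max lexx/= ge_max ler01/= ge_min lexx.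
Qed.

Definition clampI (x : R) : unitI R :=
  exist (fun y => y \in `[0:R, 1%R]%classic) _ (clampI_subproof x).

Definition I0 : unitI R := clampI 0.
Definition I1 : unitI R := clampI 1.
Definition valI (t : unitI R) : R := set_val t.

Lemma valI_cts : continuous valI.
Proof. exact: initial_continuous. Qed.

Lemma valI_ge0 t : 0 <= valI t.
Proof.
by rewrite /valI set_valE; case: t => x /=; rewrite inE/= in_itv/= => /andP[].
Qed.

Lemma valI_le1 t : valI t <= 1.
Proof.
by rewrite /valI set_valE; case: t => x /=; rewrite inE/= in_itv/= => /andP[].
Qed.

Lemma clampIK x : 0 <= x -> x <= 1 -> valI (clampI x) = x.
Proof. by move=> x0 x1; rewrite /valI/= set_valE/= min_r// max_r. Qed.

Lemma valIK t : clampI (valI t) = t.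
Proof.
apply: val_inj => /=; have := clampIK (valI_ge0 t) (valI_le1 t).
by rewrite /valI/= set_valE.
Qed.

Lemma clampI_cts : continuous clampI.
Proof.
apply/continuousP => _ [B oB <-].
rewrite -comp_preimage; move: B oB; apply/continuousP => x /=.
rewrite set_valE.
apply: (@continuous_max R R (cst 0) (fun x => Num.min 1 x)).
  exact: cvg_cst.
by apply: (@continuous_min R R (cst 1) id); [exact: cvg_cst|exact: cvg_id].
Qed.

Lemma valI0 : valI I0 = 0. Proof. by rewrite clampIK. Qed.
Lemma valI1 : valI I1 = 1. Proof. by rewrite clampIK. Qed.

End unit_interval.

Section paste.
Context {R : realType} {Z X : topologicalType}.
Implicit Types F G : Z * unitI R -> X.

(* [F] on the first half of the interval followed by [G] on the second half *)
Definition paste F G (p : Z * unitI R) : X :=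
  if valI p.2 <= 2^-1 then F (p.1, clampI (2 * valI p.2))
  else G (p.1, clampI (2 * valI p.2 - 1)).

Lemma paste_cts F G : continuous F -> continuous G ->
  (forall z, F (z, I1) = G (z, I0)) -> continuous (paste F G).
Proof.
move=> cF cG FG.
have cv : continuous (fun p : Z * unitI R => valI p.2).
  by move=> p; apply: (@continuous_comp _ _ _ (@snd Z (unitI R)) (@valI R));
    [exact: cvg_snd|exact: valI_cts].
have cA (f : R -> R) : continuous f ->
    continuous (fun p : Z * unitI R => (p.1, clampI (f (valI p.2)))).
  move=> cf p; apply: (@cvg_pair _ _ _ (nbhs p) (nbhs p.1)
    (nbhs (clampI (f (valI p.2)))) _ _ _ fst
    (fun p : Z * unitI R => clampI (f (valI p.2)))); first exact: cvg_fst.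
  apply: (@continuous_comp _ _ _ (fun p : Z * unitI R => valI p.2)
    (clampI \o f)); first exact: cv.
  by apply: continuous_comp; [exact: cf|exact: clampI_cts].
pose A := [set p : Z * unitI R | valI p.2 <= 2^-1].
pose B := [set p : Z * unitI R | 2^-1 <= valI p.2].
have AB : A `|` B = setT.
  rewrite -subTset => p _; rewrite /A /B /=.
  by case: (leP (valI p.2) 2^-1) => [|/ltW]; [left|right].
have cA' : closed A.
  apply: (@preimage_closed _ _ (fun p : Z * unitI R => valI p.2)
    [set x : R | x <= 2^-1]).
    by move=> p _; exact: cv.
  exact: closed_le.
have cB' : closed B.
  apply: (@preimage_closed _ _ (fun p : Z * unitI R => valI p.2)
    [set x : R | 2^-1 <= x]).
    by move=> p _; exact: cv.
  exact: closed_ge.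
apply/continuous_subspace_setT; rewrite -AB; apply: withinU_continuous => //.
- have cf : continuous (fun p : Z * unitI R => F (p.1, clampI (2 * valI p.2))).
    move=> p; apply: (@continuous_comp _ _ _
        (fun p : Z * unitI R => (p.1, clampI (2 * valI p.2))) F);
      last exact: cF.
    apply: (cA (fun x => 2 * x)) => x.
    by apply: cvgM; [exact: cvg_cst|exact: cvg_id].
  apply: subspace_eq_continuous (continuous_subspaceT cf) => p.
  by rewrite inE /A /paste /from_subspace /= => ->.
- have cf : continuous
      (fun p : Z * unitI R => G (p.1, clampI (2 * valI p.2 - 1))).
    move=> p; apply: (@continuous_comp _ _ _
        (fun p : Z * unitI R => (p.1, clampI (2 * valI p.2 - 1))) G);
      last exact: cG.
    apply: (cA (fun x => 2 * x - 1)) => x.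
    apply: cvgB; last exact: cvg_cst.
    by apply: cvgM; [exact: cvg_cst|exact: cvg_id].
  apply: subspace_eq_continuous (continuous_subspaceT cf) => p.
  rewrite inE /B /paste /from_subspace /= => h2; case: ifP => // h1.
  have -> : valI p.2 = 2^-1 by apply/eqP; rewrite eq_le h1.
  by rewrite mulfV ?pnatr_eq0// subrr -FG.
Qed.

Lemma paste0 F G z : paste F G (z, I0) = F (z, I0).
Proof. by rewrite /paste/= valI0 invr_ge0 ler0n mulr0. Qed.

Lemma paste1 F G z : paste F G (z, I1) = G (z, I1).
Proof.
rewrite /paste/= valI1 ifF; last first.
  by apply/negbTE; rewrite -ltNge invf_lt1 ?ltr1n ?ltr0n.
by rewrite mulr1 -(@natrB _ 2 1).
Qed.

End paste.

Section homotopy.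
Context (R : realType) (Z X : topologicalType) (A : set Z).

Definition homotopic_rel : rel (continuousType Z X) := fun f g =>
  `[< exists H : Z * unitI R -> X,
      [/\ continuous H,
          forall z, H (z, I0) = f z,
          forall z, H (z, I1) = g z &
          forall z t, A z -> H (z, t) = f z] >].

Lemma homotopic_rel_refl : reflexive homotopic_rel.
Proof.
move=> f; apply/asboolP; exists (fun p => f p.1); split => // p.
apply: (@continuous_comp _ _ _ (@fst Z (unitI R)) f); first exact: cvg_fst.
exact: cts_fun.
Qed.

Lemma homotopic_rel_sym : symmetric homotopic_rel.
Proof.
suff sub f g : homotopic_rel f g -> homotopic_rel g f.
  by move=> f g; apply/idP/idP; exact: sub.
move=> /asboolP[H [cH H0 H1 HA]]; apply/asboolP.
exists (fun p => H (p.1, clampI (1 - valI p.2))); split => /=.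
- move=> p; apply: (@continuous_comp _ _ _
      (fun p : Z * unitI R => (p.1, clampI (1 - valI p.2))) H); last exact: cH.
  apply: (@cvg_pair _ _ _ (nbhs p) (nbhs p.1)
    (nbhs (clampI (1 - valI p.2))) _ _ _ fst
    (fun p : Z * unitI R => clampI (1 - valI p.2))); first exact: cvg_fst.
  apply: (@continuous_comp _ _ _ (fun p : Z * unitI R => 1 - valI p.2) clampI);
    last exact: clampI_cts.
  apply: cvgB; first exact: cvg_cst.
  by apply: (@continuous_comp _ _ _ (@snd Z (unitI R)) (@valI R));
    [exact: cvg_snd|exact: valI_cts].
- by move=> z; rewrite valI0 subr0 H1.
- by move=> z; rewrite valI1 subrr H0.
- by move=> z t Az; rewrite HA// -H1 HA.
Qed.

Lemma homotopic_rel_trans : transitive homotopic_rel.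
Proof.
move=> g f h /asboolP[H [cH H0 H1 HA]] /asboolP[K [cK K0 K1 KA]].
apply/asboolP; exists (paste H K); split.
- by apply: paste_cts => // z; rewrite H1 K0.
- by move=> z; rewrite paste0 H0.
- by move=> z; rewrite paste1 K1.
- move=> z t Az; rewrite /paste /=; case: ifP => _; first exact: HA.
  by rewrite KA// -H1 HA.
Qed.

Canonical homotopic_equiv := EquivRel homotopic_rel
  homotopic_rel_refl homotopic_rel_sym homotopic_rel_trans.

Definition homotopy_classes := {eq_quot homotopic_equiv}.
HB.instance Definition _ := Choice.on homotopy_classes.

Definition hclass (f : continuousType Z X) : homotopy_classes := \pi f.

End homotopy.
Arguments homotopy_classes R {Z} X A.
Arguments hclass R {Z X} A f.

Notation path_space R X := (continuousType (unitI R) X).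

Section paths.
Context (R : realType) (X : topologicalType).
Implicit Types a b g : path_space R X.

Definition concat_fun (a b : unitI R -> X) (t : unitI R) : X :=
  if valI t <= 2^-1 then a (clampI (2 * valI t))
  else b (clampI (2 * valI t - 1)).

Lemma concat_cts a b : a I1 = b I0 -> continuous (concat_fun a b).
Proof.
move=> ab t.
have csnd f : continuous (f : path_space R X) ->
    continuous (fun p : unitI R * unitI R => f p.2).
  move=> cf p; apply: (@continuous_comp _ _ _ (@snd (unitI R) (unitI R)) f);
    [exact: cvg_snd|exact: cf].
apply: (@continuous_comp _ _ _ (fun t : unitI R => (t, t))
  (paste (fun p => a p.2) (fun p => b p.2))).
  by apply: (@cvg_pair _ _ _ (nbhs t) (nbhs t) (nbhs t) _ _ _ id id);
    exact: cvg_id.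
by apply: paste_cts => //; apply: csnd; exact: cts_fun.
Qed.

Definition concat a b (ab : a I1 = b I0) : path_space R X :=
  mkcts (concat_cts ab).

Lemma concat0 a b (ab : a I1 = b I0) : concat ab I0 = a I0.
Proof. exact: (paste0 (fun p => a p.2) (fun p => b p.2) I0). Qed.

Lemma concat1 a b (ab : a I1 = b I0) : concat ab I1 = b I1.
Proof. exact: (paste1 (fun p => a p.2) (fun p => b p.2) I0). Qed.

Definition endpoints : set (unitI R) := [set I0; I1].

Definition Pi : Type := homotopy_classes R X endpoints.
HB.instance Definition _ := Choice.on Pi.

Definition path_class : path_space R X -> Pi := hclass R endpoints.

Definition path_connected (A : set X) := A !=set0 /\
  forall x y, A x -> A y -> exists g : path_space R X,
    [/\ range g `<=` A, g I0 = x & g I1 = y].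

(* the last clause says that [pi_1(U, x) -> pi_1(X, x)] is trivial *)
Definition nice (U : set X) := [/\ open U, path_connected U &
  forall x g, U x -> range g `<=` U -> g I0 = x -> g I1 = x ->
    path_class g = path_class (cst x)].

Definition Pi_base (U V : set X) g : set Pi := [set c |
  exists (d1 d2 : path_space R X) (e1 : d1 I1 = g I0) (e2 : g I1 = d2 I0),
    [/\ range d1 `<=` U, range d2 `<=` V &
        c = path_class (concat (etrans (concat1 e1) e2))]].

(* For arbitrary [X] the sets [Pi_base U V g] need only form a subbase; when
   the nice open sets form a basis of [X] they form a basis, so that the
   topology below is the one having them as basis. *)
HB.instance Definition _ := @isSubBaseTopological.Build Pi (set Pi)
  [set S | exists U V g,
    [/\ nice U, nice V, U (g I0), V (g I1) & S = Pi_base U V g]] id.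

Definition asphericity_cover (k : nat) := exists U : 'I_k.+1 -> set Pi,
  [/\ forall j, open (U j),
      \bigcup_j U j = [set: Pi] &
      forall j, exists s : U j -> path_space R X,
        continuous s /\ path_class \o s = set_val].

(* the (normalized) asphericity complexity AC(X) *)
Definition asphericity_complexity : \bar nat :=
  match pselect (exists k, `[< asphericity_cover k >]) with
  | left ex => (ex_minn ex)%:E
  | right _ => +oo%E
  end.

End paths.
Arguments path_connected R {X} A.

Section homotopy_groups.
Context (R : realType) (X : topologicalType).

Definition cube n : Type := 'rV[unitI R]_n.
HB.instance Definition _ n := Topological.copy (cube n) 'rV[unitI R]_n.

Definition cube_boundary n : set (cube n) :=
  [set v | exists i, v ord0 i = I0 \/ v ord0 i = I1].
Arguments cube_boundary : clear implicits.

(* the underlying set of the n-th homotopy group, for 0 < n *)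
Definition homotopy_group n (x : X) :
    set (homotopy_classes R X (cube_boundary n)) :=
  hclass R (cube_boundary n) @` [set f : continuousType (cube n) X |
    forall v, cube_boundary n v -> f v = x].
Arguments homotopy_group : clear implicits.

Definition aspherical := path_connected R [set: X] /\
  forall n x, (2 <= n)%N ->
    homotopy_group n x = [set hclass R (cube_boundary n) (cst x)].

End homotopy_groups.

Section CW_complexes.
Context (R : realType).

Definition sqnorm n (v : 'rV[R]_n) : R := \sum_i v ord0 i ^+ 2.
Definition disk n : set 'rV[R]_n := [set v | sqnorm v <= 1].
Arguments disk : clear implicits.
Definition disk_interior n : set (disk n) := [set v | sqnorm (set_val v) < 1].
Definition disk_boundary n : set (disk n) := [set v | sqnorm (set_val v) = 1].
Arguments disk_interior : clear implicits.
Arguments disk_boundary : clear implicits.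

Record CW_structure (X : topologicalType) := {
  cell : Type;
  cell_dim : cell -> nat;
  char_map : forall c, continuousType (disk (cell_dim c)) X;
  open_cell c := char_map c @` disk_interior (cell_dim c);
  closed_cell c := range (char_map c);
  CW_hausdorff : hausdorff_space X;
  (* with continuity, the next two clauses say that the characteristic maps
     restrict to homeomorphisms from the open disks onto the open cells *)
  char_map_inj : forall c,
    {in disk_interior (cell_dim c) &, injective (char_map c)};
  char_map_open : forall c (W : set (disk (cell_dim c))),
    open W -> W `<=` disk_interior (cell_dim c) ->
    exists2 O, open O & char_map c @` W = O `&` open_cell c;
  open_cell_cover : \bigcup_c open_cell c = [set: X];
  open_cell_trivIset : trivIset [set: cell] open_cell;
  closure_finite : forall c, exists F : set cell,
    [/\ finite_set F, forall d, F d -> (cell_dim d < cell_dim c)%N &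
        char_map c @` disk_boundary (cell_dim c) `<=`
          \bigcup_(d in F) open_cell d];
  weak_topology : forall B : set X,
    closed B <-> forall c, closed (B `&` closed_cell c)
}.

Definition locally_finite X (C : CW_structure X) :=
  forall x, finite_set [set c : cell C | closed_cell c x].

Definition countable_CW X (C : CW_structure X) := countable [set: cell C].

End CW_complexes.

(* the empty space is not connected *)
Definition connected_space (X : topologicalType) :=
  [set: X] !=set0 /\ connected [set: X].

(* Main.v *)
(** Since [Y] is a retract of [X * Y], it suffices to show that the quotient map
    from the path space of [X] to [Pi X] has a continuous global section [s]: a
    local section over [Pi Y] combined with [s] gives one over [Pi (X * Y)].

    Collars of the open cells, built by skeletal induction, cover [X] by countably
    many cozero sets [{t_i > 0}], each with a homotopy [h_i] in [X] from the
    inclusion to a map that is constant along paths. In particular [X] is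
    semilocally simply connected, and it is locally path connected by the weak
    topology. Asphericity gives, by induction on the cells of the universal covers
    of [X], a continuous choice [sigma] of a representative of each class of
    paths, for the topology where only the end point moves. Over [{t_i > 0}] the
    path [h_i x] lifts the starting point [x] to a universal cover, and [sigma]
    then deforms every path starting at [x], within its class, to one that depends
    on the class only. Performing these deformations one after the other, for
    decreasing [i] and up to a time depending on the starting point, yields [s]:
    a deformation that is carried out completely erases everything done before, so
    that near a given class only finitely many steps matter. *)

Require Import Defs.
From HB Require Import structures.
From mathcomp Require Import all_boot all_order all_algebra generic_quotient.
From mathcomp Require Import all_classical all_reals all_analysis.
From mathcomp Require Import ring lra.

Set Implicit Arguments.
Unset Strict Implicit.
Unset Printing Implicit Defensive.

Import Order.TTheory GRing.Theory Num.Theory.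
Import numFieldNormedType.Exports.
Import ArrowAsCompactOpen.

Local Open Scope classical_set_scope.
Local Open Scope ring_scope.

(** * Paths and the compact-open topology *)

(** In [Pi] both end points of a class move, whereas [sigma] is continuous only for moves of the
    end; and local sections over an open cover cannot be averaged, since paths have no convex
    combinations. This is why each local section is made the last stage of a deformation of the path
    space inside the classes: deformations can be composed, sections cannot. One collar serves all
    cells of one dimension at once, so collars are indexed by a dimension and a shrinking factor,
    that is, by pairs of natural numbers. In the universal covers the homotopy groups fill the cells
    of dimension at least 2; over a 1-cell the loop to be filled is trivial because the points of a
    universal cover are themselves classes. The groupoid laws come from one fact: in a normed space
    two paths with the same ends are homotopic along straight lines. Cells are normalised to balls
    of the sup norm, which are cubes and so match the homotopy groups. The space [X * Y] is used
    through its product topology, in which products of nice sets are nice. *)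

Section continuity_at_a_point.
Context {T U V W : topologicalType}.

Lemma cts_at_comp (f : T -> U) (g : U -> V) x :
  {for x, continuous f} -> {for f x, continuous g} ->
  {for x, continuous (fun z => g (f z))}.
Proof. exact: continuous_comp. Qed.

Lemma cts_comp (f : T -> U) (g : U -> V) :
  continuous f -> continuous g -> continuous (fun z => g (f z)).
Proof. by move=> cf cg x; apply: continuous_comp; [exact: cf|exact: cg]. Qed.

Lemma cts_at_pair (f : T -> U) (g : T -> V) x :
  {for x, continuous f} -> {for x, continuous g} ->
  {for x, continuous (fun z => (f z, g z))}.
Proof. by move=> cf cg; exact: (cvg_pair cf cg). Qed.

Lemma cts_at_cst (c : U) (x : T) : {for x, continuous (fun=> c)}.
Proof. exact: cvg_cst. Qed.

Lemma cts_at_near (f g : T -> U) x :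
  (\forall z \near x, f z = g z) ->
  {for x, continuous f} -> {for x, continuous g}.
Proof.
move=> fg cf; have fgx : f x = g x := nbhs_singleton fg.
rewrite /prop_for /continuous_at -fgx => A /cf fA.
by apply: filterS2 fg fA => z /= ->.
Qed.

Lemma cts_at_id (x : T) : {for x, continuous (fun z => z)}.
Proof. exact: cvg_id. Qed.

Lemma cts_at_fst (p : T * U) : {for p, continuous fst}.
Proof. exact: cvg_fst. Qed.

Lemma cts_at_snd (p : T * U) : {for p, continuous snd}.
Proof. exact: cvg_snd. Qed.

End continuity_at_a_point.

Section real_valued.
Context {R : realType} {T U : topologicalType}.

(** Each branch has to be continuous only on its own side of the threshold. This matters for
    boundary data of cells, which is not controlled at the centre. *)
Lemma cts_at_if (phi : T -> R) (c : R) (f g : T -> U) x :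
  {for x, continuous phi} ->
  (phi x <= c -> {for x, continuous f}) ->
  (c <= phi x -> {for x, continuous g}) ->
  (phi x = c -> f x = g x) ->
  {for x, continuous (fun z => if phi z <= c then f z else g z)}.
Proof.
move=> cphi cf cg fg; have [lt_pc|lt_cp|eq_pc] := ltgtP (phi x) c.
- apply: cts_at_near (cf (ltW lt_pc)).
  have : \forall z \near x, phi z < c by exact: (cphi [set y | y < c] (lt_nbhsl lt_pc)).
  by apply: filterS => z /ltW ->.
- apply: cts_at_near (cg (ltW lt_cp)).
  have : \forall z \near x, c < phi z by exact: (cphi [set y | c < y] (lt_nbhsr lt_cp)).
  by apply: filterS => z; rewrite ltNge => /negbTE ->.
- have [cfx cgx] : {for x, continuous f} /\ {for x, continuous g}.
    by split; [apply: cf|apply: cg]; rewrite eq_pc.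
  rewrite /prop_for /continuous_at eq_pc lexx => A Afx.
  have fA : nbhs x (f @^-1` A) := cfx _ Afx.
  have gA : nbhs x (g @^-1` A) by apply: (cgx A); rewrite -fg.
  by apply: filterS2 gA fA => z /=; case: ifP.
Qed.

Lemma cts_at_add (f g : T -> R) x : {for x, continuous f} ->
  {for x, continuous g} -> {for x, continuous (fun z => f z + g z)}.
Proof. by move=> cf cg; exact: (cvgD cf cg). Qed.

Lemma cts_at_sub (f g : T -> R) x : {for x, continuous f} ->
  {for x, continuous g} -> {for x, continuous (fun z => f z - g z)}.
Proof. by move=> cf cg; exact: (cvgB cf cg). Qed.

Lemma cts_at_mul (f g : T -> R) x : {for x, continuous f} ->
  {for x, continuous g} -> {for x, continuous (fun z => f z * g z)}.
Proof. by move=> cf cg; exact: (cvgM cf cg). Qed.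

Lemma cts_at_div (f g : T -> R) x : {for x, continuous f} ->
  {for x, continuous g} -> g x != 0 ->
  {for x, continuous (fun z => f z / g z)}.
Proof. by move=> cf cg g0; apply: (cvgM cf); exact: (cvgV g0 cg). Qed.

Lemma cts_at_inv (g : T -> R) x : {for x, continuous g} -> g x != 0 ->
  {for x, continuous (fun z => (g z)^-1)}.
Proof. by move=> cg g0; exact: (cvgV g0 cg). Qed.

Lemma cts_at_max (f g : T -> R) x : {for x, continuous f} ->
  {for x, continuous g} -> {for x, continuous (fun z => Num.max (f z) (g z))}.
Proof. by move=> cf cg; exact: continuous_max. Qed.

Lemma cts_at_min (f g : T -> R) x : {for x, continuous f} ->
  {for x, continuous g} -> {for x, continuous (fun z => Num.min (f z) (g z))}.
Proof. by move=> cf cg; exact: continuous_min. Qed.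

Lemma cts_at_scale (E : normedModType R) (f : T -> R) (g : T -> E) x :
  {for x, continuous f} -> {for x, continuous g} ->
  {for x, continuous (fun z => f z *: g z)}.
Proof. by move=> cf cg; exact: (cvgZ cf cg). Qed.

Lemma cts_at_addE (E : normedModType R) (f g : T -> E) x :
  {for x, continuous f} -> {for x, continuous g} ->
  {for x, continuous (fun z => f z + g z)}.
Proof. by move=> cf cg; exact: (cvgD cf cg). Qed.

Lemma cts_at_subE (E : normedModType R) (f g : T -> E) x :
  {for x, continuous f} -> {for x, continuous g} ->
  {for x, continuous (fun z => f z - g z)}.
Proof. by move=> cf cg; exact: (cvgB cf cg). Qed.

Lemma cts_at_norm (E : normedModType R) (f : T -> E) x :
  {for x, continuous f} -> {for x, continuous (fun z => `|f z|)}.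
Proof. by move=> cf; exact: (cvg_norm cf). Qed.

End real_valued.

Section clamp.
Context {R : realType}.

(** Together with [ev] it turns paths into functions on all of [R], constant outside the unit
    interval, so that parameters can be computed with freely. *)
Definition cl01 (s : R) : R := valI (clampI s).

Lemma cl01_ge0 s : 0 <= cl01 s. Proof. exact: valI_ge0. Qed.
Lemma cl01_le1 s : cl01 s <= 1. Proof. exact: valI_le1. Qed.
Lemma cl01_id s : 0 <= s -> s <= 1 -> cl01 s = s. Proof. exact: clampIK. Qed.
Lemma cl01K s : clampI (cl01 s) = clampI s.
Proof. by rewrite /cl01 valIK. Qed.

Lemma cl01E s : cl01 s = Num.max 0 (Num.min 1 s).
Proof. by rewrite /cl01 /valI set_valE. Qed.

Lemma cl01_le0 s : s <= 0 -> cl01 s = 0.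
Proof. by move=> s0; rewrite cl01E; apply/max_l; rewrite ge_min s0 orbT. Qed.

Lemma cl01_ge1 s : 1 <= s -> cl01 s = 1.
Proof. by move=> s1; rewrite cl01E min_l// max_r. Qed.

Lemma cl01_cts : continuous cl01.
Proof.
by move=> s; apply: (@continuous_comp _ _ _ clampI (@valI R));
  [exact: clampI_cts|exact: valI_cts].
Qed.

Lemma cts_at_cl01 {T : topologicalType} (f : T -> R) x :
  {for x, continuous f} -> {for x, continuous (fun z => cl01 (f z))}.
Proof. by move=> cf; apply: cts_at_comp => //; exact: cl01_cts. Qed.

Lemma unitI_compact : compact [set: unitI R].
Proof.
have -> : [set: unitI R] = clampI @` `[0:R, 1%R].
  rewrite eqEsubset; split => // t _; exists (valI t); rewrite ?valIK//=.
  by rewrite in_itv /= valI_ge0 valI_le1.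
apply: continuous_compact; last exact: segment_compact.
by apply: continuous_subspaceT; exact: clampI_cts.
Qed.

Lemma valI_inj : injective (@valI R).
Proof. by move=> s t st; rewrite -(valIK s) st valIK. Qed.

Lemma unitI_hausdorff : hausdorff_space (unitI R).
Proof.
move=> s t cst; apply: valI_inj; apply: (@norm_hausdorff R R) => A B As Bt.
have [z [Az Bz]] := cst _ _ (valI_cts As) (valI_cts Bt).
by exists (valI z).
Qed.

Lemma unitI_locally_compact : locally_compact [set: unitI R].
Proof.
move=> t _; exists setT; first by rewrite withinET; exact: filterT.
by split; [exact: unitI_compact|exact: closedT].
Qed.

Lemma unitI_regular : regular_space (unitI R).
Proof.
move=> t; apply: (@compact_regular _ t setT) => //.
- exact: unitI_hausdorff.
- exact: unitI_compact.
- exact: filterT.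
Qed.

End clamp.

Section path_space_topology.
Context {R : realType} {X : topologicalType}.

Definition ev (g : path_space R X) (s : R) : X := g (clampI s).

Lemma ev_cts g : continuous (ev g).
Proof.
by move=> s; apply: (@continuous_comp _ _ _ clampI g); [exact: clampI_cts|exact: cts_fun].
Qed.

Lemma ev_cl01 g s : ev g (cl01 s) = ev g s.
Proof. by rewrite /ev cl01K. Qed.

Lemma ev0 g : ev g 0 = g I0. Proof. by []. Qed.
Lemma ev1 g : ev g 1 = g I1. Proof. by []. Qed.
Lemma ev_valI g t : ev g (valI t) = g t. Proof. by rewrite /ev valIK. Qed.

Lemma path_ext (g h : path_space R X) :
  (forall s, 0 <= s -> s <= 1 -> ev g s = ev h s) -> g = h.
Proof.
move=> gh; apply/continuousEP => t.
by rewrite -!ev_valI gh ?valI_ge0 ?valI_le1.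
Qed.

Lemma mkp_subproof (f : R -> X) : continuous f -> continuous (f \o @valI R).
Proof.
by move=> cf t; apply: continuous_comp; [exact: valI_cts|exact: cf].
Qed.

(* constant path when [f] is not continuous *)
Definition mkp (f : R -> X) : path_space R X :=
  match pselect (continuous f) with
  | left cf => mkcts (mkp_subproof cf)
  | right _ => cst (f 0)
  end.

Lemma mkpE f t : continuous f -> mkp f t = f (valI t).
Proof. by move=> cf; rewrite /mkp; case: pselect. Qed.

Lemma ev_mkp f s : continuous f -> ev (mkp f) s = f (cl01 s).
Proof. by move=> cf; rewrite /ev mkpE. Qed.

(** Exponential law at one point: evaluation is continuous because the interval is locally compact
    and regular; conversely a compact set of parameters is controlled uniformly near [w], as in the
    tube lemma. Many families below are continuous at some points only, hence the pointwise form. *)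
Lemma path_cts_atP {W : topologicalType} (g : W -> path_space R X) (w : W) :
  {for w, continuous g} <->
  forall s : R, {for (w, s), continuous (fun p : W * R => ev (g p.1) p.2)}.
Proof.
split=> [cg s|cg].
  have ce := eval_continuous (Y := X) (@unitI_locally_compact R)
    (@unitI_regular R).
  apply: (@cts_at_comp _ _ _ (fun p : W * R => (g p.1, clampI p.2)) (@eval _ _)).
    apply: cts_at_pair.
      by apply: (@cts_at_comp _ _ _ fst g) => //; exact: cts_at_fst.
    by apply: (@cts_at_comp _ _ _ snd clampI);
      [exact: cts_at_snd|exact: clampI_cts].
  exact: ce.
have FF : Filter ((fun w => (g w : unitI R -> X)) @ w) by exact: fmap_filter.
(* The path space has the topology induced from all maps, so continuity may be tested there. *)
suff cg' : {for w, continuous (fun w => (g w : unitI R -> X))}.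
  move=> A [B [[C oC <-] /= Cgw] CA]; rewrite nbhs_simpl /=.
  have /cg' : nbhs (g w : unitI R -> X) C by exact: open_nbhs_nbhs.
  by rewrite nbhs_simpl /=; apply: filterS => z /= Cz; exact: CA.
apply/compact_open_cvgP => K O cK oO gKO /=.
near=> z => _ /= [+ + <-]; near: z.
move/compact_near_coveringP/near_covering_withinP : cK; apply => t Kt.
have : nbhs (ev (g w) (valI t)) O.
  by apply: open_nbhs_nbhs; split=> //; apply: gKO; exists t; rewrite ?ev_valI.
move=> /(cg (valI t)) [[P Q] /= [Pw Qt] PQO].
exists (@valI R @^-1` Q, P) => /=; first by split => //; exact: valI_cts.
by move=> [t' z] /= [Qt' Pz] _; rewrite -ev_valI; exact: (PQO (z, valI t')).
Unshelve. all: by end_near. Qed.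

Lemma path_cts_at {W : topologicalType} (g : W -> path_space R X) (h : W -> R)
    (w : W) : {for w, continuous g} -> {for w, continuous h} ->
  {for w, continuous (fun w => ev (g w) (h w))}.
Proof.
move=> /path_cts_atP cg ch.
exact: (@cts_at_comp _ _ _ (fun w => (w, h w)) (fun p : W * R => ev (g p.1) p.2)
  w (cts_at_pair (@cts_at_id _ w) ch) (cg _)).
Qed.

Lemma mkp_cts_at {W : topologicalType} (G : W -> R -> X) (w : W) :
  (forall w, continuous (G w)) ->
  (forall s, {for (w, s), continuous (fun p : W * R => G p.1 p.2)}) ->
  {for w, continuous (fun w => mkp (G w))}.
Proof.
move=> cG cGw; apply/path_cts_atP => s.
rewrite (_ : (fun p : W * R => _) = (fun p : W * R => G p.1 (cl01 p.2))).
  apply: (@cts_at_comp _ _ _ (fun p : W * R => (p.1, cl01 p.2))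
    (fun p : W * R => G p.1 p.2)); last exact: cGw.
  apply: cts_at_pair; first exact: cts_at_fst.
  by apply: cts_at_cl01; exact: cts_at_snd.
by apply/funext => p; rewrite ev_mkp.
Qed.

Definition pcst (x : X) : path_space R X := cst x.

Lemma pcst_cts : continuous pcst.
Proof.
move=> x; apply/path_cts_atP => s; exact: cts_at_fst.
Qed.

End path_space_topology.

(** * The fundamental groupoid *)

Section groupoid.
Context {R : realType} {X : topologicalType}.
Implicit Types (f g h : R -> X) (b c d : Pi R X) (x y : X).

Lemma path_class_surj b : exists g : path_space R X, path_class g = b.
Proof. by elim/quotW: b => g; exists g. Qed.

Definition rep b : path_space R X := projT1 (cid (path_class_surj b)).

Lemma repK b : path_class (rep b) = b.
Proof. by rewrite /rep; case: cid. Qed.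

Lemma path_class_homotopy (a a' : path_space R X) :
  path_class a = path_class a' -> exists H : R * R -> X,
    [/\ continuous H, forall s, H (s, 0) = ev a s, forall s, H (s, 1) = ev a' s
      & forall t, H (0, t) = ev a 0 /\ H (1, t) = ev a 1].
Proof.
move=> /eqquotP /asboolP [H [cH H0 H1 HA]].
exists (fun p => H (clampI p.1, clampI p.2)); split => /=.
- move=> p; apply: (@cts_at_comp _ _ _
    (fun p : R * R => (clampI p.1, clampI p.2)) H); last exact: cH.
  apply: cts_at_pair.
    by apply: (@cts_at_comp _ _ _ fst clampI);
      [exact: cts_at_fst|exact: clampI_cts].
  by apply: (@cts_at_comp _ _ _ snd clampI);
    [exact: cts_at_snd|exact: clampI_cts].
- by move=> s; rewrite -[clampI 0]/I0 H0.
- by move=> s; rewrite -[clampI 1]/I1 H1.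
- by move=> t; split; rewrite HA//; [left|right].
Qed.

Definition cls f : Pi R X := path_class (mkp f).

Lemma cls_ev (a : path_space R X) : cls (ev a) = path_class a.
Proof.
congr path_class; apply: path_ext => s s0 s1.
by rewrite ev_mkp ?ev_cl01//; exact: ev_cts.
Qed.

Lemma cls_eq f g : continuous f -> continuous g ->
  (forall s, 0 <= s -> s <= 1 -> f s = g s) -> cls f = cls g.
Proof.
move=> cf cg fg; congr path_class; apply: path_ext => s s0 s1.
by rewrite !ev_mkp// cl01_id// fg.
Qed.

Lemma cls_homotopy (H : R * R -> X) : continuous H ->
  (forall t, 0 <= t -> t <= 1 -> H (0, t) = H (0, 0)) ->
  (forall t, 0 <= t -> t <= 1 -> H (1, t) = H (1, 0)) ->
  cls (fun s => H (s, 0)) = cls (fun s => H (s, 1)).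
Proof.
move=> cH H0 H1.
have cHt t : continuous (fun s => H (s, t)).
  move=> s; apply: (@cts_at_comp _ _ _ (fun s : R => (s, t)) H) (cH _).
  by apply: cts_at_pair; [exact: cts_at_id|exact: cts_at_cst].
apply/eqquotP/asboolP; exists (fun p => H (valI p.1, valI p.2)); split.
- move=> p; apply: (@cts_at_comp _ _ _
    (fun p : unitI R * unitI R => (valI p.1, valI p.2)) H); last exact: cH.
  apply: cts_at_pair.
    by apply: (@cts_at_comp _ _ _ fst (@valI R));
      [exact: cts_at_fst|exact: valI_cts].
  by apply: (@cts_at_comp _ _ _ snd (@valI R));
    [exact: cts_at_snd|exact: valI_cts].
- by move=> z; rewrite /= valI0 mkpE.
- by move=> z; rewrite /= valI1 mkpE.
- move=> z t /= [->|->]; rewrite mkpE//=.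
    by rewrite valI0 H0 ?valI_ge0 ?valI_le1.
  by rewrite valI1 H1 ?valI_ge0 ?valI_le1.
Qed.

Lemma cls_surj b : exists2 f, continuous f & b = cls f.
Proof. by exists (ev (rep b)); [exact: ev_cts|rewrite cls_ev repK]. Qed.

Definition src b : X := ev (rep b) 0.
Definition tgt b : X := ev (rep b) 1.

Lemma path_class_ends (a a' : path_space R X) : path_class a = path_class a' ->
  ev a 0 = ev a' 0 /\ ev a 1 = ev a' 1.
Proof.
move=> /path_class_homotopy [H [_ _ H1 Ht]].
by rewrite -!H1; case: (Ht 1) => -> ->.
Qed.

Lemma src_path (a : path_space R X) : src (path_class a) = ev a 0.
Proof. exact: (path_class_ends (repK _)).1. Qed.

Lemma tgt_path (a : path_space R X) : tgt (path_class a) = ev a 1.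
Proof. exact: (path_class_ends (repK _)).2. Qed.

Lemma src_cls f : continuous f -> src (cls f) = f 0.
Proof. by move=> cf; rewrite src_path ev_mkp// cl01_le0. Qed.

Lemma tgt_cls f : continuous f -> tgt (cls f) = f 1.
Proof. by move=> cf; rewrite tgt_path ev_mkp// cl01_ge1. Qed.

Definition cat f g (s : R) : X :=
  if s <= 2^-1 then f (cl01 (2 * s)) else g (cl01 (2 * s - 1)).

(** The parameter [t] allows both halves to vary, as they do when homotopies are concatenated. *)
Lemma cat_cts2 {T : topologicalType} (F G : T * R -> X) (phi : T -> R) :
  continuous F -> continuous G -> continuous phi ->
  (forall t, F (t, 1) = G (t, 0)) ->
  continuous (fun t => cat (fun s => F (t, s)) (fun s => G (t, s)) (phi t)).
Proof.
move=> cF cG cphi FG t.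
apply: (@cts_at_if _ _ _ phi 2^-1 (fun t => F (t, cl01 (2 * phi t)))
  (fun t => G (t, cl01 (2 * phi t - 1)))) => [|_|_|->].
- exact: cphi.
- apply: (@cts_at_comp _ _ _ (fun t => (t, cl01 (2 * phi t))) F); last exact: cF.
  apply: cts_at_pair; first exact: cts_at_id.
  by apply: cts_at_cl01; apply: cts_at_mul; [exact: cts_at_cst|exact: cphi].
- apply: (@cts_at_comp _ _ _ (fun t => (t, cl01 (2 * phi t - 1))) G);
    last exact: cG.
  apply: cts_at_pair; first exact: cts_at_id.
  apply: cts_at_cl01; apply: cts_at_sub; last exact: cts_at_cst.
  by apply: cts_at_mul; [exact: cts_at_cst|exact: cphi].
- by rewrite mulfV// cl01_ge1// subrr cl01_le0.
Qed.

Lemma cat_cts f g : continuous f -> continuous g -> f 1 = g 0 ->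
  continuous (cat f g).
Proof.
move=> cf cg fg; apply: (@cat_cts2 R (fun p => f p.2) (fun p => g p.2) id) => //.
- by move=> p; apply: (@cts_at_comp _ _ _ snd f); [exact: cts_at_snd|exact: cf].
- by move=> p; apply: (@cts_at_comp _ _ _ snd g); [exact: cts_at_snd|exact: cg].
- by move=> t; exact: cts_at_id.
Qed.

Lemma cat0 f g : cat f g 0 = f 0.
Proof. by rewrite /cat invr_ge0 ler0n mulr0 cl01_le0. Qed.

Lemma cat1 f g : cat f g 1 = g 1.
Proof.
rewrite /cat ifF; first by rewrite cl01_ge1//; lra.
by apply/negbTE; rewrite -ltNge; lra.
Qed.

(** A total operation, meaningful only if [tgt b = src c]: on a discontinuous function [mkp] falls
    back to a constant path. *)
Definition pmul b c : Pi R X := cls (cat (ev (rep b)) (ev (rep c))).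

Lemma pmul_path (a a' : path_space R X) : ev a 1 = ev a' 0 ->
  pmul (path_class a) (path_class a') = cls (cat (ev a) (ev a')).
Proof.
move=> aa'; have /path_class_homotopy[H [cH H0 H1 Ht]] := repK (path_class a).
have /path_class_homotopy[K [cK K0 K1 Kt]] := repK (path_class a').
pose L (p : R * R) := cat (fun s => H (s, p.2)) (fun s => K (s, p.2)) p.1.
have HK t : H (1, t) = K (0, t).
  have [_ ->] := Ht t; have [-> _] := Kt t.
  by rewrite -[LHS]/(tgt _) -[RHS]/(src _) tgt_path src_path.
have cL : continuous L.
  apply: (@cat_cts2 _ (fun q : (R * R) * R => H (q.2, q.1.2))
    (fun q : (R * R) * R => K (q.2, q.1.2)) fst).
  - move=> q; apply: (@cts_at_comp _ _ _
      (fun q : (R * R) * R => (q.2, q.1.2)) H); last exact: cH.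
    apply: cts_at_pair; first exact: cts_at_snd.
    by apply: (@cts_at_comp _ _ _ fst snd); [exact: cts_at_fst|exact: cts_at_snd].
  - move=> q; apply: (@cts_at_comp _ _ _
      (fun q : (R * R) * R => (q.2, q.1.2)) K); last exact: cK.
    apply: cts_at_pair; first exact: cts_at_snd.
    by apply: (@cts_at_comp _ _ _ fst snd); [exact: cts_at_fst|exact: cts_at_snd].
  - by move=> p; exact: cts_at_fst.
  - by move=> p /=; exact: HK.
have -> : pmul (path_class a) (path_class a') = cls (fun s => L (s, 0)).
  by congr cls; apply/funext => s; rewrite /L /cat /= H0 K0.
have -> : cls (cat (ev a) (ev a')) = cls (fun s => L (s, 1)).
  by congr cls; apply/funext => s; rewrite /L /cat /= H1 K1.
apply: cls_homotopy => // t _ _; rewrite /L.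
  by rewrite !cat0 (Ht t).1 (Ht 0).1.
by rewrite !cat1 (Kt t).2 (Kt 0).2.
Qed.

Lemma pmul_cls f g : continuous f -> continuous g -> f 1 = g 0 ->
  pmul (cls f) (cls g) = cls (cat f g).
Proof.
move=> cf cg fg; rewrite pmul_path; last first.
  by rewrite !ev_mkp// cl01_ge1// cl01_le0.
apply: cls_eq => [||s s0 s1]; last by rewrite /cat !ev_mkp// /cl01 !valIK.
- by apply: cat_cts; [exact: ev_cts..|rewrite !ev_mkp// cl01_ge1// cl01_le0].
- exact: cat_cts.
Qed.

Lemma pmul_concat (a a' : path_space R X) (aa' : a I1 = a' I0) :
  path_class (concat aa') = pmul (path_class a) (path_class a').
Proof.
rewrite pmul_path//; congr path_class; apply/continuousEP => t.
rewrite mkpE; last by apply: cat_cts => //; exact: ev_cts.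
by rewrite /concat /= /cat /mkcts /= /concat_fun /ev !cl01K.
Qed.

Lemma src_pmul b c : tgt b = src c -> src (pmul b c) = src b.
Proof.
by move=> bc; rewrite src_cls ?cat0//; apply: cat_cts => //; exact: ev_cts.
Qed.

Lemma tgt_pmul b c : tgt b = src c -> tgt (pmul b c) = tgt c.
Proof.
by move=> bc; rewrite tgt_cls ?cat1//; apply: cat_cts => //; exact: ev_cts.
Qed.

Definition punit x : Pi R X := cls (fun=> x).

Lemma punitE x : punit x = path_class (cst x).
Proof.
rewrite /punit /cls; congr path_class; apply/continuousEP => t.
by rewrite mkpE// => s; exact: cts_at_cst.
Qed.

Lemma src_punit x : src (punit x) = x.
Proof. by rewrite src_cls// => s; exact: cts_at_cst. Qed.

Lemma tgt_punit x : tgt (punit x) = x.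
Proof. by rewrite tgt_cls// => s; exact: cts_at_cst. Qed.

Section segments.
Context {E : normedModType R}.
Implicit Types (phi : E -> X) (u v w : E).

(** One notion for three uses: [E] is the line for reparametrisations, the plane for homotopy
    squares and ['rV[R]_n] for characteristic maps. *)
Definition seg phi u v : Pi R X := cls (fun s => phi (u + s *: (v - u))).

(** Straight-line homotopy from [p] to [p'], carried over by [phi]. *)
Lemma cls_convex phi (p p' : R -> E) : continuous phi -> continuous p ->
  continuous p' -> p 0 = p' 0 -> p 1 = p' 1 ->
  cls (fun s => phi (p s)) = cls (fun s => phi (p' s)).
Proof.
move=> cphi cp cp' p0 p1.
pose H (q : R * R) := phi (p q.1 + q.2 *: (p' q.1 - p q.1)).
have -> : cls (fun s => phi (p s)) = cls (fun s => H (s, 0)).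
  by congr cls; apply/funext => s; rewrite /H /= scale0r addr0.
have -> : cls (fun s => phi (p' s)) = cls (fun s => H (s, 1)).
  by congr cls; apply/funext => s; rewrite /H /= scale1r subrKC.
apply: cls_homotopy => [q|t _ _|t _ _]; last 2 first.
- by rewrite /H /= p0 subrr !scaler0.
- by rewrite /H /= p1 subrr !scaler0.
have c1 : {for q, continuous (fun q : R * R => p q.1)}.
  by apply: (@cts_at_comp _ _ _ fst p); [exact: cts_at_fst|exact: cp].
have c2 : {for q, continuous (fun q : R * R => p' q.1)}.
  by apply: (@cts_at_comp _ _ _ fst p'); [exact: cts_at_fst|exact: cp'].
apply: (@cts_at_comp _ _ _
  (fun q : R * R => p q.1 + q.2 *: (p' q.1 - p q.1)) phi); last exact: cphi.
apply: cts_at_addE => //; apply: cts_at_scale; first exact: cts_at_snd.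
exact: cts_at_subE.
Qed.

Lemma line_cts u v : continuous (fun s : R => u + s *: (v - u)).
Proof.
move=> s; apply: (@cts_at_addE R R E); first exact: cts_at_cst.
by apply: (@cts_at_scale R R E); [exact: cts_at_id|exact: cts_at_cst].
Qed.

Lemma seg_fun_cts phi u v : continuous phi ->
  continuous (fun s : R => phi (u + s *: (v - u))).
Proof.
move=> cphi s; apply: (@cts_at_comp R E _ (fun s : R => u + s *: (v - u)) phi).
  exact: line_cts.
exact: cphi.
Qed.

Lemma cls_comp_seg phi (p : R -> E) : continuous phi -> continuous p ->
  cls (fun s => phi (p s)) = seg phi (p 0) (p 1).
Proof.
move=> cphi cp; apply: cls_convex => //; first exact: line_cts.
  by rewrite scale0r addr0.
by rewrite scale1r subrKC.
Qed.

Lemma src_seg phi u v : continuous phi -> src (seg phi u v) = phi u.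
Proof.
by move=> cphi; rewrite src_cls ?scale0r ?addr0//; exact: seg_fun_cts.
Qed.

Lemma tgt_seg phi u v : continuous phi -> tgt (seg phi u v) = phi v.
Proof.
by move=> cphi; rewrite tgt_cls ?scale1r ?subrKC//; exact: seg_fun_cts.
Qed.

Lemma seg_refl phi u : seg phi u u = punit (phi u).
Proof. by congr cls; apply/funext => s; rewrite subrr scaler0 addr0. Qed.

End segments.

Lemma line_cat_cts {E : normedModType R} (u v w : E) :
  continuous (fun s : R =>
    if s <= 2^-1 then u + cl01 (2 * s) *: (v - u)
    else v + cl01 (2 * s - 1) *: (w - v)).
Proof.
move=> s; apply: (@cts_at_if _ _ _ id 2^-1) => [|_|_|/= ->].
- exact: cts_at_id.
- apply: (@cts_at_addE R R E); first exact: cts_at_cst.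
  apply: (@cts_at_scale R R E); last exact: cts_at_cst.
  by apply: cts_at_cl01; apply: cts_at_mul; [exact: cts_at_cst|exact: cts_at_id].
- apply: (@cts_at_addE R R E); first exact: cts_at_cst.
  apply: (@cts_at_scale R R E); last exact: cts_at_cst.
  apply: cts_at_cl01; apply: cts_at_sub; last exact: cts_at_cst.
  by apply: cts_at_mul; [exact: cts_at_cst|exact: cts_at_id].
- by rewrite mulfV// cl01_ge1// subrr cl01_le0// scale1r scale0r addr0 subrKC.
Qed.

Lemma seg_mul {E : normedModType R} (phi : E -> X) (u v w : E) :
  continuous phi -> pmul (seg phi u v) (seg phi v w) = seg phi u w.
Proof.
move=> cphi; rewrite pmul_cls; [|exact: seg_fun_cts..|]; last first.
  by rewrite scale1r scale0r addr0 subrKC.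
pose p (s : R) := if s <= 2^-1 then u + cl01 (2 * s) *: (v - u)
    else v + cl01 (2 * s - 1) *: (w - v).
rewrite (_ : cat _ _ = fun s => phi (p s)); last first.
  by apply/funext => s; rewrite /cat /p; case: ifP.
rewrite (cls_comp_seg cphi (@line_cat_cts _ u v w)); congr (seg phi _ _).
  by rewrite invr_ge0 ler0n mulr0 cl01_le0// scale0r addr0.
rewrite ifF; first by rewrite cl01_ge1 ?scale1r ?subrKC//; lra.
by apply/negbTE; rewrite -ltNge; lra.
Qed.

Lemma cls_seg f : continuous f -> cls f = seg f 0 1.
Proof. by move=> cf; apply: (@cls_comp_seg R f id cf) => s; exact: cts_at_id. Qed.

(* reduces associativity to [seg_mul] *)
Lemma three_segments b c d : tgt b = src c -> tgt c = src d ->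
  exists w : R -> X, [/\ continuous w,
    b = seg w 0 1, c = seg w 1 2 & d = seg w 2 3].
Proof.
move=> bc cd; pose f := ev (rep b); pose g := ev (rep c); pose h := ev (rep d).
pose gh s := if s <= 2 then g (cl01 (s - 1)) else h (cl01 (s - 2)).
pose w s := if s <= 1 then f (cl01 s) else gh s.
have [cf cg ch] : [/\ continuous f, continuous g & continuous h].
  by split; exact: ev_cts.
have cgh : continuous gh.
  move=> s; apply: (@cts_at_if _ _ _ id 2) => [|_|_|/= ->].
  - exact: cts_at_id.
  - apply: (@cts_at_comp R R _ (fun s => cl01 (s - 1)) g) (cg _).
    by apply: cts_at_cl01; apply: cts_at_sub; [exact: cts_at_id|exact: cts_at_cst].
  - apply: (@cts_at_comp R R _ (fun s => cl01 (s - 2)) h) (ch _).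
    by apply: cts_at_cl01; apply: cts_at_sub; [exact: cts_at_id|exact: cts_at_cst].
  - by rewrite cl01_ge1 ?subrr ?cl01_le0//; lra.
have cw : continuous w.
  move=> s; apply: (@cts_at_if _ _ _ id 1) => [|_|_|/= ->].
  - exact: cts_at_id.
  - apply: (@cts_at_comp R R _ (fun s => cl01 s) f) (cf _).
    by apply: cts_at_cl01; exact: cts_at_id.
  - exact: cgh.
  - by rewrite /gh ifT ?ler1n// subrr cl01_ge1// cl01_le0.
exists w; split => //.
- rewrite -{1}(repK b) -cls_ev; apply: cls_eq => [||s s0 s1].
  + exact: cf.
  + exact: seg_fun_cts.
  + by rewrite add0r subr0 /w [_ *: _]mulr1 s1 cl01_id.
- rewrite -{1}(repK c) -cls_ev; apply: cls_eq => [||s s0 s1].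
  + exact: cg.
  + exact: seg_fun_cts.
  + rewrite (_ : 1 + s *: (2 - 1) = 1 + s); last by rewrite -[_ *: _]/(_ * _); lra.
    rewrite /w; case: ifPn => [s1'|]; last first.
      by rewrite /gh ifT ?[1 + s - 1]addrAC ?subrr ?add0r ?cl01_id//; lra.
    have -> : s = 0 by lra.
    by rewrite cl01_ge1 ?addr0// /f /g -[LHS]/(src c) -bc.
- rewrite -{1}(repK d) -cls_ev; apply: cls_eq => [||s s0 s1].
  + exact: ch.
  + exact: seg_fun_cts.
  + rewrite (_ : 2 + s *: (3 - 2) = 2 + s); last by rewrite -[_ *: _]/(_ * _); lra.
    rewrite /w ifF; last by apply/negbTE; rewrite -ltNge; lra.
    rewrite /gh; case: ifPn => [s1'|_]; last first.
      by rewrite [2 + s - 2]addrAC subrr add0r cl01_id.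
    have -> : s = 0 by lra.
    by rewrite cl01_ge1 /h /g -?[LHS]/(src d) -?cd//; lra.
Qed.

Lemma pmulA b c d : tgt b = src c -> tgt c = src d ->
  pmul b (pmul c d) = pmul (pmul b c) d.
Proof.
move=> bc cd; have [w [cw -> -> ->]] := three_segments bc cd.
by rewrite !seg_mul.
Qed.

Lemma pmul1 b x : x = tgt b -> pmul b (punit x) = b.
Proof.
move=> ->; have [f cf ->] := cls_surj b.
by rewrite tgt_cls// cls_seg// -seg_refl seg_mul.
Qed.

Lemma pmul1l b x : x = src b -> pmul (punit x) b = b.
Proof.
move=> ->; have [f cf ->] := cls_surj b.
by rewrite src_cls// cls_seg// -seg_refl seg_mul.
Qed.

Definition pflip b : Pi R X := seg (ev (rep b)) 1 0.

Lemma pflipP b : exists f, [/\ continuous f, b = seg f 0 1 & pflip b = seg f 1 0].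
Proof.
exists (ev (rep b)); split => //; first exact: ev_cts.
by rewrite -cls_seg ?cls_ev ?repK//; exact: ev_cts.
Qed.

Lemma src_pflip b : src (pflip b) = tgt b.
Proof. by rewrite src_seg//; exact: ev_cts. Qed.

Lemma tgt_pflip b : tgt (pflip b) = src b.
Proof. by rewrite tgt_seg//; exact: ev_cts. Qed.

Lemma pmulV b : pmul b (pflip b) = punit (src b).
Proof. by have [f [cf -> ->]] := pflipP b; rewrite src_seg// seg_mul// seg_refl. Qed.

Lemma pmulVl b : pmul (pflip b) b = punit (tgt b).
Proof. by have [f [cf -> ->]] := pflipP b; rewrite tgt_seg// seg_mul// seg_refl. Qed.

Lemma pmulVK b c : tgt b = tgt c -> pmul (pmul b (pflip c)) c = b.
Proof. by move=> bc; rewrite -pmulA ?src_pflip ?tgt_pflip// pmulVl pmul1. Qed.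

(** Since [pflip] reverses an unknown representative, this is uniqueness of inverses in the
    groupoid. *)
Lemma seg_inv {E : normedModType R} (phi : E -> X) (u v : E) :
  continuous phi -> pflip (seg phi u v) = seg phi v u.
Proof.
move=> cphi; rewrite -[LHS](@pmul1 _ (phi u)) ?tgt_pflip ?src_seg//.
rewrite -(seg_refl phi u) -(@seg_mul _ phi u v u)// pmulA ?tgt_pflip ?src_seg ?tgt_seg//.
by rewrite pmulVl pmul1l// src_seg ?tgt_seg.
Qed.

(** The small moves inside [V]: neighbourhoods in both topologies on classes are obtained by
    multiplying with such elements. *)
Definition PV (V : set X) : set (Pi R X) :=
  [set c | exists f, [/\ continuous f, forall s, V (f s) & c = cls f]].

Lemma PV_src V c : PV V c -> V (src c).
Proof. by move=> [f [cf Vf ->]]; rewrite src_cls. Qed.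

Lemma PV_tgt V c : PV V c -> V (tgt c).
Proof. by move=> [f [cf Vf ->]]; rewrite tgt_cls. Qed.

Lemma PV_path V (g : path_space R X) : range g `<=` V -> PV V (path_class g).
Proof.
move=> gV; exists (ev g); split; [exact: ev_cts| |by rewrite cls_ev].
by move=> s; apply: gV; exists (clampI s).
Qed.

Lemma PV_pathP V c : PV V c ->
  exists2 g : path_space R X, range g `<=` V & c = path_class g.
Proof.
move=> [f [cf Vf ->]]; exists (mkp f) => // _ [t _ <-].
by rewrite mkpE.
Qed.

Lemma PV_sub V W c : V `<=` W -> PV V c -> PV W c.
Proof. by move=> VW [f [cf Vf ->]]; exists f; split => // s; exact: VW. Qed.

Lemma PV_unit V x : V x -> PV V (punit x).
Proof. by move=> Vx; exists (fun=> x); split => // s; exact: cts_at_cst. Qed.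

Lemma PV_mul V b c : tgt b = src c -> PV V b -> PV V c -> PV V (pmul b c).
Proof.
move=> + [f [cf Vf fE]] [g [cg Vg gE]]; rewrite fE gE tgt_cls// src_cls// => fg.
exists (cat f g); split; [exact: cat_cts| |by rewrite pmul_cls].
by move=> s; rewrite /cat; case: ifP.
Qed.

Lemma PV_inv V b : PV V b -> PV V (pflip b).
Proof.
move=> [f [cf Vf ->]]; exists (fun s => f (1 + s *: (0 - 1))); split => //.
  exact: seg_fun_cts.
by rewrite cls_seg// seg_inv.
Qed.

Lemma PV_seg {E : normedModType R} V (phi : E -> X) (u v : E) :
  continuous phi ->
  (forall s, 0 <= s -> s <= 1 -> V (phi (u + s *: (v - u)))) ->
  PV V (seg phi u v).
Proof.
move=> cphi Vphi; exists (fun s => phi (u + cl01 s *: (v - u))); split.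
- move=> s; apply: (@cts_at_comp R R _ cl01 (fun s => phi (u + s *: (v - u)))).
    exact: cl01_cts.
  exact: seg_fun_cts.
- by move=> s; apply: Vphi; [exact: cl01_ge0|exact: cl01_le1].
- apply: cls_eq => [||s s0 s1]; first exact: seg_fun_cts.
    move=> s; apply: (@cts_at_comp R R _ cl01 (fun s => phi (u + s *: (v - u)))).
      exact: cl01_cts.
    exact: seg_fun_cts.
  by rewrite cl01_id.
Qed.

(** Two classes in [U] with common ends differ by a loop in [U], so triviality of the map on
    fundamental groups amounts to uniqueness of a class with given ends. *)
Lemma niceP (U : set X) : nice R U <-> [/\ open U, U !=set0,
  (forall x y, U x -> U y -> exists2 c, PV U c & src c = x /\ tgt c = y) &
  (forall b c, PV U b -> PV U c -> src b = src c -> tgt b = tgt c -> b = c)].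
Proof.
split=> [[oU [U0 pU] lU]|[oU U0 pU lU]]; split => //.
- move=> x y Ux Uy; have [g [gU g0 g1]] := pU x y Ux Uy.
  exists (path_class g); first exact: PV_path.
  by rewrite src_path tgt_path ev0 ev1.
- move=> b c Ub Uc sbc tbc.
  have bc : tgt b = src (pflip c) by rewrite src_pflip.
  have /PV_pathP[g gU gE] : PV U (pmul b (pflip c)) by apply: PV_mul => //; exact: PV_inv.
  have g0 : g I0 = src b by rewrite -ev0 -src_path -gE src_pmul.
  have g1 : g I1 = src b by rewrite -ev1 -tgt_path -gE tgt_pmul// tgt_pflip.
  have := lU (src b) g (PV_src Ub) gU g0 g1; rewrite -gE -punitE => e.
  by rewrite -(pmulVK tbc) e pmul1l.
- split=> // x y Ux Uy; have [c /PV_pathP[g gU ->] []] := pU x y Ux Uy.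
  by rewrite src_path tgt_path ev0 ev1 => g0 g1; exists g.
- move=> x g Ux gU g0 g1; rewrite -punitE; apply: lU; first exact: PV_path.
  + exact: PV_unit.
  + by rewrite src_path src_punit ev0.
  + by rewrite tgt_path tgt_punit ev1.
Qed.

Lemma Pi_baseE (U V : set X) (g : path_space R X) :
  Pi_base U V g = [set c | exists b d, [/\ PV U b, PV V d, tgt b = g I0,
    src d = g I1 & c = pmul (pmul b (path_class g)) d]].
Proof.
rewrite eqEsubset; split=> [c [d1 [d2 [e1 [e2 [d1U d2V ->]]]]]|].
  exists (path_class d1), (path_class d2); split.
  - exact: PV_path.
  - exact: PV_path.
  - by rewrite tgt_path ev1.
  - by rewrite src_path ev0.
  - by rewrite !pmul_concat.
move=> _ [_ [_ [/PV_pathP[d1 d1U ->] /PV_pathP[d2 d2V ->] + + ->]]].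
rewrite tgt_path src_path ev1 ev0 => e1 e2.
by exists d1, d2, e1, (esym e2); split => //; rewrite !pmul_concat.
Qed.

End groupoid.

Section functoriality.
Context {R : realType} {X Y : topologicalType}.
Implicit Types (u : X -> Y) (b c : Pi R X).

Definition Pimap u b : Pi R Y := cls (fun s => u (ev (rep b) s)).

Lemma Pimap_path u (a : path_space R X) : continuous u ->
  Pimap u (path_class a) = cls (fun s => u (ev a s)).
Proof.
move=> cu; have /path_class_homotopy[H [cH H0 H1 Ht]] := repK (path_class a).
rewrite /Pimap; under [in LHS]eq_fun do rewrite -H0.
under [in RHS]eq_fun do rewrite -H1.
apply: (@cls_homotopy _ _ (fun p => u (H p))) => [p|t _ _|t _ _].
- exact: (@cts_at_comp _ _ _ H u p (cH p) (cu _)).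
- by rewrite (Ht t).1 (Ht 0).1.
- by rewrite (Ht t).2 (Ht 0).2.
Qed.

Lemma Pimap_cls u (f : R -> X) : continuous u -> continuous f ->
  Pimap u (cls f) = cls (fun s => u (f s)).
Proof.
move=> cu cf; rewrite Pimap_path//; apply: cls_eq => [||s s0 s1].
- by exact: (cts_comp (@ev_cts _ _ _) cu).
- by exact: (cts_comp cf cu).
- by rewrite ev_mkp// cl01_id.
Qed.

Lemma src_Pimap u b : continuous u -> src (Pimap u b) = u (src b).
Proof.
by move=> cu; rewrite src_cls//; exact: (cts_comp (@ev_cts _ _ _) cu).
Qed.

Lemma tgt_Pimap u b : continuous u -> tgt (Pimap u b) = u (tgt b).
Proof.
by move=> cu; rewrite tgt_cls//; exact: (cts_comp (@ev_cts _ _ _) cu).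
Qed.

Lemma Pimap_mul u b c : continuous u -> tgt b = src c ->
  Pimap u (pmul b c) = pmul (Pimap u b) (Pimap u c).
Proof.
move=> cu; have [f cf ->] := cls_surj b; have [g cg ->] := cls_surj c.
rewrite tgt_cls// src_cls// => fg; rewrite pmul_cls// !Pimap_cls//; last first.
  exact: cat_cts.
rewrite pmul_cls ?fg//; last 2 first.
- by exact: (cts_comp cf cu).
- by exact: (cts_comp cg cu).
by congr cls; apply/funext => s; rewrite /cat; case: ifP.
Qed.

Lemma PV_Pimap u (V : set Y) b : continuous u -> PV (u @^-1` V) b ->
  PV V (Pimap u b).
Proof.
move=> cu [f [cf Vf ->]]; exists (fun s => u (f s)); split => //.
  by exact: (cts_comp cf cu).
by rewrite Pimap_cls.
Qed.

End functoriality.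

(** * The sup-norm ball *)

Section sup_norm_ball.
Context {R : realType} {n : nat}.
Implicit Types v w : 'rV[R]_n.

Definition unitv v : 'rV[R]_n := `|v|^-1 *: v.

Definition projB v : 'rV[R]_n := (Num.max 1 `|v|)^-1 *: v.

Lemma norm_gt0_neq v : 0 < `|v| -> v != 0.
Proof. by rewrite normr_gt0. Qed.

Lemma norm_unitv v : v != 0 -> `|unitv v| = 1.
Proof. by move=> v0; rewrite normrZ normfV normr_id mulVf// normr_eq0. Qed.

Lemma unitv_scale (a : R) v : 0 < a -> unitv (a *: v) = unitv v.
Proof.
move=> a0; rewrite /unitv normrZ gtr0_norm// scalerA invfM.
by rewrite mulrAC mulVf ?gt_eqF// mul1r.
Qed.

Lemma unitv_id v : `|v| = 1 -> unitv v = v.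
Proof. by rewrite /unitv => ->; rewrite invr1 scale1r. Qed.

Lemma scale_unitv v : `|v| *: unitv v = v.
Proof.
have [->|v0] := eqVneq v 0; first by rewrite normr0 scale0r.
by rewrite scalerA mulfV ?scale1r// normr_eq0.
Qed.

Lemma projB_id v : `|v| <= 1 -> projB v = v.
Proof. by move=> v1; rewrite /projB max_l// invr1 scale1r. Qed.

Lemma projB_unitv v : 1 <= `|v| -> projB v = unitv v.
Proof. by move=> v1; rewrite /projB max_r. Qed.

Lemma norm_projB v : `|projB v| <= 1.
Proof.
have [v1|/ltW v1] := leP `|v| 1; first by rewrite projB_id.
by rewrite projB_unitv// norm_unitv// norm_gt0_neq// (lt_le_trans ltr01).
Qed.

Lemma norm_cts : continuous (fun v => `|v|).
Proof. exact: norm_continuous. Qed.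

Lemma unitv_cts v : v != 0 -> {for v, continuous unitv}.
Proof.
move=> v0; apply: (@cts_at_scale R 'rV[R]_n 'rV[R]_n (fun v => `|v|^-1) id).
  by apply: cts_at_inv; [exact: norm_cts|rewrite normr_eq0].
exact: cts_at_id.
Qed.

Lemma projB_cts : continuous projB.
Proof.
move=> v; apply: (@cts_at_scale R 'rV[R]_n 'rV[R]_n
  (fun v => (Num.max 1 `|v|)^-1) id); last exact: cts_at_id.
apply: cts_at_inv; last by rewrite gt_eqF// lt_max ltr01.
by apply: (@cts_at_max R 'rV[R]_n (fun=> 1) (fun v => `|v|));
  [exact: cts_at_cst|exact: norm_cts].
Qed.

Lemma coord_le_norm v i : `|v ord0 i| <= `|v|.
Proof.
rewrite [leRHS]/Num.norm /= mx_normrE; apply/bigmax_geP; right => /=.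
by exists (ord0, i).
Qed.

Lemma norm_coord v : v != 0 -> exists i, `|v| = `|v ord0 i|.
Proof.
rewrite -normr_eq0 => /mx_norm_neq0[[i j] /= vE]; exists j.
by rewrite [LHS]vE (ord1 i).
Qed.

Lemma sqnorm_ge0 v : 0 <= sqnorm v.
Proof. by apply: sumr_ge0 => i _; exact: sqr_ge0. Qed.

Lemma sqnormZ (a : R) v : sqnorm (a *: v) = a ^+ 2 * sqnorm v.
Proof. by rewrite /sqnorm mulr_sumr; apply: eq_bigr => i _; rewrite mxE exprMn. Qed.

Lemma norm_le_sqnorm v : `|v| <= Num.sqrt (sqnorm v).
Proof.
have [->|/norm_coord[i ->]] := eqVneq v 0; first by rewrite normr0 sqrtr_ge0.
rewrite -sqrtr_sqr ler_wsqrtr// /sqnorm (bigD1 i)//= lerDl.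
by apply: sumr_ge0 => j _; exact: sqr_ge0.
Qed.

Lemma sqnorm_gt0 v : v != 0 -> 0 < Num.sqrt (sqnorm v).
Proof.
by move=> v0; apply: lt_le_trans (norm_le_sqnorm v); rewrite normr_gt0.
Qed.

Lemma sqnorm_cts : continuous (@sqnorm R n).
Proof.
rewrite /sqnorm; elim: (index_enum _) => [|i r IH] v.
  rewrite (_ : (fun _ => _) = fun=> 0); first exact: cts_at_cst.
  by apply/funext => w; rewrite big_nil.
rewrite (_ : (fun _ => _) =
  fun v : 'rV[R]_n => v ord0 i * v ord0 i + \sum_(j <- r) v ord0 j ^+ 2).
  apply: (@cts_at_add R 'rV[R]_n); last exact: IH.
  by apply: (@cts_at_mul R 'rV[R]_n); exact: coord_continuous.
by apply/funext => w; rewrite big_cons expr2.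
Qed.

(** Radial homeomorphism carrying the sup norm of ['rV[R]_n] to the Euclidean norm that defines
    [disk]. At [0] the quotient is [0 / 0 = 0], and the value is [0] as it should be. *)
Definition sup_to_euclid v : 'rV[R]_n := (`|v| / Num.sqrt (sqnorm v)) *: v.

Lemma sqnorm_sup_to_euclid v : sqnorm (sup_to_euclid v) = `|v| ^+ 2.
Proof.
rewrite sqnormZ; have [->|v0] := eqVneq v 0.
  by rewrite normr0 mul0r expr0n mul0r.
rewrite exprMn exprVn sqr_sqrtr ?sqnorm_ge0// mulfVK//.
by rewrite gt_eqF// -sqrtr_gt0 sqnorm_gt0.
Qed.

Lemma norm_sup_to_euclid v : `|sup_to_euclid v| <= `|v|.
Proof.
rewrite normrZ normrM normfV normr_id ger0_norm ?sqrtr_ge0//.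
have [->|v0] := eqVneq v 0; first by rewrite normr0 !mul0r.
by rewrite mulrAC ler_pdivrMr ?sqnorm_gt0// ler_wpM2l// norm_le_sqnorm.
Qed.

Lemma sup_to_euclid_cts : continuous sup_to_euclid.
Proof.
move=> v; have [->|v0] := eqVneq v 0; last first.
  apply: (@cts_at_scale R 'rV[R]_n 'rV[R]_n
    (fun v => `|v| / Num.sqrt (sqnorm v)) id); last exact: cts_at_id.
  apply: cts_at_div; first exact: norm_cts.
    by apply: continuous_comp; [exact: sqnorm_cts|exact: sqrt_continuous].
  by rewrite gt_eqF// sqnorm_gt0.
rewrite /continuous_at {2}/sup_to_euclid scaler0.
apply/(@cvgr0Pnorm_lt R 'rV[R]_n 'rV[R]_n (nbhs (0 : 'rV[R]_n))
  (nbhs_filter _)) => e e0.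
have : \forall v \near (0 : 'rV[R]_n), `|v| < e.
  by apply/nbhs_normP; exists e => // u; rewrite /ball_ /= sub0r normrN.
by apply: filterS => u; exact: le_lt_trans (norm_sup_to_euclid u).
Qed.

Lemma sup_to_euclid_inj : injective sup_to_euclid.
Proof.
move=> v w vw; have nvw : `|v| = `|w|.
  by apply/eqP; rewrite -(@eqrXn2 _ 2)// -!sqnorm_sup_to_euclid vw.
have [v0|v0] := eqVneq v 0.
  by move: nvw; rewrite v0 normr0 => /esym/eqP; rewrite normr_eq0 => /eqP ->.
have w0 : w != 0 by rewrite -normr_eq0 -nvw normr_eq0.
have a0 (u : 'rV[R]_n) : u != 0 -> 0 < `|u| / Num.sqrt (sqnorm u).
  by move=> u0; apply: divr_gt0; [rewrite normr_gt0|exact: sqnorm_gt0].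
rewrite -(scale_unitv v) -(scale_unitv w) nvw; congr (_ *: _).
rewrite -(unitv_scale v (a0 _ v0)) -(unitv_scale w (a0 _ w0)).
by rewrite -!/(sup_to_euclid _) vw.
Qed.

Lemma sup_to_euclid_surj w :
  exists2 v, w = sup_to_euclid v & `|v| ^+ 2 = sqnorm w.
Proof.
suff [v wv] : exists v, w = sup_to_euclid v.
  by exists v; rewrite // wv sqnorm_sup_to_euclid.
have [->|w0] := eqVneq w 0; first by exists 0; rewrite /sup_to_euclid scaler0.
have nw : `|w| != 0 by rewrite normr_eq0.
have sw := sqnorm_gt0 w0.
have lam0 : 0 < Num.sqrt (sqnorm w) / `|w| by rewrite divr_gt0 ?normr_gt0.
exists ((Num.sqrt (sqnorm w) / `|w|) *: w).
rewrite /sup_to_euclid scalerA normrZ gtr0_norm// sqnormZ.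
rewrite sqrtrM ?sqr_ge0// sqrtr_sqr gtr0_norm// mulfVK//.
rewrite (_ : _ * _ = 1) ?scale1r//; field.
by rewrite nw gt_eqF.
Qed.

End sup_norm_ball.

(** * Cell complexes and skeletal induction *)

Section normalised_cells.
Context {R : realType} {n : nat}.

Lemma to_disk_subproof (v : 'rV[R]_n) : sup_to_euclid (projB v) \in @disk R n.
Proof.
by rewrite inE /disk /= sqnorm_sup_to_euclid expr_le1// norm_projB.
Qed.

Definition to_disk (v : 'rV[R]_n) : @disk R n :=
  exist (fun w => w \in @disk R n) _ (to_disk_subproof v).

Lemma to_diskE v : set_val (to_disk v) = sup_to_euclid (projB v).
Proof. by rewrite set_valE. Qed.

Lemma to_disk_cts : continuous to_disk.
Proof.
apply: continuous_comp_initial.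
rewrite (_ : _ \o _ = fun v => sup_to_euclid (projB v)).
  exact: (cts_comp projB_cts sup_to_euclid_cts).
by apply/funext => v /=; rewrite to_diskE.
Qed.

Lemma to_disk_surj (w : @disk R n) :
  exists v, [/\ `|v| <= 1, w = to_disk v & `|v| ^+ 2 = sqnorm (set_val w)].
Proof.
have [v wv nv] := sup_to_euclid_surj (set_val w).
have w1 : sqnorm (set_val w) <= 1 by have := set_valP w.
have v1 : `|v| <= 1 by rewrite -(@expr_le1 _ 2)// nv.
exists v; split => //; apply: val_inj; have := to_diskE v.
by rewrite projB_id// -wv !set_valE => ->.
Qed.

Lemma to_disk_boundary v : 1 <= `|v| -> @disk_boundary R n (to_disk v).
Proof.
move=> v1; rewrite /disk_boundary /= to_diskE sqnorm_sup_to_euclid.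
rewrite projB_unitv// norm_unitv ?expr1n// norm_gt0_neq//.
exact: lt_le_trans v1.
Qed.

Lemma to_disk_interior v : `|v| < 1 -> to_disk v \in @disk_interior R n.
Proof.
move=> v1; rewrite inE /disk_interior /= to_diskE sqnorm_sup_to_euclid.
by rewrite projB_id ?(ltW v1)// expr_lt1.
Qed.

End normalised_cells.

(* A cell complex presented by characteristic maps [Psi c] defined on the whole
   of ['rV_n], constant on rays outside of the unit ball of the sup norm; the
   cells whose dimension is in an initial segment [D] of [nat] form a skeleton
   or the whole space, and [cellular_cts] expresses the weak topology on it *)
Section cellular_spaces.
Context {R : realType} {Z : topologicalType} {I : Type} {dim : I -> nat}.
Implicit Types (D : set nat).

Definition lower D := forall m k, D m -> (k < m)%N -> D k.

Lemma lower_lt m : lower [set k | (k < m)%N].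
Proof. by move=> i k /= im ki; exact: ltn_trans im. Qed.

Lemma lower_setT : lower setT. Proof. by []. Qed.

Context (Psi : forall c, 'rV[R]_(dim c) -> Z).

Definition in_cells D (z : Z) :=
  exists c v, [/\ D (dim c), `|v| < 1 & z = @Psi c v].

Record cellular : Prop := {
  cellular_map_cts : forall c, continuous (@Psi c);
  cellular_radial : forall c v, 1 <= `|v| -> Psi v = @Psi c (unitv v);
  cellular_cover : forall z, in_cells setT z;
  cellular_inj : forall c d v w, `|v| < 1 -> `|w| < 1 -> @Psi c v = @Psi d w ->
    existT (fun c => 'rV[R]_(dim c)) c v = existT _ d w;
  cellular_boundary : forall c v, 1 <= `|v| ->
    in_cells [set k | (k < dim c)%N] (@Psi c v);
  cellular_cts : forall (T : topologicalType) D (f : Z -> T), lower D ->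
    (forall c, D (dim c) -> continuous (f \o @Psi c)) ->
    forall z, in_cells D z ->
    forall O, nbhs (f z) O -> \forall z' \near z, in_cells D z' -> O (f z')
}.

Hypothesis cel : cellular.

Lemma in_cells_map D c v : lower D -> D (dim c) -> in_cells D (@Psi c v).
Proof.
move=> lD Dc; have [v1|v1] := ltP `|v| 1; first by exists c, v.
have [d [w [dc w1 ->]]] := cellular_boundary cel v1.
by exists d, w; split => //; exact: lD Dc dc.
Qed.

(** The unit sphere lands in the cells of smaller dimension, where [cellular_cts] applies; [unitv]
    spreads the result to all [v != 0]. *)
Lemma cellular_sphere_cts (T : topologicalType) (f : Z -> T) c :
  (forall d, (dim d < dim c)%N -> continuous (f \o @Psi d)) ->
  forall v, v != 0 -> {for v, continuous (fun v => f (@Psi c (unitv v)))}.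
Proof.
move=> cf v v0.
have bd w : w != 0 -> in_cells [set k | (k < dim c)%N] (@Psi c (unitv w)).
  by move=> w0; apply: (cellular_boundary cel); rewrite norm_unitv.
move=> O /(cellular_cts cel (@lower_lt (dim c)) cf (bd v v0)) nO.
have cu : {for v, continuous (fun v => @Psi c (unitv v))}.
  by apply: cts_at_comp (unitv_cts v0) _; exact: (cellular_map_cts cel).
have : \forall w \near v, w != 0.
  have nv0 : 0 < `|v| by rewrite normr_gt0.
  have : nbhs v [set w | 0 < `|w|] := @norm_cts R _ v _ (lt_nbhsr nv0).
  by apply: filterS => w /=; rewrite normr_gt0.
have : nbhs v [set w | in_cells [set k | (k < dim c)%N] (@Psi c (unitv w)) ->
  O (f (@Psi c (unitv w)))] := cu _ nO.
by apply: filterS2 => w /= Ow w0; apply: Ow; exact: bd.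
Qed.

Lemma cellular_all_cts (T : topologicalType) (f : Z -> T) :
  (forall c, continuous (f \o @Psi c)) -> continuous f.
Proof.
move=> cf z O /(cellular_cts cel lower_setT (fun c _ => cf c)
  (cellular_cover cel z)) nO.
suff : nbhs z (f @^-1` O) by [].
by apply: filterS nO => z'; apply; exact: (cellular_cover cel).
Qed.

Definition cell_coords (z : Z) : {c : I & 'rV[R]_(dim c)} :=
  let: exist c Hc := cid (cellular_cover cel z) in
  existT _ c (projT1 (cid Hc)).

Lemma cell_coordsP z : let: existT c v := cell_coords z in
  `|v| < 1 /\ z = Psi v.
Proof.
by rewrite /cell_coords; case: cid => c Hc; case: cid => v [_ v1 zE] /=.
Qed.

Lemma cell_coordsK c (v : 'rV[R]_(dim c)) : `|v| < 1 ->
  cell_coords (Psi v) = existT _ c v.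
Proof.
move=> v1; have := cell_coordsP (Psi v); case: (cell_coords _) => d w [w1 e].
by apply: (cellular_inj cel).
Qed.

Definition zdim (z : Z) : nat := dim (projT1 (cell_coords z)).

Lemma zdim_in_cells m z : in_cells [set k | (k < m)%N] z -> (zdim z < m)%N.
Proof. by move=> [d [w [dm w1 ->]]]; rewrite /zdim cell_coordsK. Qed.

Lemma zdim_map c (v : 'rV[R]_(dim c)) : (zdim (Psi v) < (dim c).+1)%N.
Proof. by apply: zdim_in_cells; apply: in_cells_map => /=; first exact: lower_lt. Qed.

Lemma zdim_boundary c (v : 'rV[R]_(dim c)) : 1 <= `|v| ->
  (zdim (Psi v) < dim c)%N.
Proof. by move=> v1; apply: zdim_in_cells; exact: (cellular_boundary cel). Qed.

(** Cells are filled by increasing dimension, and the weak topology makes the union continuous. The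
    datum [b] stands for a map on the sphere, made radial, hence known to be continuous away from
    [0] only. The condition [P] is pointwise, so it survives the union. *)
Lemma cellular_extension (T : topologicalType) (P : Z -> T -> Prop) (t0 : T) :
  (forall c (b : 'rV[R]_(dim c) -> T),
    (forall v, v != 0 -> {for v, continuous b}) ->
    (forall v, v != 0 -> P (@Psi c (unitv v)) (b v)) ->
    (forall (a : R) v, 0 < a -> b (a *: v) = b v) ->
    exists g : 'rV[R]_(dim c) -> T, [/\ continuous g,
      forall v, 1 <= `|v| -> g v = b v & forall v, P (@Psi c v) (g v)]) ->
  exists f : Z -> T, continuous f /\ forall z, P z (f z).
Proof.
move=> ext.
pose good c (b g : 'rV[R]_(dim c) -> T) := [/\ continuous g,
  forall v, 1 <= `|v| -> g v = b v & forall v, P (@Psi c v) (g v)].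
(* A chosen extension of [b]; the default [b] is never reached in the induction. *)
pose G c (b : 'rV[R]_(dim c) -> T) : 'rV[R]_(dim c) -> T :=
  if pselect (exists g, good c b g) is left e then projT1 (cid e) else b.
have GP c b : (exists g, good c b g) -> good c b (G c b).
  by rewrite /G => e; case: pselect => // e'; case: cid.
(* Stage [n] rewrites the values on the open cells of dimension [n] only, so the value at [z] is
   final from stage [(zdim z).+1] on. *)
pose step n (f : Z -> T) z := let: existT c v := cell_coords z in
  if dim c == n then G c (fun w => f (Psi (unitv w))) v else f z.
pose F := fix F n := if n is n'.+1 then step n' (F n') else cst t0.
have Fstep n z : zdim z != n -> F n.+1 z = F n z.
  by rewrite /= /step /zdim; case: cell_coords => c v /= /negbTE ->.
have Fge n z : (zdim z < n)%N -> F n z = F (zdim z).+1 z.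
  elim: n => // n IH; rewrite ltnS leq_eqVlt => /predU1P[<-//|zn].
  by rewrite Fstep ?IH// neq_ltn zn.
have inv n c : (dim c < n)%N ->
    continuous (F n \o @Psi c) /\ forall v, P (@Psi c v) (F n (Psi v)).
  elim: n c => // n IH c; rewrite ltnS leq_eqVlt => /predU1P[cn|cn]; last first.
    have e v : F n.+1 (@Psi c v) = F n (Psi v).
      by rewrite Fstep// neq_ltn (leq_trans (zdim_map v) cn).
    have [cFc PFc] := IH c cn; rewrite (_ : _ \o _ = F n \o @Psi c).
      by split => // v; rewrite e.
    by apply/funext => v; exact: e.
  pose b w := F n (@Psi c (unitv w)).
  have low w : w != 0 -> exists d u, [/\ (dim d < n)%N, `|u| < 1 &
      @Psi c (unitv w) = @Psi d u].
    move=> w0; have : 1 <= `|unitv w| by rewrite norm_unitv.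
    move=> /(cellular_boundary cel) [d [u [/= dc u1 e]]].
    by exists d, u; split => //; rewrite -cn.
  have /GP[cg gb gP] : exists g, good c b g.
    apply: ext => [||a v a0]; last by rewrite /b unitv_scale.
      move=> v v0; apply: cellular_sphere_cts => // d dc.
      by apply: (IH d _).1; rewrite -cn.
    by move=> v /low[d [u [dn _]]]; rewrite /b => ->; exact: (IH d dn).2.
  have e : F n.+1 \o @Psi c = G c b.
    apply/funext => v /=; have [v1|v1] := ltP `|v| 1.
      by rewrite /step cell_coordsK//; case: eqP cn.
    rewrite -[LHS]/(F n.+1 (Psi v)) Fstep.
      by rewrite gb// (cellular_radial cel v1).
    by rewrite neq_ltn -cn zdim_boundary.
  by rewrite e; split => // v; rewrite -[F _ _]/((F n.+1 \o @Psi c) v) e.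
exists (fun z => F (zdim z).+1 z); split.
  apply: cellular_all_cts => c.
  rewrite (_ : _ \o _ = F (dim c).+1 \o @Psi c); first exact: (inv _ _ _).1.
  by apply/funext => v; apply: (esym (Fge _ _ _)); exact: zdim_map.
move=> z; have := cell_coordsP z; rewrite /zdim.
by case: (cell_coords z) => c v [_ ->]; exact: (inv _ _ _).2.
Qed.

End cellular_spaces.

Section CW_cellular.
Context {R : realType} {X : topologicalType} (cw : CW_structure R X).
Implicit Types (c d : cell cw) (L : set (cell cw)).

Definition cmap c (v : 'rV[R]_(cell_dim c)) : X := char_map c (to_disk v).
Arguments cmap : clear implicits.

Lemma cmap_cts c : continuous (cmap c).
Proof. by apply: cts_comp to_disk_cts _; exact: cts_fun. Qed.

Lemma cmap_radial c v : 1 <= `|v| -> cmap c v = cmap c (unitv v).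
Proof.
move=> v1; have v0 : v != 0 by rewrite norm_gt0_neq// (lt_le_trans ltr01).
rewrite /cmap (_ : to_disk v = to_disk (unitv v))//; apply: val_inj; have := to_diskE v.
have := to_diskE (unitv v); rewrite !set_valE => -> ->.
by rewrite projB_unitv// projB_id// norm_unitv.
Qed.

Lemma cmap_open_cell c v : `|v| < 1 -> open_cell c (cmap c v).
Proof.
by move=> v1; exists (to_disk v) => //; have := to_disk_interior v1; rewrite inE.
Qed.

Lemma open_cellP c x : open_cell c x -> exists2 v, `|v| < 1 & x = cmap c v.
Proof.
move=> [w w1 <-]; have [v [v1 wv nv]] := to_disk_surj w.
exists v; last by rewrite /cmap wv.
by rewrite -(@expr_lt1 _ 2)// nv.
Qed.

Lemma cmap_closed_cell c : closed_cell c = cmap c @` [set v | `|v| <= 1].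
Proof.
rewrite eqEsubset; split=> [_ [w _ <-]|_ [v _ <-]]; last by exists (to_disk v).
by have [v [v1 -> _]] := to_disk_surj w; exists v.
Qed.

Lemma cmap_compact c (B : set 'rV[R]_(cell_dim c)) :
  closed B -> compact (cmap c @` ([set v | `|v| <= 1] `&` B)).
Proof.
move=> cB; apply: continuous_compact.
  by apply: continuous_subspaceT; exact: cmap_cts.
apply: bounded_closed_compact.
  exists 1; split => // M M1 v [/= v1 _]; exact: le_trans (ltW M1).
apply: closedI => //.
apply: (@preimage_closed _ _ (fun v : 'rV[R]_(cell_dim c) => `|v|)
  [set x : R | x <= 1]); last exact: closed_le.
by move=> v _; exact: norm_cts.
Qed.

Lemma closed_cell_finite c : exists F : set (cell cw), finite_set F /\
  closed_cell c `<=` \bigcup_(d in F) open_cell d.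
Proof.
have [F [finF _ bF]] := closure_finite c.
exists (c |` F); split; first by rewrite finite_setU; split.
rewrite cmap_closed_cell => _ [v /= v1 <-].
have [v1'|v1'] := ltP `|v| 1; first by exists c; [left|exact: cmap_open_cell].
have [|d Fd dv] := bF (cmap c v); last by exists d => //; right.
by exists (to_disk v) => //; exact: to_disk_boundary.
Qed.

Lemma open_cell_inj c d x : open_cell c x -> open_cell d x -> c = d.
Proof.
by move=> cx dx; apply: (open_cell_trivIset (I : setT c) (I : setT d)); exists x.
Qed.

(** A closed cell meets finitely many open cells, and only those in [L] can meet [A]; each
    contributes the compact image of a closed part of its ball, and the weak topology concludes. *)
Lemma closed_in_cells L (A : set X) : A `<=` \bigcup_(c in L) open_cell c ->
  (forall c, L c -> closed (cmap c @^-1` A)) -> closed A.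
Proof.
move=> AL cA; apply/(weak_topology cw) => c.
have [F [finF cF]] := closed_cell_finite c.
have -> : A `&` closed_cell c = (\bigcup_(d in (F `&` L : set {classic cell cw}))
    (cmap d @` ([set v | `|v| <= 1] `&` (cmap d @^-1` A)))) `&` closed_cell c.
  rewrite eqEsubset; split=> x [].
    move=> Ax cx; split => //; have [d Fd dx] := cF x cx.
    have [d' Ld' d'x] := AL x Ax; have e := open_cell_inj dx d'x.
    have [v v1 xv] := open_cellP dx; exists d; first by split=> //; rewrite e.
    by exists v => //; split; [exact: ltW|rewrite /= -xv].
  by move=> [d _ [v [_ /= Av] <-]] cx.
apply: closedI.
  apply: closed_bigcup; first by exact: finite_setIl.
  move=> d [_ Ld]; apply: compact_closed; first exact: (CW_hausdorff cw).
  by apply: cmap_compact; exact: cA.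
apply: compact_closed; first exact: (CW_hausdorff cw).
rewrite cmap_closed_cell -[X in _ @` X]setIT; apply: cmap_compact.
exact: closedT.
Qed.

Lemma cmap_inj c d v w : `|v| < 1 -> `|w| < 1 -> cmap c v = cmap d w ->
  existT (fun c => 'rV[R]_(cell_dim c)) c v = existT _ d w.
Proof.
move=> v1 w1 e.
have cd : c = d.
  by apply: open_cell_inj (cmap_open_cell v1) _; rewrite e; exact: cmap_open_cell.
move: w w1 e; rewrite -{d}cd => w w1.
move=> /(char_map_inj (to_disk_interior v1) (to_disk_interior w1)) e.
have := to_diskE v; rewrite e to_diskE => /sup_to_euclid_inj.
by rewrite !projB_id ?ltW// => ->.
Qed.

Lemma cmap_boundary c v : 1 <= `|v| ->
  in_cells cmap [set k | (k < cell_dim c)%N] (cmap c v).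
Proof.
move=> v1; have [F [_ dF bF]] := closure_finite c.
have [|d Fd /open_cellP[w w1 e]] := bF (cmap c v).
  by exists (to_disk v) => //; exact: to_disk_boundary.
by exists d, w; split => //; exact: dF.
Qed.

Lemma in_cellsE (D : set nat) x : in_cells cmap D x <->
  (\bigcup_(c in [set c : cell cw | D (cell_dim c)]) open_cell c) x.
Proof.
split=> [[c [v [Dc v1 ->]]]|[c Dc /open_cellP[v v1 ->]]].
  by exists c => //; exact: cmap_open_cell.
by exists c, v.
Qed.

Lemma cmap_in_cells (D : set nat) c v : lower D -> D (cell_dim c) ->
  in_cells cmap D (cmap c v).
Proof.
move=> lD Dc; have [v1|v1] := ltP `|v| 1; first by exists c, v.
have [d [w [dc w1 ->]]] := cmap_boundary v1.
by exists d, w; split => //; exact: lD Dc dc.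
Qed.

(** The part of the skeleton outside [A] is closed in the whole of [X] by [closed_in_cells]; [O] is
    its complement. *)
Lemma open_in_cells (D : set nat) (A : set X) : lower D ->
  (forall c, D (cell_dim c) -> open (cmap c @^-1` A)) ->
  exists2 O, open O & forall x, in_cells cmap D x -> O x <-> A x.
Proof.
move=> lD oA; pose B := in_cells cmap D `&` ~` A.
exists (~` B).
  apply: closed_openC; apply: (@closed_in_cells [set c : cell cw | D (cell_dim c)]) => [x [/in_cellsE//]|c Dc].
  rewrite (_ : _ @^-1` _ = ~` (cmap c @^-1` A)).
    by apply: open_closedC; exact: oA.
  rewrite eqEsubset; split=> [v []//|v Av]; split=> //.
  exact: cmap_in_cells.
move=> x Dx; split=> [BAx|Ax []//].
by apply: contrapT => Ax; apply: BAx.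
Qed.

Lemma cmap_cellular : cellular cmap.
Proof.
split.
- exact: cmap_cts.
- exact: cmap_radial.
- move=> x; have [c _ /open_cellP[v v1 ->]] : (\bigcup_c @open_cell _ _ cw c) x.
    by rewrite open_cell_cover.
  by exists c, v.
- exact: cmap_inj.
- exact: cmap_boundary.
- move=> T D f lD cf x Dx O.
  rewrite nbhsE => -[Q [oQ Qx] QO].
  have [|N oN NA] := @open_in_cells D (f @^-1` Q) lD.
    by move=> c Dc; move/continuousP: (cf c Dc); apply.
  have : nbhs x N by apply: open_nbhs_nbhs; split => //; apply/NA.
  by apply: filterS => y Ny Dy; apply: QO; apply/NA.
Qed.

(** An [n]-cell meets [A] at most in its own centre, because its boundary lies in cells of smaller
    dimension. Applied to every subset, this makes the centres of the [n]-cells a closed discrete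
    set. *)
Lemma centers_closed n (A : set X) :
  (forall x, A x -> exists2 c, cell_dim c = n & x = cmap c 0) -> closed A.
Proof.
have n0 c : `|0 : 'rV[R]_(cell_dim c)| < 1 by rewrite normr0.
move=> An; pose L : set (cell cw) := [set c | cell_dim c = n].
apply: (@closed_in_cells L) => [x /An[c cn ->]|c cn].
  by exists c => //; exact: cmap_open_cell.
have H v : A (cmap c v) -> v = 0.
  move=> /An[d dn e]; have v1 : `|v| < 1.
    rewrite ltNge; apply/negP => /cmap_boundary.
    rewrite e => -[d' [w [/= d'c w1 /esym e']]].
    have dd' : d' = d.
      by apply: open_cell_inj (cmap_open_cell w1) _; rewrite e'; exact: cmap_open_cell.
    by move: d'c; rewrite dd' dn cn ltnn.
  have cd : c = d.
    by apply: open_cell_inj (cmap_open_cell v1) _; rewrite e; exact: cmap_open_cell.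
  move: e; rewrite -{d dn}cd => /(char_map_inj (to_disk_interior v1)
    (to_disk_interior (n0 c))) e.
  have := to_diskE v; rewrite e to_diskE => /sup_to_euclid_inj.
  by rewrite !projB_id ?ltW.
have [A0|A0] := pselect (A (cmap c 0)).
  rewrite (_ : _ @^-1` _ = [set 0]).
    by apply: accessible_closed_set1; apply: hausdorff_accessible; exact: norm_hausdorff.
  by rewrite eqEsubset; split=> [v /H|_ ->].
rewrite (_ : _ @^-1` _ = set0); first exact: closed0.
by rewrite -subset0 => v /= Av; apply: A0; rewrite -(H v Av).
Qed.

End CW_cellular.

Arguments cmap {R X} cw c v.

(** * Collars of cells *)

Section collars.
Context {R : realType} {X : topologicalType} (cw : CW_structure R X).
Local Notation dim := (@cell_dim R X cw).
Local Notation cmap := (cmap cw).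
Local Notation zd := (zdim (cmap_cellular cw)).

Lemma zdim_cmap c v : `|v| < 1 -> zd (cmap c v) = dim c.
Proof. by move=> v1; rewrite /zdim cell_coordsK. Qed.

Lemma cmap_higher_neq c d v w : `|v| < 1 -> (dim d < dim c)%N ->
  cmap c v <> cmap d w.
Proof.
move=> v1 dc e; have := zdim_map (cmap_cellular cw) w.
by rewrite -e zdim_cmap// ltnS leqNgt dc.
Qed.

Section extension_to_a_cell.
Context (n : nat) (K : R).

(** The last clause starts the induction: nothing happens below dimension [n], so the radial
    contraction of an [n]-cell has to fade out on its sphere. For [0 < K], the inequality in the
    third clause means that the norm of [v] is less than [1 - 1/K]. *)
Definition collar_spec (z : X) (p : R * path_space R X) := [/\ ev p.2 0 = z,
  0 < p.1 -> exists2 c, dim c = n & ev p.2 1 = cmap c 0,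
  forall c v, dim c = n -> 1 < (1 - `|v|) * K -> z = cmap c v -> 0 < p.1 &
  forall c v, (dim c < n)%N -> z = cmap c v -> p = (0, pcst z)].

Hypothesis K0 : 0 < K.

Lemma lt1_of_scaled (r : R) : 1 < (1 - r) * K -> r < 1.
Proof.
move=> h; rewrite -subr_gt0 -(@pmulr_lgt0 _ K)//; exact: lt_trans h.
Qed.

Context (c : cell cw) (b : 'rV[R]_(dim c) -> R * path_space R X).
Hypothesis b_cts : forall v, v != 0 -> {for v, continuous b}.
Hypothesis b_spec : forall v, v != 0 -> collar_spec (cmap c (unitv v)) (b v).

Definition extends_collar (g : 'rV[R]_(dim c) -> R * path_space R X) :=
  [/\ continuous g, forall v, 1 <= `|v| -> g v = b v
    & forall v, collar_spec (cmap c v) (g v)].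

Lemma extends_collarI g : continuous g -> (forall v, 1 <= `|v| -> g v = b v) ->
  (forall v, `|v| < 1 -> collar_spec (cmap c v) (g v)) -> extends_collar g.
Proof.
move=> cg gb Pg; split => // v; have [v1|v1] := ltP `|v| 1; first exact: Pg.
rewrite gb// cmap_radial//; apply: b_spec.
by rewrite norm_gt0_neq// (lt_le_trans ltr01).
Qed.

Lemma collar_low : (dim c < n)%N -> exists g, extends_collar g.
Proof.
move=> cn; exists (fun v => (0, pcst (cmap c v))); apply: extends_collarI.
- move=> v; apply: (@cts_at_pair 'rV[R]_(dim c) R (path_space R X)).
    exact: cts_at_cst.
  exact: (cts_comp (@cmap_cts _ _ _ c) (@pcst_cts R X)).
- move=> v v1; have v0 : v != 0 by rewrite norm_gt0_neq// (lt_le_trans ltr01).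
  have [_ _ _ H] := b_spec v0.
  by rewrite (H c (unitv v) cn erefl) (cmap_radial v1).
- move=> v v1; split => //=; first by rewrite ltxx.
  move=> d w dn /lt1_of_scaled w1 e; exfalso.
  by apply: (@cmap_higher_neq d c w v); rewrite ?dn.
Qed.

Lemma collar_mid : dim c = n -> exists g, extends_collar g.
Proof.
move=> cn.
(* [cl01 (kap v)] is the share of the radial contraction that is carried out: none on the sphere,
   all of it once [1 <= kap v], in particular where the weight [kap v - 1] is positive. *)
pose kap (v : 'rV[R]_(dim c)) := (1 - `|v|) * K.
pose f (v : 'rV[R]_(dim c)) (s : R) := cmap c ((1 - s * cl01 (kap v)) *: v).
have ckap : continuous kap.
  move=> v; apply: (@cts_at_mul R _ (fun v : 'rV[R]_(dim c) => 1 - `|v|));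
    last exact: cts_at_cst.
  by apply: cts_at_sub; [exact: cts_at_cst|exact: norm_cts].
have cf : continuous (fun q : 'rV[R]_(dim c) * R => f q.1 q.2).
  move=> q; apply: (@cts_at_comp _ _ _
    (fun q : 'rV[R]_(dim c) * R => (1 - q.2 * cl01 (kap q.1)) *: q.1) (cmap c));
    last exact: cmap_cts.
  apply: cts_at_scale; last exact: cts_at_fst.
  apply: cts_at_sub; first exact: cts_at_cst.
  apply: cts_at_mul; first exact: cts_at_snd.
  by apply: cts_at_cl01; apply: (@cts_at_comp _ _ _ fst kap);
    [exact: cts_at_fst|exact: ckap].
have cf1 v : continuous (f v).
  move=> s; apply: (@cts_at_comp R _ _ (fun s : R => (v, s))
    (fun q : 'rV[R]_(dim c) * R => f q.1 q.2)); last exact: cf.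
  by apply: cts_at_pair; [exact: cts_at_cst|exact: cts_at_id].
exists (fun v => (Num.max 0 (kap v - 1), mkp (f v))); apply: extends_collarI.
- move=> v; apply: (@cts_at_pair 'rV[R]_(dim c) R (path_space R X)); last by apply: mkp_cts_at => // s; exact: cf.
  apply: cts_at_max; first exact: cts_at_cst.
  by apply: cts_at_sub; [exact: ckap|exact: cts_at_cst].
- move=> v v1; have v0 : v != 0 by rewrite norm_gt0_neq// (lt_le_trans ltr01).
  have uv1 : 1 <= `|unitv v| by rewrite norm_unitv.
  have [_ _ _ H] := b_spec v0.
  have [d [w [dc w1 e]]] := cmap_boundary uv1.
  rewrite (H d w _ e) -?cn// -(cmap_radial v1).
  have k0 : kap v <= 0 by rewrite /kap pmulr_lle0// subr_le0.
  congr (_, _); first by rewrite max_l// subr_le0 (le_trans k0).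
  apply: path_ext => s s0 s1.
  by rewrite ev_mkp// /f (cl01_le0 k0) mulr0 subr0 scale1r.
- move=> v v1; split => /=.
  + by rewrite ev_mkp// cl01_le0// /f mul0r subr0 scale1r.
  + rewrite lt_max ltxx /= subr_gt0 => kv; exists c => //.
    by rewrite ev_mkp// /f (cl01_ge1 (ltW kv)) cl01_ge1// mulr1 subrr scale0r.
  + move=> d w dn w1 e; rewrite lt_max ltxx /= subr_gt0 /kap.
    have ew := cmap_inj v1 (lt1_of_scaled w1) e.
    suff -> : `|v| = `|w| by [].
    exact: (congr1 (fun u : {c : cell cw & 'rV[R]_(dim c)} => `|projT2 u|) ew).
  + by move=> d w dn e; exfalso; apply: (@cmap_higher_neq c d v w); rewrite ?cn.
Qed.

(** An interior point of such a cell lies on no cell of dimension at most [n], so the last two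
    clauses of [collar_spec] are void there and only the weight and the path have to be extended. *)
Lemma collar_high : (n < dim c)%N -> exists g, extends_collar g.
Proof.
move=> nc.
(* [v] is pushed radially at speed [2 - |v|] (slowed down near [0]): it reaches
   the sphere when [p v s = 1], after which it follows the path [b v]; for
   [|v| > 1/2] this path is followed to its end, and for [|v| = 1] nothing but
   [b v] remains *)
pose rc (v : 'rV[R]_(dim c)) := Num.min 1 `|v|.
pose lam (v : 'rV[R]_(dim c)) (s : R) :=
  1 + 2 * s * (2 - rc v) / Num.max 1 (2 * rc v).
pose p (v : 'rV[R]_(dim c)) (s : R) := rc v * lam v s.
pose f (v : 'rV[R]_(dim c)) (s : R) :=
  if p v s <= 1 then cmap c (lam v s *: v) else ev (b v).2 (p v s - 1).
have m0 v : Num.max 1 (2 * rc v) != 0 by rewrite gt_eqF// lt_max ltr01.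
have rc1 v : 1 <= `|v| -> rc v = 1 by move=> v1; rewrite /rc min_l.
have rcE v : `|v| <= 1 -> rc v = `|v| by move=> v1; rewrite /rc min_r.
have crc : continuous rc.
  by move=> v; apply: cts_at_min; [exact: cts_at_cst|exact: norm_cts].
have clam : continuous (fun q : 'rV[R]_(dim c) * R => lam q.1 q.2).
  have crc1 : continuous (fun q : 'rV[R]_(dim c) * R => rc q.1).
    by move=> q; apply: (@cts_at_comp _ _ _ fst rc); [exact: cts_at_fst|exact: crc].
  move=> q; apply: (@cts_at_add R ('rV[R]_(dim c) * R)%type).
    exact: cts_at_cst.
  apply: cts_at_div; last exact: m0.
    apply: cts_at_mul.
      by apply: cts_at_mul; [exact: cts_at_cst|exact: cts_at_snd].
    by apply: cts_at_sub; [exact: cts_at_cst|exact: crc1].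
  apply: cts_at_max; first exact: cts_at_cst.
  by apply: cts_at_mul; [exact: cts_at_cst|exact: crc1].
have cp : continuous (fun q : 'rV[R]_(dim c) * R => p q.1 q.2).
  move=> q; apply: (@cts_at_mul R ('rV[R]_(dim c) * R)%type); last exact: clam.
  by apply: (@cts_at_comp _ _ _ fst rc); [exact: cts_at_fst|exact: crc].
have p1 v s : p v s = 1 -> v != 0 ->
    cmap c (lam v s *: v) = ev (b v).2 (p v s - 1).
  move=> pE v0; have [e _ _ _] := b_spec v0; rewrite pE subrr e.
  have [v1|v1] := leP `|v| 1.
    rewrite /unitv -[`|v|^-1]mulr1 -pE /p rcE// mulKf// normr_eq0//.
  have := pE; rewrite /p rc1 ?ltW// mul1r => ->; rewrite scale1r.
  by rewrite cmap_radial// ltW.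
have p0 s : p 0 s = 0 by rewrite /p rcE ?normr0 ?mul0r.
have cf : continuous (fun q : 'rV[R]_(dim c) * R => f q.1 q.2).
  move=> q; apply: (@cts_at_if _ _ _ (fun q : 'rV[R]_(dim c) * R => p q.1 q.2) 1).
  - exact: cp.
  - move=> _; apply: (@cts_at_comp _ _ _
      (fun q : 'rV[R]_(dim c) * R => lam q.1 q.2 *: q.1) (cmap c));
      last exact: cmap_cts.
    by apply: cts_at_scale; [exact: clam|exact: cts_at_fst].
  - move=> pq; have q0 : q.1 != 0.
      by apply/eqP => q0; move: pq; rewrite q0 p0 ler10.
    apply: path_cts_at.
      apply: (@cts_at_comp _ _ _ fst (fun v => (b v).2)); first exact: cts_at_fst.
      by apply: (@cts_at_comp _ _ _ b snd); [exact: b_cts|exact: cts_at_snd].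
    by apply: cts_at_sub; [exact: cp|exact: cts_at_cst].
  - move=> pq; apply: p1 => //.
    by apply/eqP => q0; move: pq; rewrite q0 p0 => /esym/eqP; rewrite oner_eq0.
have cf1 v : continuous (f v).
  move=> s; apply: (@cts_at_comp R _ _ (fun s : R => (v, s))
    (fun q : 'rV[R]_(dim c) * R => f q.1 q.2)); last exact: cf.
  by apply: cts_at_pair; [exact: cts_at_cst|exact: cts_at_id].
(* [b] need not be continuous at [0], whence the case distinction *)
pose t (v : 'rV[R]_(dim c)) := if `|v| <= 2^-1 then 0 else cl01 (2 * `|v| - 1) * (b v).1.
exists (fun v => (t v, mkp (f v))); apply: extends_collarI.
- move=> v; apply: (@cts_at_pair 'rV[R]_(dim c) R (path_space R X)); last by apply: mkp_cts_at => // s; exact: cf.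
  apply: (@cts_at_if _ _ _ (fun v : 'rV[R]_(dim c) => `|v|)) => [|_|v2|vE].
  + exact: norm_cts.
  + exact: cts_at_cst.
  + have v0 : v != 0 by rewrite norm_gt0_neq// (lt_le_trans _ v2).
    apply: cts_at_mul.
      apply: cts_at_cl01; apply: cts_at_sub; last exact: cts_at_cst.
      by apply: cts_at_mul; [exact: cts_at_cst|exact: norm_cts].
    by apply: (@cts_at_comp _ _ _ b fst); [exact: b_cts|exact: cts_at_fst].
  + by rewrite vE mulfV// subrr cl01_le0// mul0r.
- move=> v v1; have v0 : v != 0 by rewrite norm_gt0_neq// (lt_le_trans ltr01).
  rewrite [RHS]surjective_pairing; congr (_, _).
    rewrite /t ifF; last by apply/negbTE; rewrite -ltNge; lra.
    by rewrite cl01_ge1 ?mul1r//; lra.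
  apply: path_ext => s s0 s1; rewrite ev_mkp// cl01_id// /f.
  have pE : p v s = 1 + s.
    rewrite /p /lam rc1// mul1r mulr1 max_r; last by rewrite ler1n.
    by rewrite -[2 - 1]/(1 + 1 - 1) addrK mulr1 [2 * s]mulrC mulfK.
  case: ifPn => [p1'|_]; last by rewrite pE [1 + s]addrC addrK.
  rewrite p1 ?pE//; first by rewrite [1 + s]addrC addrK.
  by move: p1'; rewrite pE => ?; lra.
- move=> v v1; split => /=.
  + rewrite ev_mkp// cl01_le0// /f /p.
    rewrite (_ : lam v 0 = 1); last by rewrite /lam mulr0 !mul0r addr0.
    by rewrite mulr1 rcE ?(ltW v1)// scale1r.
  + rewrite /t; case: ifPn; first by rewrite ltxx.
    rewrite -ltNge => v2 tv.
    have v0 : v != 0 by rewrite norm_gt0_neq// (lt_trans _ v2).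
    have [_ H _ _] := b_spec v0.
    have [|d dn e] := H.
      by move: tv; rewrite pmulr_rgt0// cl01_id; lra.
    exists d => //; rewrite ev_mkp// cl01_ge1// /f -e.
    (* Positive weight forces norm above 1/2, where the denominator in [lam] is twice the norm [r]
       of [v]; hence [p v 1 = r + (2 - r)], and the path [b v] is followed to its end. *)
    have pE : p v 1 = 2.
      rewrite /p /lam rcE ?(ltW v1)// max_r; last by lra.
      by field; rewrite normr_eq0.
    rewrite pE ifF; last by apply/negbTE; rewrite -ltNge; lra.
    by rewrite -[2 - 1]/(1 + 1 - 1) addrK.
  + move=> d w dn /lt1_of_scaled w1 e; exfalso.
    by apply: (@cmap_higher_neq c d v w); rewrite ?dn.
  + move=> d w dn e; exfalso.
    by apply: (@cmap_higher_neq c d v w); rewrite ?(ltn_trans dn).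
Qed.

End extension_to_a_cell.

(* [t > 0] is a neighbourhood of the [n]-cells shrunk by the factor [1 - 1/K],
   and [h] contracts it to the centres of the [n]-cells *)
Lemma collar (x0 : X) (n : nat) (K : R) : 0 < K ->
  exists (t : X -> R) (h : X -> path_space R X), [/\ continuous t,
    continuous h, forall x, ev (h x) 0 = x,
    forall x, 0 < t x -> exists2 c, dim c = n & ev (h x) 1 = cmap c 0 &
    forall c v, dim c = n -> 1 < (1 - `|v|) * K -> 0 < t (cmap c v)].
Proof.
move=> K0.
have [|f [cf fP]] := @cellular_extension _ _ _ _ _ (cmap_cellular cw) _
    (collar_spec n K) (0, pcst x0).
  move=> c b cb bP _; have [cn|nc|cn] := ltngtP (dim c) n.
  - exact: collar_low.
  - exact: collar_high.
  - exact: collar_mid.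
exists (fun x => (f x).1), (fun x => (f x).2); split.
- exact: (cts_comp cf (@cts_at_fst _ _)).
- exact: (cts_comp cf (@cts_at_snd _ _)).
- by move=> x; have [] := fP x.
- by move=> x; have [_ H _ _] := fP x.
- by move=> c v cn v1; have [_ _ H _] := fP (cmap c v); exact: H v1 erefl.
Qed.

End collars.

(** * Path components of open sets *)

Section path_components.
Context {R : realType} {X : topologicalType}.
Implicit Types (W : set X) (x y : X) (c : Pi R X).

Definition pathcomp W x : set X :=
  [set y | exists c : Pi R X, [/\ PV W c, src c = x & tgt c = y]].

Lemma pathcomp_sub W x : pathcomp W x `<=` W.
Proof. by move=> y [c [Wc _ <-]]; exact: PV_tgt. Qed.

Lemma pathcomp_refl W x : W x -> pathcomp W x x.
Proof.
by move=> Wx; exists (punit x); rewrite src_punit tgt_punit; split => //; exact: PV_unit.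
Qed.

Lemma pathcomp_step W x c : pathcomp W x (src c) -> PV W c -> pathcomp W x (tgt c).
Proof.
move=> [b [Wb sb tb]] Wc; exists (pmul b c).
by rewrite src_pmul// tgt_pmul//; split => //; exact: PV_mul.
Qed.

Lemma PV_pathcomp W x c : pathcomp W x (src c) -> PV W c -> PV (pathcomp W x) c.
Proof.
move=> + [f [cf Wf cE]]; rewrite cE src_cls// => Wf0.
exists f; split => // s; rewrite -(tgt_seg (0 : R) s cf).
apply: pathcomp_step; first by rewrite src_seg.
by apply: PV_seg.
Qed.

Lemma nbhs_seg {E : normedModType R} (phi : E -> X) W v : continuous phi ->
  open W -> W (phi v) -> \forall w \near v, PV W (seg phi v w).
Proof.
move=> cphi oW Wv.
have : nbhs v (phi @^-1` W) by apply: cphi; exact: open_nbhs_nbhs.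
move=> /nbhs_normP[e /= e0 eW]; apply/nbhs_normP; exists e => // w we.
apply: PV_seg => // s s0 s1; apply: eW; rewrite /ball_ /= in we *.
rewrite opprD addNKr normrN normrZ ger0_norm//.
by apply: le_lt_trans we; rewrite distrC ler_piMl.
Qed.

Definition locally_pc := forall W x, open W -> open (pathcomp W x).

End path_components.
Arguments locally_pc R X : clear implicits.
Arguments pathcomp R {X} W x.

Section collar_families.
Context {R : realType} {X : topologicalType}.

(** [collar_end] speaks of paths: the ends lie in a discrete set of centres, so they cannot vary
    along a path. With local path connectedness this gives local constancy. *)
Record is_collar (t : X -> R) (h : X -> path_space R X) : Prop := {
  collar_weight_cts : continuous t;
  collar_path_cts : continuous h;
  collar_start : forall x, ev (h x) 0 = x;
  collar_end : forall f : R -> X, continuous f -> (forall s, 0 < t (f s)) ->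
    forall s, ev (h (f s)) 1 = ev (h (f 0)) 1
}.

Definition collared := locally_pc R X /\
  exists (t : nat -> X -> R) (h : nat -> X -> path_space R X),
    (forall i, is_collar (t i) (h i)) /\ (forall x, exists i, 0 < t i x).

(** The square [h (f s)] at time [u] has bottom [f] and a constant top, so [f] is homotopic to its
    left side followed by its right side reversed. A class in the collar is thus determined by its
    ends. *)
Lemma collar_PV (t : X -> R) (h : X -> path_space R X) c :
  is_collar t h -> PV [set x | 0 < t x] c ->
  c = pmul (path_class (h (src c))) (pflip (path_class (h (tgt c)))).
Proof.
move=> th [f [cf tf ->]]; rewrite src_cls// tgt_cls//.
pose F (p : R * R) := ev (h (f p.1)) p.2.
have cF : continuous F.
  move=> p; apply: path_cts_at; last exact: cts_at_snd.
  apply: (@cts_at_comp _ _ _ fst (fun s => h (f s))); first exact: cts_at_fst.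
  exact: (cts_comp cf (collar_path_cts th)).
have vert s : path_class (h (f s)) = seg F (s, 0) (s, 1).
  rewrite -cls_ev; congr cls; apply/funext => u; rewrite /F /=.
  by rewrite subrr scaler0 addr0 add0r subr0 [_ *: _]mulr1.
rewrite !vert seg_inv//.
have top : seg F (0, 1) (1, 1) = punit (ev (h (f 0)) 1).
  rewrite /seg /punit; congr cls; apply/funext => s; rewrite /F /=.
  rewrite subrr scaler0 addr0 add0r subr0 [_ *: _]mulr1.
  exact: (collar_end th).
have bottom : cls f = seg F (0, 0) (1, 0).
  rewrite /seg; congr cls; apply/funext => s; rewrite /F /=.
  rewrite subrr scaler0 addr0 add0r subr0 [_ *: _]mulr1.
  by rewrite (collar_start th).
pose c00 : R * R := (0, 0); pose c01 : R * R := (0, 1).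
pose c10 : R * R := (1, 0); pose c11 : R * R := (1, 1).
have e1 := seg_mul c00 c11 c10 cF.
have e2 := seg_mul c00 c01 c11 cF.
have e3 := tgt_seg c00 c01 cF.
by rewrite bottom -e1 -e2 top pmul1 ?e3.
Qed.

Lemma collar_PV_inj (t : X -> R) (h : X -> path_space R X) (b c : Pi R X) :
  is_collar t h -> PV [set x | 0 < t x] b -> PV [set x | 0 < t x] c ->
  src b = src c -> tgt b = tgt c -> b = c.
Proof.
move=> th tb tc sbc tbc.
by rewrite [LHS](collar_PV th tb) [RHS](collar_PV th tc) sbc tbc.
Qed.

Definition nice_basis (Y : topologicalType) := forall (x : Y) (W : set Y),
  nbhs x W -> exists U, [/\ nice R U, U x & U `<=` W].

(** Inside a given neighbourhood, the path component of [x] in its intersection with some [t i > 0]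
    is nice, by [collar_PV_inj]. *)
Lemma collared_nice_basis : collared -> nice_basis X.
Proof.
move=> [lpc [t [h [th pos]]]] x W; rewrite nbhsE => -[V [oV Vx] VW].
have [i ti] := pos x.
pose N := V `&` [set x | 0 < t i x].
have oN : open N.
  apply: openI => //; have /continuousP ct := collar_weight_cts (th i).
  by apply: (ct [set r | 0 < r]); exact: open_gt.
have Nx : N x by [].
have sub : pathcomp R N x `<=` [set x | 0 < t i x].
  by apply: subset_trans (@pathcomp_sub _ _ _ _) _ => y [].
exists (pathcomp R N x); split; last 2 first.
- exact: pathcomp_refl.
- by apply: subset_trans VW => y /pathcomp_sub[].
apply/niceP; split.
- exact: lpc.
- by exists x; exact: pathcomp_refl.
- move=> y z [b [Nb sb tb]] [c [Nc sc tc]].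
  have bc : tgt (pflip b) = src c by rewrite tgt_pflip sb.
  exists (pmul (pflip b) c).
    apply: PV_pathcomp; last by apply: PV_mul => //; exact: PV_inv.
    by rewrite src_pmul// src_pflip; exists b.
  by rewrite src_pmul// src_pflip tgt_pmul.
- move=> b c /(PV_sub sub) Nb /(PV_sub sub) Nc.
  exact: (collar_PV_inj (th i)).
Qed.

End collar_families.
Arguments collared R X : clear implicits.
Arguments nice_basis R Y : clear implicits.

Section CW_collared.
Context {R : realType} {X : topologicalType} (cw : CW_structure R X).

(** In the coordinates of a cell, short segments stay in the component, so its preimages are open;
    the weak topology does the rest. *)
Lemma CW_locally_pc : locally_pc R X.
Proof.
move=> W x oW.
have [c _|O oO OW] := @open_in_cells _ _ cw setT (pathcomp R W x) lower_setT.
  rewrite openE => v /= Wv; rewrite /interior.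
  have : W (cmap cw c v) by exact: pathcomp_sub Wv.
  move=> /(nbhs_seg (@cmap_cts _ _ _ c) oW); apply: filterS => w Wvw /=.
  rewrite -(tgt_seg v w (@cmap_cts _ _ _ c)); apply: pathcomp_step => //.
  by rewrite src_seg//; exact: cmap_cts.
rewrite (_ : pathcomp R W x = O)// eqEsubset.
have all y := cellular_cover (cmap_cellular cw) y.
by split=> y /(OW y (all y)).
Qed.

(** The fibre over [f 0] and its complement are both preimages of subsets of [A], hence closed in
    the line. *)
Lemma connected_in_discrete (A : set X) (f : R -> X) : continuous f ->
  (forall B, B `<=` A -> closed B) -> (forall s, A (f s)) ->
  forall s, f s = f 0.
Proof.
move=> cf cA Af.
have cl B : B `<=` A -> closed (f @^-1` B).
  by move=> BA; apply: preimage_closed => [s _|]; [exact: cf|exact: cA].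
suff : f @^-1` [set f 0] = setT by move=> e s; have : setT s by []; rewrite -e.
have : connected [set: R] by apply/connected_intervalP => a b _ _ c _.
apply.
- by exists 0.
- exists (~` (f @^-1` (A `\ f 0))).
    by apply: closed_openC; apply: cl => y [].
  rewrite setTI eqEsubset; split=> [s /= -> []//|s /= h].
  by apply: contrapT => fs; apply: h.
- exists (f @^-1` [set f 0]); last by rewrite setTI.
  by apply: cl => y ->.
Qed.

Lemma CW_collared : X -> collared R X.
Proof.
move=> x0; split; first exact: CW_locally_pc.
have K0 (k : nat) : 0 < k.+1%:R :> R by rewrite ltr0n.
pose T n k := cid (collar cw x0 n (K0 k)).
(* A pair codes a dimension and a shrinking factor; numbers that code nothing repeat the collar of
   [(0, 0)]. *)
pose idx (i : nat) : nat * nat := odflt (0%N, 0%N) (unpickle i).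
exists (fun i => projT1 (T (idx i).1 (idx i).2)).
exists (fun i => projT1 (cid (projT2 (T (idx i).1 (idx i).2)))).
split=> [i|x].
  case: (T _ _) => t /= H; case: cid => h /= [ct ch h0 h1 _]; split => //.
  move=> f cf tf.
  have cg : continuous (fun s => ev (h (f s)) 1).
    move=> s; apply: path_cts_at; last exact: cts_at_cst.
    exact: (cts_comp cf ch).
  apply: (@connected_in_discrete [set x | exists2 c,
      cell_dim c = (idx i).1 & x = cmap cw c 0] _ cg) => [B BA|s /=].
    by apply: (@centers_closed _ _ cw (idx i).1) => x /BA.
  by have [c cn e] := h1 _ (tf s); exists c.
have [c [v [_ v1 xE]]] := cellular_cover (cmap_cellular cw) x.
have [k hk] : exists k : nat, 1 < (1 - `|v|) * k.+1%:R :> R.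
  have v0 : 0 < 1 - `|v| by rewrite subr_gt0.
  exists (Num.truncn (1 - `|v|)^-1); rewrite mulrC -ltr_pdivrMr// mul1r.
  exact: truncnS_gt.
exists (pickle (cell_dim c, k)).
rewrite /idx pickleK /=; case: (T _ _) => t /= [h [_ _ _ _ H]].
by rewrite xE; exact: H.
Qed.

End CW_collared.

(** * Topologies on homotopy classes of paths *)

Section Pi_topology.
Context {R : realType} {X : topologicalType}.
Implicit Types (U V : set X) (b c d : Pi R X).

Lemma Pi_base_open U V (g : path_space R X) : nice R U -> nice R V -> U (g I0) -> V (g I1) ->
  open (Pi_base U V g : set (Pi R X)).
Proof.
move=> nU nV Ug Vg; exists [set Pi_base U V g]; last by rewrite bigcup_set1.
move=> _ ->; apply: (@finI_from1 _ _ _ id (Pi_base U V g)).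
by exists U, V, g.
Qed.

Lemma Pi_nbhs U V b : nice R U -> nice R V -> U (src b) -> V (tgt b) ->
  \forall c \near b, exists d1 d2, [/\ PV U d1, PV V d2, tgt d1 = src b,
    src d2 = tgt b & c = pmul (pmul d1 b) d2].
Proof.
move=> nU nV Ub Vb.
have oB : open (Pi_base U V (rep b)) by exact: Pi_base_open.
apply: (@filterS _ _ _ (Pi_base U V (rep b))) => [c|].
  by rewrite Pi_baseE repK.
apply: open_nbhs_nbhs; split => //; rewrite Pi_baseE repK.
exists (punit (src b)), (punit (tgt b)); rewrite tgt_punit src_punit.
by split => //; rewrite ?pmul1l ?pmul1//; exact: PV_unit.
Qed.

(** A subbasic set containing [f w] is based at some other path [g]; the moves from [g] to [f w]
    compose with moves starting at [f w], so the latter are enough. *)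
Lemma Pi_cts_at (W : topologicalType) (f : W -> Pi R X) (w : W) :
  (forall U V, nice R U -> nice R V -> U (src (f w)) -> V (tgt (f w)) ->
    \forall w' \near w, exists d1 d2, [/\ PV U d1, PV V d2,
      tgt d1 = src (f w), src d2 = tgt (f w)
      & f w' = pmul (pmul d1 (f w)) d2]) ->
  {for w, continuous f}.
Proof.
move=> H A; rewrite nbhsE => -[B [[D DB <-] [C DC Cf]] BA].
have [E ED CE] := DB _ DC.
suff : \forall w' \near w, C (f w').
  by apply: filterS => w' Cw'; apply: BA; exists C.
rewrite -CE in Cf; rewrite -CE; apply: filter_bigI => S SE.
have Sfw : S (f w) := Cf S SE.
have := ED S SE; rewrite inE => -[U [V [g [nU nV Ug Vg SB]]]].
move: Sfw; rewrite SB Pi_baseE => -[b [d [Ub Vd tb sd fwE]]].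
have bg : tgt b = src (path_class g) by rewrite src_path.
have gd : tgt (path_class g) = src d by rewrite tgt_path.
have bgd : tgt (pmul b (path_class g)) = src d by rewrite tgt_pmul.
have : \forall w' \near w, exists d1 d2, [/\ PV U d1, PV V d2,
    tgt d1 = src (f w), src d2 = tgt (f w) & f w' = pmul (pmul d1 (f w)) d2].
  apply: H => //; rewrite fwE; first by rewrite !src_pmul//; exact: PV_src.
  by rewrite tgt_pmul//; exact: PV_tgt.
apply: filterS => w' [d1 [d2 [Ud1 Vd2 td1 sd2 ->]]].
move: td1 sd2; rewrite fwE !src_pmul// tgt_pmul// => td1 sd2.
exists (pmul d1 b), (pmul d d2); split.
- exact: PV_mul.
- exact: PV_mul.
- by rewrite tgt_pmul.
- by rewrite src_pmul.
- rewrite (@pmulA _ _ d1 (pmul b (path_class g)) d) ?src_pmul//.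
  rewrite (@pmulA _ _ d1 b (path_class g))//.
  by rewrite -(@pmulA _ _ _ d d2)// !tgt_pmul.
Qed.

Lemma src_cts : nice_basis R X -> continuous (@src R X).
Proof.
move=> nb b A /nb[U [nU Ub UA]]; have [V [nV Vb _]] := nb (tgt b) setT filterT.
suff : \forall c \near b, A (src c) by [].
apply: filterS (Pi_nbhs nU nV Ub Vb) => c [d1 [d2 [Ud1 Vd2 td1 sd2 ->]]].
by apply: UA; rewrite !src_pmul ?tgt_pmul//; exact: PV_src.
Qed.

End Pi_topology.

Lemma Pimap_cts {R : realType} {X Y : topologicalType} (u : X -> Y) :
  nice_basis R X -> continuous u -> continuous (@Pimap R X Y u).
Proof.
move=> nb cu b; apply: Pi_cts_at => U V nU nV.
rewrite src_Pimap// tgt_Pimap// => Ub Vb.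
have [[oU _ _] [oV _ _]] := (nU, nV).
have [|U' [nU' U'b UU']] := nb (src b) (u @^-1` U).
  by apply: cu; exact: open_nbhs_nbhs.
have [|V' [nV' V'b VV']] := nb (tgt b) (u @^-1` V).
  by apply: cu; exact: open_nbhs_nbhs.
apply: filterS (Pi_nbhs nU' nV' U'b V'b) => c [d1 [d2 [Ud1 Vd2 td1 sd2 ->]]].
exists (Pimap u d1), (Pimap u d2); split.
- by apply: PV_Pimap => //; exact: PV_sub Ud1.
- by apply: PV_Pimap => //; exact: PV_sub Vd2.
- by rewrite tgt_Pimap// td1.
- by rewrite src_Pimap// sd2.
- by rewrite !Pimap_mul// tgt_pmul.
Qed.

(* The set of classes with the topology in which only the end point is allowed
   to move: the disjoint union, over all base points, of the universal covers *)
Definition whisker (R : realType) (X : topologicalType) : Type := Pi R X.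
HB.instance Definition _ R X := Choice.on (whisker R X).

Section whisker_topology.
Context {R : realType} {X : topologicalType}.
Implicit Types (z : whisker R X) (V : set X) (c : Pi R X).

(** Allowing any open [V], and not only nice ones, makes stability under intersection immediate. *)
Definition whisker_open (O : set (whisker R X)) := forall z, O z ->
  exists V, [/\ open V, V (tgt z) &
    forall c, PV V c -> src c = tgt z -> O (pmul z c)].

Lemma whisker_openT : whisker_open setT.
Proof. by move=> z _; exists setT; split => //; exact: openT. Qed.

Lemma whisker_openI A B :
  whisker_open A -> whisker_open B -> whisker_open (A `&` B).
Proof.
move=> oA oB z [/oA[V [oV Vz AV]] /oB[W [oW Wz BW]]].
exists (V `&` W); split => //; first exact: openI.
move=> c VWc sc; split; [apply: AV|apply: BW] => //.
  by apply: PV_sub VWc => x [].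
by apply: PV_sub VWc => x [].
Qed.

Lemma whisker_open_bigU (I : Type) (f : I -> set (whisker R X)) :
  (forall i, whisker_open (f i)) -> whisker_open (\bigcup_i f i).
Proof.
move=> of_ z [i _ fz]; have [V [oV Vz fV]] := of_ i z fz.
by exists V; split => // c Vc sc; exists i => //; exact: fV.
Qed.

HB.instance Definition _ := isOpenTopological.Build (whisker R X)
  whisker_openT whisker_openI whisker_open_bigU.

(** Two moves in [V] compose to a move in [V], so the classes reached from [z] by moves in [V]
    already form an open set. *)
Lemma nbhs_whisker z (A : set (whisker R X)) : nbhs z A <->
  exists V, [/\ open V, V (tgt z) &
    forall c, PV V c -> src c = tgt z -> A (pmul z c)].
Proof.
rewrite nbhsE; split=> [[B [oB Bz] BA]|[V [oV Vz VA]]].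
  have [V [oV Vz BV]] := oB z Bz.
  by exists V; split => // c Vc sc; apply: BA; exact: BV.
exists [set z' | exists2 c, PV V c & src c = tgt z /\ z' = pmul z c]; last first.
  by move=> _ [c Vc [sc ->]]; exact: VA.
split; last first.
  exists (punit (tgt z)); first exact: PV_unit.
  by rewrite src_punit pmul1.
move=> _ [c Vc [sc ->]]; exists V; split => //.
  by rewrite tgt_pmul//; exact: PV_tgt.
move=> c' Vc'; rewrite tgt_pmul// => sc'; exists (pmul c c').
  exact: PV_mul.
by rewrite src_pmul// pmulA.
Qed.

Lemma whisker_cts_atP (W : topologicalType) (f : W -> whisker R X) (w : W) :
  {for w, continuous f} <-> forall V, open V -> V (tgt (f w)) ->
    \forall w' \near w, exists c, [/\ PV V c, src c = tgt (f w)
      & f w' = pmul (f w) c].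
Proof.
split=> [cf V oV Vf|H A].
  apply: (cf [set z | exists c, [/\ PV V c, src c = tgt (f w)
    & z = pmul (f w) c]]).
  by apply/nbhs_whisker; exists V; split => // c Vc sc; exists c.
move=> /nbhs_whisker[V [oV Vf VA]].
by apply: filterS (H V oV Vf) => w' [c [Vc sc e]] /=; rewrite e; exact: VA.
Qed.

End whisker_topology.

(** Propagation in both directions near each point makes [S] and its complement open, and the line
    is connected. *)
Lemma real_clopen_induction {R : realType} (S : set R) : S 0 ->
  (forall s0, exists2 e, 0 < e & forall s1 s2, `|s0 - s1| < e ->
    `|s0 - s2| < e -> S s1 -> S s2) -> forall s, S s.
Proof.
move=> S0 loc; suff : S = setT by move=> -> s.
have oS : open S.
  rewrite openE => s Ss; have [e e0 H] := loc s.
  by apply/nbhs_normP; exists e => // r /= sr; apply: (H s) => //; rewrite subrr normr0.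
have cS : closed S.
  rewrite -[S]setCK; apply: open_closedC; rewrite openE => s Ss.
  have [e e0 H] := loc s; apply/nbhs_normP; exists e => // r /= sr Sr.
  by apply: Ss; apply: (H r) => //; rewrite subrr normr0.
have : connected [set: R] by apply/connected_intervalP => a b _ _ c _.
apply; first by exists 0.
  by exists S => //; rewrite setTI.
by exists S => //; rewrite setTI.
Qed.

(** * Lifting families of paths to the universal covers *)

Section path_lifting.
Context {R : realType} {X W : topologicalType}.
Hypothesis nb : nice_basis R X.
Context (g : W -> path_space R X) (a : W -> whisker R X) (w0 : W).
Hypothesis g_cts : {for w0, continuous g}.
Hypothesis a_cts : {for w0, continuous a}.
Hypothesis ag : forall w, tgt (a w) = ev (g w) 0.

Definition lift_path (w : W) (s : R) : whisker R X :=
  pmul (a w) (seg (ev (g w)) 0 s).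

Lemma lift_src w s : tgt (a w) = src (seg (ev (g w)) 0 s).
Proof. by rewrite src_seg//; exact: ev_cts. Qed.

Lemma tgt_lift_path w s : tgt (lift_path w s) = ev (g w) s.
Proof.
by rewrite tgt_pmul; [rewrite tgt_seg//; exact: ev_cts|exact: lift_src].
Qed.

Lemma lift_path_step w s s' :
  pmul (lift_path w s) (seg (ev (g w)) s s') = lift_path w s'.
Proof.
have cg := @ev_cts _ _ (g w).
rewrite /lift_path -(@pmulA _ _ (a w) (seg _ 0 s) (seg _ s s')).
- by rewrite seg_mul.
- exact: lift_src.
- by rewrite (tgt_seg _ _ cg) (src_seg _ _ cg).
Qed.

(* Near [(w0, s0)] the paths stay in a nice set, where a class is determined by
   its end points; hence continuity propagates from any [s1] to any [s2] close to
   [s0], and then to all times since [R] is connected. *)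
Lemma lift_path_local (s0 : R) : exists2 e, 0 < e & forall s1 s2,
  `|s0 - s1| < e -> `|s0 - s2| < e -> {for w0, continuous (lift_path^~ s1)} ->
  {for (w0, s2), continuous (fun p : W * R => lift_path p.1 p.2)}.
Proof.
have [V [nV Vs0 _]] := nb (filterT : nbhs (ev (g w0) s0) setT).
have [oV _ _ uV] := (niceP V).1 nV.
have cgs s := (path_cts_atP g w0).1 g_cts s.
have : nbhs (w0, s0) [set p : W * R | V (ev (g p.1) p.2)].
  by apply: (cgs s0); exact: open_nbhs_nbhs.
move=> [[N J] /= [Nw0 /nbhs_normP[e /= e0 eJ]] NJ].
have NV w s : N w -> `|s0 - s| < e -> V (ev (g w) s).
  by move=> Nw se; apply: (NJ (w, s)); split => //; exact: eJ.
have segV w s s' : N w -> `|s0 - s| < e -> `|s0 - s'| < e ->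
    PV V (seg (ev (g w)) s s').
  move=> Nw se s'e; apply: PV_seg; first exact: ev_cts.
  move=> r r0 r1; apply: NV => //.
  rewrite -[r *: _]/(r * _).
  have -> : s0 - (s + r * (s' - s)) = (1 - r) * (s0 - s) + r * (s0 - s') by ring.
  apply: (le_lt_trans (ler_normD _ _)).
  rewrite !normrM (ger0_norm r0) ger0_norm ?subr_ge0//.
  have [->|rn0] := eqVneq r 0; first by rewrite subr0 mul1r mul0r addr0.
  have -> : e = (1 - r) * e + r * e by ring.
  apply: ler_ltD; first by rewrite ler_wpM2l ?subr_ge0// ltW.
  by rewrite ltr_pM2l// lt_neqAle eq_sym rn0.
exists e => // s1 s2 s1e s2e cs1; apply/whisker_cts_atP => V' oV' /=.
rewrite tgt_lift_path => V's2.
have Vs2 : V (ev (g w0) s2) by apply: NV => //; exact: nbhs_singleton.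
have [|V'' [nV'' V''s2 V''V]] := @nb (ev (g w0) s2) (V' `&` V).
  by apply: open_nbhs_nbhs; split => //; exact: openI.
have [oV'' _ pV'' _] := (niceP V'').1 nV''.
have n1 : \forall p \near (w0, s2), N p.1 /\ `|s0 - p.2| < e.
  exists (N, [set s | `|s0 - s| < e]) => //; split => //=.
  apply: open_nbhs_nbhs; split => //.
  have := @ball_open R R s0 e; rewrite -ball_normE.
  by apply.
have n2 : \forall p \near (w0, s2), V'' (ev (g p.1) p.2).
  by apply: (cgs s2); exact: open_nbhs_nbhs.
have n3 : \forall p \near (w0, s2), exists c, [/\ PV V c,
    src c = ev (g w0) s1 & lift_path p.1 s1 = pmul (lift_path w0 s1) c].
  have := (whisker_cts_atP (lift_path^~ s1) w0).1 cs1 V oV.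
  rewrite tgt_lift_path => /(_ (NV _ _ (nbhs_singleton Nw0) s1e)) n3.
  exists ([set w | exists c, [/\ PV V c, src c = ev (g w0) s1 &
    lift_path w s1 = pmul (lift_path w0 s1) c]], setT) => /=.
    by split => //; exact: filterT.
  by move=> [w s] /= [].
apply: filterS3 n1 n2 n3 => -[w s] /= [Nw se] V''s [d [Vd sd Ld]].
have [c V''c [sc tc]] := pV'' _ _ V''s2 V''s.
have cg v := @ev_cts _ _ (g v).
have Nw0' := nbhs_singleton Nw0.
exists c; split => //; first by apply: PV_sub V''c => x /V''V[].
have td : tgt d = ev (g w) s1.
  by rewrite -(tgt_lift_path w s1) Ld tgt_pmul// tgt_lift_path.
rewrite -(lift_path_step w s1 s) Ld -(lift_path_step w0 s1 s2).
have e0' := tgt_lift_path w0 s1.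
have sw := src_seg s1 s (cg w); have sw0 := src_seg s1 s2 (cg w0).
have tw0 := tgt_seg s1 s2 (cg w0).
rewrite -(@pmulA _ _ (lift_path w0 s1) d) ?e0' ?sw//.
rewrite -(@pmulA _ _ (lift_path w0 s1) _ c) ?e0' ?tw0//.
congr pmul; apply: uV.
- by apply: PV_mul; [rewrite src_seg|exact: Vd|exact: segV].
- apply: PV_mul; [by rewrite tgt_seg|exact: segV|].
  by apply: PV_sub V''c => x /V''V[].
- by rewrite !src_pmul ?tgt_seg ?src_seg.
- by rewrite !tgt_pmul ?tgt_seg ?src_seg.
Qed.

Lemma lift_path_cts (s : R) :
  {for (w0, s), continuous (fun p : W * R => lift_path p.1 p.2)}.
Proof.
have partial s1 : {for (w0, s1), continuous (fun p : W * R => lift_path p.1 p.2)}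
    -> {for w0, continuous (lift_path^~ s1)}.
  move=> cs; apply: (@cts_at_comp _ _ _ (fun w => (w, s1))
    (fun p : W * R => lift_path p.1 p.2)); last exact: cs.
  by apply: cts_at_pair; [exact: cts_at_id|exact: cts_at_cst].
have all : forall s1, {for w0, continuous (lift_path^~ s1)}.
  apply: real_clopen_induction; last first.
    move=> s0; have [e e0 H] := lift_path_local s0; exists e => // s1 s2 s1e s2e.
    by move=> cs1; apply: partial; exact: H s1e s2e cs1.
  suff -> : lift_path^~ 0 = a by [].
  apply/funext => w; rewrite /lift_path seg_refl pmul1//.
have [e e0 H] := lift_path_local s.
by apply: (H s s) => //; rewrite subrr normr0.
Qed.

End path_lifting.

(** * Cells of the universal covers *)

Section whisker_cells.
Context {R : realType} {X : topologicalType} (cw : CW_structure R X).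
Hypothesis nb : nice_basis R X.
Local Notation cmap := (cmap cw).

(** A cell of a universal cover is a cell of [X] together with a lift of its centre; [umap] extends
    this lift over the cell along segments. *)
Definition ucell : Type :=
  {c : cell cw & {a : Pi R X | tgt a = cmap c 0}}.
Definition udim (e : ucell) : nat := cell_dim (projT1 e).
Definition ubase (e : ucell) : Pi R X := proj1_sig (projT2 e).

Definition umap (e : ucell) (v : 'rV[R]_(udim e)) : whisker R X :=
  pmul (ubase e) (seg (cmap (projT1 e)) 0 v).

Lemma tgt_ubase e : tgt (ubase e) = cmap (projT1 e) 0.
Proof. exact: proj2_sig (projT2 e). Qed.

Lemma umap_src e v :
  tgt (ubase e) = src (seg (cmap (projT1 e)) 0 (v : 'rV[R]_(udim e))).
Proof. by rewrite tgt_ubase src_seg//; exact: cmap_cts. Qed.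

Lemma tgt_umap e v : tgt (umap v) = cmap (projT1 e) (v : 'rV[R]_(udim e)).
Proof.
by rewrite tgt_pmul; [rewrite tgt_seg//; exact: cmap_cts|exact: umap_src].
Qed.

Lemma umap_seg e (v w : 'rV[R]_(udim e)) :
  umap w = pmul (umap v) (seg (cmap (projT1 e)) v w).
Proof.
have cc := @cmap_cts _ _ cw (projT1 e).
rewrite /umap -(@pmulA _ _ (ubase e) (seg _ 0 v)) ?seg_mul//.
  exact: umap_src.
by rewrite (tgt_seg _ _ cc) (src_seg _ _ cc).
Qed.

Lemma ubase_umap e (v : 'rV[R]_(udim e)) :
  ubase e = pmul (umap v) (seg (cmap (projT1 e)) v 0).
Proof.
rewrite -umap_seg /umap seg_refl pmul1//.
by rewrite tgt_ubase.
Qed.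

Definition ucell_at (z : Pi R X) (c : cell cw) (v : 'rV[R]_(cell_dim c))
    (zv : tgt z = cmap c v) : ucell.
Proof.
exists c; exists (pmul z (seg (cmap c) v 0)).
have cc := @cmap_cts _ _ cw c.
by rewrite tgt_pmul ?tgt_seg// src_seg.
Defined.

Lemma umap_ucell_at z c v (zv : tgt z = cmap c v) :
  umap (v : 'rV[R]_(udim (ucell_at zv))) = z.
Proof.
have cc := @cmap_cts _ _ cw c.
rewrite /umap /ubase /= -pmulA ?tgt_seg ?src_seg// seg_mul// seg_refl.
by rewrite pmul1.
Qed.

Lemma umap_cts e : continuous (@umap e).
Proof.
move=> v; apply/whisker_cts_atP => V oV; rewrite tgt_umap => Vv.
have cc := @cmap_cts _ _ cw (projT1 e).
apply: filterS (nbhs_seg cc oV Vv) => w Vw.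
exists (seg (cmap (projT1 e)) v w); split => //; first by rewrite src_seg.
exact: umap_seg.
Qed.

Lemma umap_radial e v : 1 <= `|v| -> umap v = @umap e (unitv v).
Proof.
move=> v1; have cc := @cmap_cts _ _ cw (projT1 e).
have v0 : v != 0 by rewrite norm_gt0_neq// (lt_le_trans ltr01).
rewrite (umap_seg (unitv v) v).
suff -> : seg (cmap (projT1 e)) (unitv v) v = punit (cmap (projT1 e) (unitv v)).
  by rewrite pmul1// tgt_umap.
apply: cls_eq => [||s s0 s1]; first exact: seg_fun_cts.
  by move=> s; exact: cts_at_cst.
have -> : unitv v + s *: (v - unitv v) = (1 + s * (`|v| - 1)) *: unitv v.
  rewrite -{2}(scale_unitv v) scalerDl scale1r; congr (_ + _).
  by rewrite -scalerA scalerBl scale1r.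
have a1 : 1 <= 1 + s * (`|v| - 1).
  by rewrite lerDl mulr_ge0// subr_ge0.
have a0 : 0 < 1 + s * (`|v| - 1) by apply: lt_le_trans a1.
rewrite cmap_radial; last by rewrite normrZ norm_unitv// mulr1 gtr0_norm.
by rewrite unitv_scale// unitv_id// norm_unitv.
Qed.

(** Projecting to [X] identifies the cell and the coordinates; travelling back to the centre, by
    [ubase_umap], then identifies the base class. *)
Lemma umap_inj (e e' : ucell) v w : `|v| < 1 -> `|w| < 1 ->
  @umap e v = @umap e' w ->
  existT (fun e => 'rV[R]_(udim e)) e v = existT _ e' w.
Proof.
move=> v1 w1 vw.
have ew : existT (fun c => 'rV[R]_(cell_dim c)) (projT1 e) v =
    existT _ (projT1 e') w.
  by apply: cmap_inj => //; rewrite -!tgt_umap vw.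
(* Rebuilds the dependent pair from data that can be compared without transport. *)
pose mk (u : {c : cell cw & 'rV[R]_(cell_dim c)}) (a : Pi R X)
    (ha : tgt a = cmap (projT1 u) 0) : {e : ucell & 'rV[R]_(udim e)} :=
  existT (fun e : ucell => 'rV[R]_(udim e))
    (existT _ (projT1 u) (exist _ a ha)) (projT2 u).
have mk_eq u u' a a' ha ha' : u = u' -> a = a' -> mk u a ha = mk u' a' ha'.
  by move=> uu aa; subst u' a'; congr mk; exact: Prop_irrelevance.
have aa : ubase e = ubase e'.
  rewrite (ubase_umap v) (ubase_umap w) vw; congr pmul.
  pose sg (u : {c : cell cw & 'rV[R]_(cell_dim c)}) :=
    seg (cmap (projT1 u)) (projT2 u) 0.
  exact: (congr1 sg ew).
pose u := existT (fun c => 'rV[R]_(cell_dim c)) (projT1 e) v.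
pose u' := existT (fun c => 'rV[R]_(cell_dim c)) (projT1 e') w.
have := @mk_eq u u' _ _ (proj2_sig (projT2 e)) (proj2_sig (projT2 e')) ew aa.
rewrite {}/u {}/u'.
by rewrite /mk; case: e v w v1 w1 vw ew aa => c [a ha]; case: e' => c' [a' ha'].
Qed.

(** For nice [V] this is the graph of the local inverse, through [z], of the covering projection:
    [sheet_inj] gives uniqueness of [z']. *)
Definition sheet (V : set X) (z : Pi R X) (x : X) (z' : Pi R X) :=
  exists c, [/\ PV V c, src c = tgt z, tgt c = x & z' = pmul z c].

Lemma sheet_inj V z x z1 z2 : nice R V -> sheet V z x z1 -> sheet V z x z2 ->
  z1 = z2.
Proof.
move=> nV [c [Vc sc tc ->]] [d [Vd sd td ->]]; congr pmul.
have [_ _ _ uV] := (niceP V).1 nV.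
by apply: uV => //; [rewrite sc sd|rewrite tc td].
Qed.

Lemma sheet_mul V z x z' c : sheet V z x z' -> PV V c -> src c = x ->
  sheet V z (tgt c) (pmul z' c).
Proof.
move=> [d [Vd sd td ->]] Vc sc; exists (pmul d c).
have dc : tgt d = src c by rewrite td.
split; rewrite ?src_pmul ?tgt_pmul//; first exact: PV_mul.
by rewrite pmulA.
Qed.

Lemma tgt_sheet V z x z' : sheet V z x z' -> tgt z' = x.
Proof. by move=> [c [_ sc tc ->]]; rewrite tgt_pmul. Qed.

Lemma umap_cellular : cellular umap.
Proof.
split.
- exact: umap_cts.
- exact: umap_radial.
- move=> z; have [c [v [_ v1 e]]] := cellular_cover (cmap_cellular cw) (tgt z).
  by exists (ucell_at e), v; split => //; rewrite umap_ucell_at.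
- exact: umap_inj.
- move=> e v /(cmap_boundary (cw := cw)) [d [w [/= dc w1 ew]]].
  have tw : tgt (umap v) = cmap d w by rewrite tgt_umap.
  by exists (ucell_at tw), w; split => //; rewrite umap_ucell_at.
move=> T D f lD cf z0 Dz0 O; rewrite nbhsE => -[Q [oQ Qz0] QO].
have tgt_in z : in_cells umap D z -> in_cells cmap D (tgt z).
  by move=> [e [v [De v1 ->]]]; rewrite tgt_umap; exists (projT1 e), v.
have [V [nV Vz0 _]] := nb (filterT : nbhs (tgt z0) setT).
have [oV _ _ _] := (niceP V).1 nV.
(* The projection to [X] of the part of the sheet through [z0] that [f] sends into [Q]. Its
   preimages under characteristic maps are open because the sheet is locally the image of a single
   [umap]; this reduces the claim to the weak topology of [X]. *)
pose A := [set x | exists2 z, sheet V z0 x z & Q (f z)].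
have [|N oN NA] := @open_in_cells _ _ cw D A lD.
  move=> c Dc; rewrite openE => v /= [z sz Qz].
  have zv : tgt z = cmap c v := tgt_sheet sz.
  have Vv : V (cmap c v).
    by move: sz => [d [Vd _ <- _]]; exact: PV_tgt.
  have cc := @cmap_cts _ _ cw c.
  have n1 := nbhs_seg cc oV Vv.
  have cfe := cf (ucell_at zv) Dc.
  have n2 : nbhs v [set w : 'rV[R]_(udim (ucell_at zv)) | Q (f (umap w))].
    apply: cfe; apply: open_nbhs_nbhs; split => //=.
    by rewrite umap_ucell_at.
  rewrite /interior; apply: filterS2 n1 n2 => w Vvw /= Qw.
  exists (@umap (ucell_at zv) w) => //.
  rewrite (umap_seg (e := ucell_at zv) v w) umap_ucell_at.
  have <- : tgt (seg (cmap c) v w) = cmap c w by rewrite tgt_seg.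
  by apply: sheet_mul sz _ _ => //; rewrite src_seg.
have z0z0 : sheet V z0 (tgt z0) z0.
  exists (punit (tgt z0)); rewrite src_punit tgt_punit pmul1//.
  by split => //; exact: PV_unit.
have Nz0 : N (tgt z0) by apply/NA; [exact: tgt_in|exists z0].
apply/nbhs_whisker; exists (V `&` N); split => //; first exact: openI.
move=> c VNc sc Dz; apply: QO.
have VNt := PV_tgt VNc.
have tz : tgt (pmul z0 c) = tgt c by rewrite tgt_pmul.
have [z sz Qz] : A (tgt c).
  by apply/NA; [rewrite -tz; exact: tgt_in|case: VNt].
have sc' : sheet V z0 (tgt c) (pmul z0 c).
  by exists c; split => //; apply: PV_sub VNc => x [].
by rewrite (sheet_inj nV sc' sz).
Qed.

End whisker_cells.

(** * Lifting the universal covers to path spaces *)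

Section null_homotopies.
Context {R : realType} {X : topologicalType} {n : nat}.
Implicit Types (F : 'rV[R]_n -> X) (x : X).

(** A spheroid is encoded as a map on the whole space, constant outside the ball of radius 2; this
    radius leaves room for the unit ball and a collar around it. *)
Definition null_homotopic F x := exists H : 'rV[R]_n * R -> X,
  [/\ continuous H, forall w, H (w, 1) = F w, forall w, H (w, 0) = x &
    forall w t, 2 <= `|w| -> H (w, t) = x].

Definition ones : 'rV[R]_n := const_mx 1.

Lemma norm_ones : (0 < n)%N -> `|ones| = 1.
Proof.
move=> n0; have : ones != 0.
  apply/eqP => /(congr1 (fun v : 'rV[R]_n => v ord0 (Ordinal n0))).
  by rewrite !mxE => /eqP; rewrite oner_eq0.
by move=> /norm_coord[i ->]; rewrite mxE normr1.
Qed.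

(** For the sup norm the ball of radius 2 is a cube, identified with the unit cube by [4 * t - 2] in
    each coordinate, boundary to boundary. *)
Lemma homotopy_group_null F x : (2 <= n)%N -> continuous F ->
  (forall w, 2 <= `|w| -> F w = x) ->
  homotopy_group (n := n) x = [set hclass R (@cube_boundary R n) (cst x)] ->
  null_homotopic F x.
Proof.
move=> n2 cF Fx pin.
pose inn (q : cube R n) : 'rV[R]_n := \row_i (4 * valI (q ord0 i) - 2).
pose out (w : 'rV[R]_n) : cube R n := \row_i clampI ((w ord0 i + 2) / 4).
have cinn : continuous inn.
  move=> q A [P /= nP PA].
  exists (fun i j => (fun t => 4 * valI t - 2) @^-1` P i j).
    move=> i j; have := nP i j; rewrite mxE (ord1 i).
    apply: (cts_at_comp (f := @valI R) (g := fun t : R => 4 * t - 2)).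
      exact: valI_cts.
    apply: cts_at_sub; last exact: cts_at_cst.
    by apply: cts_at_mul; [exact: cts_at_cst|exact: cts_at_id].
  move=> q' q'P; apply: PA => i j; rewrite mxE.
  by have := q'P i j; rewrite /= (ord1 i).
have cout : continuous out.
  move=> w A [P /= nP PA].
  exists (fun i j => (fun t => clampI ((t + 2) / 4)) @^-1` P i j).
    move=> i j; have := nP i j; rewrite mxE (ord1 i).
    apply: (cts_at_comp (f := fun t : R => (t + 2) / 4) (g := clampI)).
      apply: cts_at_mul; last exact: cts_at_cst.
      by apply: cts_at_add; [exact: cts_at_id|exact: cts_at_cst].
    exact: clampI_cts.
  move=> w' w'P; apply: PA => i j; rewrite mxE.
  by have := w'P i j; rewrite /= (ord1 i).
have bd q : cube_boundary q -> F (inn q) = x.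
  move=> [i qi]; apply: Fx; apply: (le_trans _ (coord_le_norm _ i)); rewrite mxE.
  case: qi => ->; rewrite ?valI0 ?valI1 ler_normr; apply/orP; [right|left]; lra.
have outbd w : 2 <= `|w| -> cube_boundary (out w).
  move=> w2; have w0 : w != 0 by rewrite norm_gt0_neq// (lt_le_trans _ w2).
  have [i wi] := norm_coord w0; exists i; rewrite mxE.
  move: w2; rewrite wi ler_normr => /orP[wi2|wi2]; [right|left].
    by apply: valI_inj; rewrite valI1 -[LHS]/(cl01 _) cl01_ge1//; lra.
  by apply: valI_inj; rewrite valI0 -[LHS]/(cl01 _) cl01_le0//; lra.
have inout w : F (inn (out w)) = F w.
  have [w2|w2] := leP 2 `|w|; first by rewrite (Fx w)// bd//; exact: outbd.
  congr F; apply/rowP => i; rewrite !mxE.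
  have := le_lt_trans (coord_le_norm w i) w2; rewrite ltr_norml => /andP[w21 w22].
  by rewrite clampIK; lra.
pose f : continuousType (cube R n) X := mkcts (cts_comp cinn cF).
have : homotopy_group (n := n) x (hclass R (@cube_boundary R n) f).
  by exists f => // q; exact: bd.
rewrite pin /= => /eqquotP/asboolP [K [cK K0 K1 KA]].
exists (fun p => K (out p.1, clampI (1 - p.2))); split => /=.
- move=> p; apply: (@cts_at_comp _ _ _
    (fun p : 'rV[R]_n * R => (out p.1, clampI (1 - p.2))) K); last exact: cK.
  apply: cts_at_pair.
    by apply: (@cts_at_comp _ _ _ fst out); [exact: cts_at_fst|exact: cout].
  apply: (@cts_at_comp _ _ _ (fun p : 'rV[R]_n * R => 1 - p.2) clampI).
    by apply: cts_at_sub; [exact: cts_at_cst|exact: cts_at_snd].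
  exact: clampI_cts.
- by move=> w; rewrite subrr -[clampI 0]/I0 K0; exact: inout.
- by move=> w; rewrite subr0 -[clampI 1]/I1 K1.
- by move=> w t /outbd w2; rewrite KA//; exact: bd.
Qed.

(** In dimension 1 the parameter [4 * s - 2] runs through the interval from [-2] to [2], and a
    homotopy of paths with fixed ends is already the required contraction. *)
Lemma loop_null F x : n = 1%N -> continuous F ->
  (forall w, 2 <= `|w| -> F w = x) ->
  cls (fun s : R => F ((4 * s - 2) *: ones)) = punit x ->
  null_homotopic F x.
Proof.
move=> n1 cF Fx; have n0 : (0 < n)%N by rewrite n1.
pose i0 := Ordinal n0.
have onesE (w : 'rV[R]_n) : w = w ord0 i0 *: ones.
  apply/rowP => i; rewrite !mxE mulr1; congr (w _ _); apply: val_inj => /=.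
  by case: i => i /=; rewrite n1 ltnS leqn0 => /eqP.
have normE (w : 'rV[R]_n) : `|w| = `|w ord0 i0|.
  by rewrite {1}(onesE w) normrZ norm_ones// mulr1.
have cf : continuous (fun s : R => F ((4 * s - 2) *: ones)).
  move=> s; apply: (@cts_at_comp R 'rV[R]_n X (fun s : R => (4 * s - 2) *: ones)).
    apply: (@cts_at_scale R R 'rV[R]_n); last exact: cts_at_cst.
    apply: cts_at_sub; last exact: cts_at_cst.
    by apply: cts_at_mul; [exact: cts_at_cst|exact: cts_at_id].
  exact: cF.
move=> /path_class_homotopy[K [cK K0 K1 Kt]].
pose out (w : 'rV[R]_n) := cl01 ((w ord0 i0 + 2) / 4).
have cout : continuous out.
  move=> w; apply: (@cts_at_cl01 R 'rV[R]_n).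
  apply: (@cts_at_mul R 'rV[R]_n); last exact: cts_at_cst.
  apply: (@cts_at_add R 'rV[R]_n); last exact: cts_at_cst.
  exact: coord_continuous.
have outF w : F ((4 * out w - 2) *: ones) = F w.
  have [w2|w2] := leP 2 `|w|.
    rewrite (Fx w)// Fx// normrZ norm_ones// mulr1 /out.
    move: w2; rewrite normE ler_normr => /orP[w2|w2].
      by rewrite cl01_ge1; [rewrite ler_normr; apply/orP; left|]; lra.
    by rewrite cl01_le0; [rewrite ler_normr; apply/orP; right|]; lra.
  congr F; rewrite [RHS]onesE; congr (_ *: _).
  move: w2; rewrite normE ltr_norml => /andP[w1 w2].
  by rewrite /out cl01_id; lra.
have Kx : forall t, K (0, t) = x /\ K (1, t) = x.
  have F0 : ev (mkp (fun s : R => F ((4 * s - 2) *: ones))) 0 = x.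
    rewrite ev_mkp// cl01_le0// Fx// normrZ norm_ones// mulr1 ler_normr.
    by apply/orP; right; lra.
  have F1 : ev (mkp (fun s : R => F ((4 * s - 2) *: ones))) 1 = x.
    rewrite ev_mkp// cl01_ge1// Fx// normrZ norm_ones// mulr1 ler_normr.
    by apply/orP; left; lra.
  by move=> t; have [-> ->] := Kt t.
exists (fun p => K (out p.1, 1 - p.2)); split => /=.
- move=> p; apply: (@cts_at_comp _ _ _
    (fun p : 'rV[R]_n * R => (out p.1, 1 - p.2)) K); last exact: cK.
  apply: cts_at_pair.
    by apply: (@cts_at_comp _ _ _ fst out); [exact: cts_at_fst|exact: cout].
  by apply: cts_at_sub; [exact: cts_at_cst|exact: cts_at_snd].
- move=> w; rewrite subrr K0 ev_mkp// cl01_id ?outF ?cl01_ge0 ?cl01_le1//.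
- by move=> w; rewrite subr0 K1 ev_mkp// => s; exact: cts_at_cst.
- move=> w t; rewrite normE ler_normr => /orP[w2|w2].
    by rewrite /out cl01_ge1 ?(Kx _).2//; lra.
  by rewrite /out cl01_le0 ?(Kx _).1//; lra.
Qed.

End null_homotopies.

(** * Filling the cylinder over a cell *)

Section filling.
Context {R : realType} {X : topologicalType} {n : nat}.
Context (phi : 'rV[R]_n -> X) (b : 'rV[R]_n -> path_space R X) (x : X).
Hypothesis phi_cts : continuous phi.
Hypothesis phi_radial : forall v, 1 <= `|v| -> phi v = phi (unitv v).
Hypothesis b_cts : forall v, v != 0 -> {for v, continuous b}.
Hypothesis b_radial : forall (a : R) v, 0 < a -> b (a *: v) = b v.
Hypothesis b_src : forall v, v != 0 -> ev (b v) 0 = x.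
Hypothesis b_tgt : forall v, v != 0 -> ev (b v) 1 = phi (unitv v).

(** The top of the cylinder over the ball, surrounded by its side flattened into the collar of radii
    1 to 2, where [b w] is run backwards from [phi] to [x]. *)
Definition collared_map (w : 'rV[R]_n) : X :=
  if `|w| <= 1 then phi w else ev (b w) (2 - `|w|).

Lemma ge_neq0 (a : R) (w : 'rV[R]_n) : 0 < a -> a <= `|w| -> w != 0.
Proof. by move=> a0 aw; rewrite norm_gt0_neq// (lt_le_trans a0). Qed.

Lemma collared_map_out w : 1 <= `|w| ->
  collared_map w = ev (b w) (2 - `|w|).
Proof.
move=> w1; rewrite /collared_map; case: ifPn => // w1'.
have -> : `|w| = 1 by apply/eqP; rewrite eq_le w1 w1'.
rewrite -[2 - 1]/(1 + 1 - 1) addrK b_tgt ?(ge_neq0 ltr01)//.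
by rewrite phi_radial.
Qed.

Lemma collared_map_far w : 2 <= `|w| -> collared_map w = x.
Proof.
move=> w2; rewrite collared_map_out; last by lra.
rewrite -(b_src (ge_neq0 _ w2))// -[ev _ (2 - _)]ev_cl01 cl01_le0//.
by rewrite subr_le0.
Qed.

Lemma collared_map_cts : continuous collared_map.
Proof.
move=> w; apply: (@cts_at_if _ _ _ (fun w : 'rV[R]_n => `|w|)) => [|_|w1|w1].
- exact: norm_cts.
- exact: phi_cts.
- apply: path_cts_at; first by apply: b_cts; exact: ge_neq0 w1.
  by apply: cts_at_sub; [exact: cts_at_cst|exact: norm_cts].
- by rewrite -collared_map_out ?w1// /collared_map w1 lexx.
Qed.

Lemma collared_map_ray (t : R) w : `|w| = 1 -> 0 <= t -> t <= 1 ->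
  collared_map ((2 - t) *: w) = ev (b w) t.
Proof.
move=> w1 t0 t1; have a0 : 0 < 2 - t by lra.
have nw : `|(2 - t) *: w| = 2 - t by rewrite normrZ w1 mulr1 gtr0_norm.
by rewrite collared_map_out nw ?b_radial ?subKr//; lra.
Qed.

Hypothesis null : null_homotopic collared_map x.

(** With the bottom sent to [x], [collared_map] is what is prescribed on the whole boundary of the
    cylinder, so a null homotopy extends it to the inside. *)
Lemma filling : exists G : 'rV[R]_n * R -> X, [/\ continuous G,
  forall v, G (v, 0) = x, forall v, G (v, 1) = phi v &
  forall v t, 1 <= `|v| -> 0 <= t -> t <= 1 -> G (v, t) = ev (b v) t].
Proof.
have [H [cH H1 H0 Hfar]] := null.
(* in the coordinates (norm, time), [(lam, tau)] sends the bottom of the cylinder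
   over the ball to the bottom and the far side of the domain of [H], where [H]
   is constant, its top to the unit ball and its side to the collar, at time 1 *)
pose lam (v : 'rV[R]_n) (t : R) :=
  (1 - cl01 t) * (4 / Num.max `|projB v| 2^-1 - 2) + cl01 t.
pose tau (v : 'rV[R]_n) (t : R) := Num.max (cl01 t) (2 * `|projB v| - 1).
have m0 v : Num.max `|projB v| 2^-1 != 0 :> R.
  by rewrite gt_eqF// lt_max invr_gt0 ltr0n orbT.
have cn : continuous (fun q : 'rV[R]_n * R => `|projB q.1|).
  move=> q; apply: (@cts_at_norm R ('rV[R]_n * R)%type 'rV[R]_n (fun q => projB q.1)).
  by apply: (@cts_at_comp _ _ _ fst projB); [exact: cts_at_fst|exact: projB_cts].
have ct : continuous (fun q : 'rV[R]_n * R => cl01 q.2).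
  by move=> q; apply: cts_at_cl01; exact: cts_at_snd.
exists (fun q => H (lam q.1 q.2 *: projB q.1, tau q.1 q.2)); split => /=.
- move=> q; apply: (@cts_at_comp _ _ _
    (fun q : 'rV[R]_n * R => (lam q.1 q.2 *: projB q.1, tau q.1 q.2)) H);
    last exact: cH.
  apply: cts_at_pair; last first.
    apply: cts_at_max; first exact: ct.
    apply: cts_at_sub; last exact: cts_at_cst.
    by apply: cts_at_mul; [exact: cts_at_cst|exact: cn].
  apply: cts_at_scale; last first.
    by apply: (@cts_at_comp _ _ _ fst projB); [exact: cts_at_fst|exact: projB_cts].
  apply: cts_at_add; last exact: ct.
  apply: cts_at_mul; first by apply: cts_at_sub; [exact: cts_at_cst|exact: ct].
  apply: cts_at_sub; last exact: cts_at_cst.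
  apply: cts_at_div; [exact: cts_at_cst| |exact: m0].
  by apply: cts_at_max; [exact: cn|exact: cts_at_cst].
- move=> v; have [v2|v2] := leP `|projB v| 2^-1.
    rewrite /tau cl01_id// max_l ?H0//; lra.
  (* The scaled point has norm 4 minus twice the norm of [projB v], which is at least 2. *)
  rewrite Hfar// normrZ /lam cl01_id// subr0 mul1r addr0 max_l ?(ltW v2)//.
  have p1 := norm_projB v.
  have p0 : 0 < `|projB v| by rewrite (lt_trans _ v2).
  rewrite ger0_norm; last by rewrite subr_ge0 ler_pdivlMr//; lra.
  by rewrite mulrBl divfK ?gt_eqF//; lra.
- move=> v; have p1 := norm_projB v; rewrite /lam /tau cl01_id// subrr mul0r add0r.
  rewrite scale1r max_l; last by lra.
  rewrite H1 /collared_map norm_projB.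
  have [v1|/ltW v1] := leP `|v| 1; first by rewrite projB_id.
  by rewrite projB_unitv// -phi_radial.
- move=> v t v1 t0 t1; rewrite /lam /tau projB_unitv// cl01_id//.
  have v0 := ge_neq0 ltr01 v1.
  rewrite norm_unitv// max_l; last by lra.
  rewrite max_r; last by lra.
  rewrite (_ : _ + t = 2 - t); last by field.
  rewrite (_ : 2 * 1 - 1 = 1); last by ring.
  by rewrite H1 collared_map_ray ?norm_unitv// b_radial// invr_gt0 normr_gt0.
Qed.

(** On the rectangle over the radial segment from [u] to [v], [G] is constant at the bottom, equal
    to [b u] on one side and to the image of the segment at the top. *)
Lemma filling_cls (G : 'rV[R]_n * R -> X) : (0 < n)%N -> continuous G ->
  (forall v, G (v, 0) = x) -> (forall v, G (v, 1) = phi v) ->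
  (forall v t, 1 <= `|v| -> 0 <= t -> t <= 1 -> G (v, t) = ev (b v) t) ->
  forall v, exists2 u, `|u| = 1 &
    cls (fun t => G (v, t)) = pmul (path_class (b u)) (seg phi u v).
Proof.
move=> n0 cG G0 G1 Gb v.
have [u u1 vE] : exists2 u : 'rV[R]_n, `|u| = 1 & v = `|v| *: u.
  have [->|v0] := eqVneq v 0.
    by exists ones; rewrite ?norm_ones// normr0 scale0r.
  by exists (unitv v); rewrite ?norm_unitv// scale_unitv.
exists u => //.
pose F (p : R * R) := G (p.1 *: u, p.2).
have cF : continuous F.
  move=> p; apply: (@cts_at_comp _ _ _ (fun p : R * R => (p.1 *: u, p.2)) G);
    last exact: cG.
  apply: cts_at_pair; last exact: cts_at_snd.
  apply: (@cts_at_scale R (R * R)%type 'rV[R]_n); last exact: cts_at_cst.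
  exact: cts_at_fst.
have cGv w : continuous (fun t : R => G (w, t)).
  move=> t; apply: (@cts_at_comp R _ _ (fun t : R => (w, t)) G); last exact: cG.
  by apply: cts_at_pair; [exact: cts_at_cst|exact: cts_at_id].
have vert (r : R) : cls (fun t => G (r *: u, t)) = seg F (r, 0) (r, 1).
  congr cls; apply/funext => t; rewrite /F /=.
  by rewrite subrr scaler0 addr0 add0r subr0 [t *: 1]mulr1.
pose cr0 : R * R := (`|v|, 0); pose cr1 : R * R := (`|v|, 1).
pose c10 : R * R := (1, 0); pose c11 : R * R := (1, 1).
have e1 := seg_mul cr0 c10 c11 cF; have e2 := seg_mul cr0 c11 cr1 cF.
have bottom : seg F cr0 c10 = punit x.
  rewrite /seg /punit; congr cls; apply/funext => s.
  by rewrite /F /= subrr scaler0 addr0 G0.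
have top : seg F c11 cr1 = seg phi u v.
  rewrite /seg; congr cls; apply/funext => s.
  rewrite /F /= subrr scaler0 addr0 G1; congr phi.
  rewrite [in RHS]vE scalerDl scale1r -[s *: (`|v| - 1)]/(s * (`|v| - 1)).
  by rewrite -scalerA scalerBl scale1r.
have side : seg F c10 c11 = path_class (b u).
  rewrite -vert -cls_ev; apply: cls_eq => [||t t0 t1].
  - exact: cGv.
  - exact: ev_cts.
  - by rewrite scale1r Gb// u1.
rewrite {1}vE vert -/cr0 -/cr1 -e2 -e1 bottom top side pmul1l//.
rewrite src_path -(b_src (v := u))//.
by rewrite norm_gt0_neq// u1.
Qed.

(** From [-2] to [2] the loop comes in along [b (- ones)], crosses the cell and goes back along
    [b ones] reversed. *)
Lemma collared_map_loop : n = 1%N ->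
  cls (fun s : R => collared_map ((4 * s - 2) *: ones)) =
  pmul (pmul (path_class (b (- ones))) (seg phi (- ones) ones))
    (pflip (path_class (b ones))).
Proof.
move=> n1; have o1 : `|ones : 'rV[R]_n| = 1 by rewrite norm_ones// n1.
pose F (t : R) := collared_map (t *: ones).
have cF : continuous F.
  move=> t; apply: (@cts_at_comp R _ _ (fun t : R => t *: (ones : 'rV[R]_n)));
    last exact: collared_map_cts.
  by apply: (@cts_at_scale R R); [exact: cts_at_id|exact: cts_at_cst].
have -> : cls (fun s : R => collared_map ((4 * s - 2) *: ones)) = seg F (- 2) 2.
  congr cls; apply/funext => s; congr collared_map; congr (_ *: _).
  by rewrite -[_ *: _]/(_ * _); ring.
have ray (w : 'rV[R]_n) : `|w| = 1 ->
    cls (fun t : R => collared_map ((2 - t) *: w)) = path_class (b w).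
  move=> w1; rewrite -cls_ev; apply: cls_eq => [||t t0 t1].
  - move=> t; apply: (@cts_at_comp R _ _ (fun t : R => (2 - t) *: w));
      last exact: collared_map_cts.
    apply: (@cts_at_scale R R 'rV[R]_n); last exact: cts_at_cst.
    by apply: cts_at_sub; [exact: cts_at_cst|exact: cts_at_id].
  - exact: ev_cts.
  - exact: collared_map_ray.
rewrite -(@seg_mul _ _ _ F (- 2) 1 2)// -(@seg_mul _ _ _ F (- 2) (- 1) 1)//.
congr (pmul (pmul _ _) _).
- rewrite -(ray (- ones)) ?normrN//; congr cls; apply/funext => s.
  congr collared_map; rewrite scalerN -scaleNr; congr (_ *: _).
  by rewrite -[_ *: _]/(_ * _); ring.
- rewrite /seg; apply: cls_eq => [||s s0 s1].
  + exact: seg_fun_cts.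
  + exact: seg_fun_cts.
  + have -> : - ones + s *: (ones - - ones) = (- 1 + s *: (1 - - 1)) *: (ones : 'rV[R]_n).
      by rewrite scalerDl scaleN1r -[s *: (1 - - 1)]/(s * (1 - - 1)) -scalerA !opprK scalerDl scale1r.
    rewrite /F /collared_map normrZ o1 mulr1 ifT// -[_ *: _]/(_ * _) ler_norml.
    by apply/andP; split; lra.
- rewrite -(ray ones)// -(@seg_inv _ _ R F 2 1 cF); congr pflip; congr cls.
  apply/funext => s; congr collared_map; congr (_ *: _).
  by rewrite -[_ *: _]/(_ * _); ring.
Qed.

End filling.

Section lifting_the_universal_cover.
Context {R : realType} {X : topologicalType} (cw : CW_structure R X).
Hypothesis nb : nice_basis R X.
Hypothesis pin : forall n (x : X), (2 <= n)%N ->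
  homotopy_group (n := n) x = [set hclass R (@cube_boundary R n) (cst x)].

Lemma rV0_eq0 (n : nat) (v : 'rV[R]_n) : n = 0%N -> v = 0.
Proof. by move=> n0; subst n; exact: thinmx0. Qed.

(** Over a cell, a family of representatives is a map on the cylinder, prescribed on its boundary;
    [filling] extends it and [filling_cls] checks that the classes inside are still the right
    ones. *)
Lemma path_section (x0 : X) : exists sigma : whisker R X -> path_space R X,
  continuous sigma /\ forall z, path_class (sigma z) = z.
Proof.
apply: (@cellular_extension _ _ _ _ _ (umap_cellular cw nb) _
  (fun z g => path_class g = z) (pcst x0)) => e b cb bP brad.
pose phi : 'rV[R]_(udim e) -> X := cmap cw (projT1 e).
have cphi : continuous phi by exact: cmap_cts.
have [e0|n0] := posnP (udim e).
  exists (fun v => rep (umap v)); split => [v|v v1|v].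
  - apply: (@cts_at_near _ _ (fun=> rep (umap v))); last exact: cts_at_cst.
    have : nbhs v setT by exact: (@filterT _ _ (nbhs_filter v)).
    by apply: filterS => w _; rewrite (rV0_eq0 v e0) (rV0_eq0 w e0).
  - by move: v1; rewrite (rV0_eq0 v e0) normr0 ler10.
  - exact: repK.
have bsrc v : v != 0 -> ev (b v) 0 = src (ubase e).
  move=> v0; rewrite -src_path bP// src_pmul//; exact: umap_src.
have btgt v : v != 0 -> ev (b v) 1 = phi (unitv v).
  by move=> v0; rewrite -tgt_path bP// tgt_umap.
have phirad v : 1 <= `|v| -> phi v = phi (unitv v) by exact: cmap_radial.
have unit_bP (u : 'rV[R]_(udim e)) : `|u| = 1 -> path_class (b u) = umap u.
  by move=> u1; rewrite bP ?unitv_id// norm_gt0_neq// u1.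
have null : null_homotopic (collared_map phi b) (src (ubase e)).
  have cF := collared_map_cts cphi phirad cb btgt.
  have Ffar := collared_map_far phirad bsrc btgt.
  have [n2|n1] := leqP 2 (udim e).
    by apply: homotopy_group_null => //; exact: pin.
  have {}n1 : udim e = 1%N by apply/eqP; rewrite eqn_leq n0 -ltnS n1.
  have o1 : `|ones : 'rV[R]_(udim e)| = 1 by rewrite norm_ones.
  apply: loop_null => //.
  rewrite (collared_map_loop cphi phirad cb brad btgt n1).
  have om : `|- ones : 'rV[R]_(udim e)| = 1 by rewrite normrN.
  rewrite (unit_bP _ om) (unit_bP _ o1).
  (* The classes at the two ends of the 1-cell differ by the cell itself, so the loop is a class
     followed by its inverse. *)
  have us : @umap _ _ cw e ones =
      pmul (@umap _ _ cw e (- ones)) (seg phi (- ones) ones) := umap_seg _ _.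
  rewrite -us.
  rewrite pmulV; congr punit; apply: src_pmul; exact: umap_src.
have [G [cG G0 G1 Gb]] := filling phirad brad btgt null.
have cGv v : continuous (fun t : R => G (v, t)).
  move=> t; apply: (@cts_at_comp R _ _ (fun t : R => (v, t)) G); last exact: cG.
  by apply: cts_at_pair; [exact: cts_at_cst|exact: cts_at_id].
exists (fun v => mkp (fun t => G (v, t))); split => [v|v v1|v].
- apply: mkp_cts_at => // s.
  rewrite (_ : (fun _ => _) = G); first exact: cG.
  by apply/funext => -[].
- apply: path_ext => t t0 t1.
  by rewrite ev_mkp// cl01_id// Gb.
- have [u u1] := filling_cls bsrc n0 cG G0 G1 Gb v.
  by move=> GE; rewrite (@umap_seg _ _ _ e u v) -(unit_bP _ u1) -GE.
Qed.

End lifting_the_universal_cover.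

(** * Gluing *)

Section collar_origin.
Context {R : realType} {X : topologicalType} (t : X -> R)
  (h : X -> path_space R X).
Hypothesis th : is_collar t h.

(* a lift of [x] to [whisker R X], locally constant up to moving the end *)
Definition origin (x : X) : whisker R X := pflip (path_class (h x)).

Lemma tgt_origin x : tgt (origin x) = x.
Proof. by rewrite tgt_pflip src_path (collar_start th). Qed.

(** By [collar_PV], [c] follows one collar path up and the other one down; the first cancels against
    the origin. *)
Lemma origin_mul (c : Pi R X) : PV [set x | 0 < t x] c ->
  pmul (origin (src c)) c = origin (tgt c).
Proof.
move=> tc.
have e0 x : tgt (path_class (h x)) = src (pflip (path_class (h x))).
  by rewrite src_pflip.
rewrite [X in pmul _ X](collar_PV th tc) /origin.
have ends : ev (h (src c)) 1 = ev (h (tgt c)) 1.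
  move: tc => [f [cf tf ->]]; rewrite src_cls// tgt_cls//.
  by rewrite [RHS](collar_end th).
rewrite pmulA ?tgt_pflip ?src_pflip ?tgt_path//.
by rewrite pmulVl pmul1l// src_pflip !tgt_path.
Qed.

(** Nearby points are joined to [x] by small paths inside the collar, and by [origin_mul] the origin
    changes by exactly such a move of its end. *)
Lemma origin_cts x : locally_pc R X -> 0 < t x -> {for x, continuous origin}.
Proof.
move=> lpc tx; apply/whisker_cts_atP => V oV; rewrite tgt_origin => Vx.
pose U := V `&` [set x | 0 < t x].
have oU : open U.
  apply: openI => //; have /continuousP ct := collar_weight_cts th.
  by apply: (ct [set r | 0 < r]); exact: open_gt.
have : nbhs x (pathcomp R U x).
  by apply: open_nbhs_nbhs; split; [exact: lpc|exact: pathcomp_refl].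
apply: filterS => y [c [Uc sc tc]]; exists c; split => //.
  by apply: PV_sub Uc => z [].
rewrite -sc -tc -origin_mul//.
by apply: PV_sub Uc => z [].
Qed.

End collar_origin.

(** * Deforming a path to a normal form of its class *)

Section pushing.
Context {R : realType} {X : topologicalType}.
Hypothesis nb : nice_basis R X.
Context (sigma : whisker R X -> path_space R X).
Hypothesis sigma_cts : continuous sigma.
Hypothesis sigmaK : forall z, path_class (sigma z) = z.
Implicit Types (z : whisker R X) (g : path_space R X) (a s : R).

Lemma sigma0 z : ev (sigma z) 0 = src z.
Proof. by rewrite -{2}(sigmaK z) src_path. Qed.

Lemma sigma1 z : ev (sigma z) 1 = tgt z.
Proof. by rewrite -{2}(sigmaK z) tgt_path. Qed.

Definition lft z g s : whisker R X := pmul z (seg (ev g) 0 s).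

(** The path is traversed for [s] between [a / 3] and [1 - a / 3] only. During the first [a / 3] the
    depth grows from [0] to [a], it stays there, then returns to [0]. For [a = 1] the middle third
    is spent at depth [1], at the source of [z], where nothing of the path is visible. *)
Definition push_time a s := cl01 ((s - a / 3) / (1 - 2 * a / 3)).
Definition push_depth a s := Num.min a (Num.min (3 * s) (3 * (1 - s))).

(* [push z g 0 = g], while [push z g 1] goes from the beginning of [g] back to
   the source of [z] along [sigma z], then on to the end of [g] along
   [sigma (z g)] *)
Definition push z g a : path_space R X := mkp (fun s =>
  ev (sigma (lft z g (push_time a s))) (1 - push_depth a s)).

Lemma push_fun_cts (W : topologicalType) (f : W -> path_space R X)
    (o : W -> whisker R X) (d : W -> R) (w : W) (s : R) :
  {for w, continuous f} -> {for w, continuous o} -> {for w, continuous d} ->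
  (forall w, tgt (o w) = ev (f w) 0) -> d w <= 1 ->
  {for (w, s), continuous (fun p : W * R =>
    ev (sigma (lft (o p.1) (f p.1) (push_time (d p.1) p.2)))
      (1 - push_depth (d p.1) p.2))}.
Proof.
move=> cf co cd of_ d1.
have cd1 : {for (w, s), continuous (fun p : W * R => d p.1)}.
  by apply: (@cts_at_comp _ _ _ fst d); [exact: cts_at_fst|exact: cd].
have cs : {for (w, s), continuous (fun p : W * R => p.2)} by exact: cts_at_snd.
have cc (r : R) : {for (w, s), continuous (fun p : W * R => r)}.
  exact: cts_at_cst.
apply: path_cts_at; last first.
  apply: cts_at_sub; first exact: cc.
  apply: cts_at_min => //; apply: cts_at_min; first exact: cts_at_mul.
  by apply: cts_at_mul => //; exact: cts_at_sub.
apply: (@cts_at_comp _ _ _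
  (fun p : W * R => lft (o p.1) (f p.1) (push_time (d p.1) p.2)) sigma);
  last exact: sigma_cts.
apply: (@cts_at_comp _ _ _ (fun p : W * R => (p.1, push_time (d p.1) p.2))
  (fun p : W * R => lift_path f o p.1 p.2)); last first.
  exact: (lift_path_cts nb cf co of_).
apply: cts_at_pair; first exact: cts_at_fst.
apply: cts_at_cl01; apply: cts_at_div => /=.
- by apply: cts_at_sub => //; exact: cts_at_mul.
- by apply: cts_at_sub => //; apply: cts_at_mul => //; exact: cts_at_mul.
- by rewrite gt_eqF//; lra.
Qed.

Lemma push_path_cts z g a : tgt z = ev g 0 -> a <= 1 -> continuous (fun s =>
  ev (sigma (lft z g (push_time a s))) (1 - push_depth a s)).
Proof.
move=> zg a1 s; apply: (@cts_at_comp R _ _ (fun s : R => (0 : R, s))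
  (fun p : R * R => ev (sigma (lft z g (push_time a p.2))) (1 - push_depth a p.2))).
  by apply: cts_at_pair; [exact: cts_at_cst|exact: cts_at_id].
exact: (@push_fun_cts R (fun=> g) (fun=> z) (fun=> a) 0 s
  (@cts_at_cst _ _ _ _) (@cts_at_cst _ _ _ _) (@cts_at_cst _ _ _ _)).
Qed.

Lemma push_cts (W : topologicalType) (f : W -> path_space R X)
    (o : W -> whisker R X) (d : W -> R) (w : W) :
  {for w, continuous f} -> {for w, continuous o} -> {for w, continuous d} ->
  (forall w, tgt (o w) = ev (f w) 0) -> (forall w, d w <= 1) ->
  {for w, continuous (fun w => push (o w) (f w) (d w))}.
Proof.
move=> cf co cd of_ d1; apply: mkp_cts_at => [w'|s].
  exact: push_path_cts.
exact: push_fun_cts.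
Qed.

Lemma ev_push z g a s : tgt z = ev g 0 -> a <= 1 -> 0 <= s -> s <= 1 ->
  ev (push z g a) s = ev (sigma (lft z g (push_time a s))) (1 - push_depth a s).
Proof.
move=> zg a1 s0 s1; rewrite ev_mkp; first by rewrite cl01_id.
exact: push_path_cts.
Qed.

Lemma tgt_lft z g s : tgt z = ev g 0 -> tgt (lft z g s) = ev g s.
Proof.
move=> zg; have cg := @ev_cts _ _ g.
by rewrite tgt_pmul ?tgt_seg// src_seg.
Qed.

Lemma src_lft z g s : tgt z = ev g 0 -> src (lft z g s) = src z.
Proof.
move=> zg; have cg := @ev_cts _ _ g.
by rewrite src_pmul// src_seg.
Qed.

Lemma lft0 z g : tgt z = ev g 0 -> lft z g 0 = z.
Proof. by move=> zg; rewrite /lft seg_refl pmul1. Qed.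

Lemma lft1 z g : lft z g 1 = pmul z (path_class g).
Proof. by rewrite /lft -cls_seg ?cls_ev//; exact: ev_cts. Qed.

Lemma push0 z g : tgt z = ev g 0 -> push z g 0 = g.
Proof.
move=> zg; apply: path_ext => s s0 s1; rewrite ev_push//.
have -> : push_depth 0 s = 0.
  by rewrite /push_depth min_l// le_min; apply/andP; split; lra.
rewrite subr0 sigma1 tgt_lft// /push_time mulr0 !mul0r !subr0 divr1.
by rewrite cl01_id.
Qed.

Lemma push_start z g a : tgt z = ev g 0 -> 0 <= a -> a <= 1 ->
  ev (push z g a) 0 = ev g 0.
Proof.
move=> zg a0 a1; rewrite ev_push//.
have -> : push_depth a 0 = 0.
  by rewrite /push_depth mulr0 subr0 mulr1 [Num.min 0 _]min_l// min_r.
rewrite subr0 sigma1 tgt_lft// /push_time cl01_le0//.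
by rewrite pmulr_lle0 ?invr_gt0; lra.
Qed.

Lemma push_end z g a : tgt z = ev g 0 -> 0 <= a -> a <= 1 ->
  ev (push z g a) 1 = ev g 1.
Proof.
move=> zg a0 a1; rewrite ev_push//.
have -> : push_depth a 1 = 0.
  by rewrite /push_depth subrr mulr0 mulr1 [Num.min 3 _]min_r// min_r.
rewrite subr0 sigma1 tgt_lft// /push_time cl01_ge1//.
by rewrite ler_pdivlMr; lra.
Qed.

(** The stages between [0] and [a] form a homotopy that starts at [g] and keeps both ends fixed. *)
Lemma push_class z g a : tgt z = ev g 0 -> 0 <= a -> a <= 1 ->
  path_class (push z g a) = path_class g.
Proof.
move=> zg a0 a1.
pose d (r : R) := a * cl01 r.
have d0 r : 0 <= d r by rewrite mulr_ge0// cl01_ge0.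
have d1 r : d r <= 1 by rewrite mulr_ile1// ?cl01_ge0 ?cl01_le1.
have cd : continuous d.
  move=> r; apply: cts_at_mul; first exact: cts_at_cst.
  exact: cl01_cts.
pose H (p : R * R) := ev (push z g (d p.2)) p.1.
have cH : continuous H.
  move=> p; apply: (@path_cts_at R X (R * R)%type (fun p => push z g (d p.2)) fst);
    last exact: cts_at_fst.
  apply: (@cts_at_comp _ _ _ snd (fun r => push z g (d r))).
    exact: cts_at_snd.
  exact: (@push_cts R (fun=> g) (fun=> z) d _ (@cts_at_cst _ _ _ _)
    (@cts_at_cst _ _ _ _) (cd _)).
have H0 : ev g = fun s => H (s, 0).
  by apply/funext => s; rewrite /H /d /= cl01_id// mulr0 push0.
have H1 : ev (push z g a) = fun s => H (s, 1).
  by apply/funext => s; rewrite /H /d /= cl01_id// mulr1.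
rewrite -[LHS]cls_ev -[RHS]cls_ev H0 H1; apply/esym/cls_homotopy => // r _ _.
  by rewrite /H /= push_start// [RHS]push_start.
by rewrite /H /= push_end// [RHS]push_end.
Qed.

(** The last stage of [push], in which only the class of the path is left. Around the cut at 1/2
    both formulas rest at the common source of [z] and [pmul z b]. *)
Definition via_origin z (b : Pi R X) : path_space R X := mkp (fun s =>
  if s <= 2^-1 then ev (sigma z) (1 - Num.min 1 (3 * s))
  else ev (sigma (pmul z b)) (1 - Num.min 1 (3 * (1 - s)))).

Lemma via_origin_fun_cts (W : topologicalType) (o : W -> whisker R X)
    (b : W -> Pi R X) (w : W) (s : R) :
  {for w, continuous o} ->
  {for w, continuous (fun w => pmul (o w) (b w) : whisker R X)} ->
  (forall w, tgt (o w) = src (b w)) ->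
  {for (w, s), continuous (fun p : W * R =>
    if p.2 <= 2^-1 then ev (sigma (o p.1)) (1 - Num.min 1 (3 * p.2))
    else ev (sigma (pmul (o p.1) (b p.1))) (1 - Num.min 1 (3 * (1 - p.2))))}.
Proof.
move=> co cob ob.
have cs : {for (w, s), continuous (fun p : W * R => p.2)} by exact: cts_at_snd.
have cc (r : R) : {for (w, s), continuous (fun p : W * R => r)}.
  exact: cts_at_cst.
have csig (f : W -> whisker R X) : {for w, continuous f} ->
    {for (w, s), continuous (fun p : W * R => sigma (f p.1))}.
  move=> cf; apply: (@cts_at_comp _ _ _ (fun p : W * R => f p.1) sigma);
    last exact: sigma_cts.
  by apply: (@cts_at_comp _ _ _ fst f); [exact: cts_at_fst|exact: cf].
apply: (@cts_at_if _ _ _ snd) => [|_|_|/= ->].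
- exact: cts_at_snd.
- apply: path_cts_at; first exact: csig.
  by apply: cts_at_sub => //; apply: cts_at_min => //; exact: cts_at_mul.
- apply: path_cts_at; first exact: (csig (fun w => pmul (o w) (b w))).
  apply: cts_at_sub => //; apply: cts_at_min => //; apply: cts_at_mul => //.
  exact: cts_at_sub.
- rewrite min_l ?subrr ?sigma0; last by lra.
  by rewrite min_l ?subrr ?sigma0 ?src_pmul//; lra.
Qed.

Lemma via_origin_path_cts z (b : Pi R X) : tgt z = src b -> continuous (fun s =>
  if s <= 2^-1 then ev (sigma z) (1 - Num.min 1 (3 * s))
  else ev (sigma (pmul z b)) (1 - Num.min 1 (3 * (1 - s)))).
Proof.
move=> zb s; apply: (@cts_at_comp R _ _ (fun s : R => (0 : R, s))
  (fun p : R * R => if p.2 <= 2^-1 then ev (sigma z) (1 - Num.min 1 (3 * p.2))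
    else ev (sigma (pmul z b)) (1 - Num.min 1 (3 * (1 - p.2))))).
  by apply: cts_at_pair; [exact: cts_at_cst|exact: cts_at_id].
exact: (@via_origin_fun_cts R (fun=> z) (fun=> b) 0 s
  (@cts_at_cst _ _ _ _) (@cts_at_cst _ _ _ _)).
Qed.

Lemma via_origin_cts (W : topologicalType) (o : W -> whisker R X)
    (b : W -> Pi R X) (w : W) :
  {for w, continuous o} ->
  {for w, continuous (fun w => pmul (o w) (b w) : whisker R X)} ->
  (forall w, tgt (o w) = src (b w)) ->
  {for w, continuous (fun w => via_origin (o w) (b w))}.
Proof.
move=> co cob ob; apply: mkp_cts_at => [w'|s].
  exact: via_origin_path_cts.
exact: via_origin_fun_cts.
Qed.

Lemma push1 z g : tgt z = ev g 0 -> push z g 1 = via_origin z (path_class g).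
Proof.
move=> zg; apply: path_ext => s s0 s1; rewrite ev_push// ev_mkp; last first.
  by apply: via_origin_path_cts; rewrite src_path.
rewrite cl01_id//; case: ifPn => [s2|]; last rewrite -ltNge => s2.
  have [s3|s3] := leP (3 * s) 1.
    rewrite /push_time cl01_le0; last first.
      by rewrite pmulr_lle0 ?invr_gt0; lra.
    rewrite lft0//; congr (ev _ (1 - _)).
    by rewrite /push_depth [Num.min (3 * s) _]min_l ?min_r//; lra.
  rewrite (_ : push_depth 1 s = 1); last first.
    by rewrite /push_depth min_l// le_min; apply/andP; split; lra.
  by rewrite subrr !sigma0 src_lft.
have [s3|s3] := leP (3 * (1 - s)) 1.
  rewrite /push_time cl01_ge1; last first.
    by rewrite ler_pdivlMr; lra.
  rewrite lft1; congr (ev _ (1 - _)).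
  by rewrite /push_depth [Num.min (3 * s) _]min_r ?min_r//; lra.
rewrite (_ : push_depth 1 s = 1); last first.
  by rewrite /push_depth min_l// le_min; apply/andP; split; lra.
by rewrite subrr !sigma0 src_lft// src_pmul// src_path.
Qed.

End pushing.

Section gluing.
Context {R : realType} {X : topologicalType}.
Hypothesis nb : nice_basis R X.
Hypothesis lpc : locally_pc R X.
Context (t : nat -> X -> R) (h : nat -> X -> path_space R X).
Hypothesis th : forall i, is_collar (t i) (h i).
Hypothesis pos : forall x, exists i, 0 < t i x.
Context (sigma : whisker R X -> path_space R X).
Hypothesis sigma_cts : continuous sigma.
Hypothesis sigmaK : forall z, path_class (sigma z) = z.

Definition layer (j : nat) : nat * nat := odflt (0%N, 0%N) (unpickle j).
Definition orig j : X -> whisker R X := origin (h (layer j).1).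

(* the second component of [layer j] is a scaling factor that makes some [weight j]
   constantly [1] on a neighbourhood of any given point *)
Definition weight j (x : X) : R :=
  cl01 ((layer j).2%:R * t (layer j).1 x - 1).

(** Origin and weight are read off at the starting point, which no step moves. *)
Definition step j (g : path_space R X) : path_space R X :=
  push sigma (orig j (ev g 0)) g (weight j (ev g 0)).

Lemma weight_cts j : continuous (weight j).
Proof.
move=> x; apply: (@cts_at_cl01 R X
  (fun x => (layer j).2%:R * t (layer j).1 x - 1)).
apply: cts_at_sub; last exact: cts_at_cst.
by apply: cts_at_mul; [exact: cts_at_cst|exact: (collar_weight_cts (th _))].
Qed.

Lemma weight_le1 j x : weight j x <= 1. Proof. exact: cl01_le1. Qed.
Lemma weight_ge0 j x : 0 <= weight j x. Proof. exact: cl01_ge0. Qed.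

Lemma weight1_pos j x : weight j x = 1 -> 0 < t (layer j).1 x.
Proof.
rewrite /weight => w1; rewrite ltNge; apply/negP => tx.
have : (layer j).2%:R * t (layer j).1 x <= 0 by rewrite mulr_ge0_le0.
by move=> h0; move: w1; rewrite cl01_le0; lra.
Qed.

Lemma weight1_ex (x : X) : exists j, \forall y \near x, weight j y = 1.
Proof.
have [i ti] := pos x.
pose k := (Num.truncn (2 / t i x)).+1.
have kt : 2 < k%:R * t i x by rewrite -ltr_pdivrMr// truncnS_gt.
exists (pickle (i, k)); rewrite /weight /layer pickleK /=.
have c : continuous (fun y => k%:R * t i y).
  move=> y; apply: (@cts_at_mul R X (fun=> k%:R)); first exact: cts_at_cst.
  exact: (collar_weight_cts (th _)).
have : nbhs x [set y | 2 < k%:R * t i y] := c x _ (lt_nbhsr kt).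
by apply: filterS => y /= ky; rewrite cl01_ge1//; lra.
Qed.

Lemma tgt_orig j x : tgt (orig j x) = x.
Proof. exact: (tgt_origin (th _)). Qed.

Lemma step_class j g : path_class (step j g) = path_class g.
Proof.
by apply: push_class => //; [exact: tgt_orig|exact: weight_ge0|exact: weight_le1].
Qed.

Lemma step1 j g : weight j (ev g 0) = 1 ->
  step j g = via_origin sigma (orig j (ev g 0)) (path_class g).
Proof. by move=> w1; rewrite /step w1 push1// tgt_orig. Qed.

Lemma step_cts j : continuous (step j).
Proof.
move=> g; have cev : continuous (fun g : path_space R X => ev g 0).
  by move=> g'; apply: path_cts_at; [exact: cts_at_id|exact: cts_at_cst].
have [tg|tg] := ltP 0 (t (layer j).1 (ev g 0)).
  apply: (@push_cts _ _ nb sigma sigma_cts _ id (fun g => orig j (ev g 0))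
    (fun g => weight j (ev g 0))).
  - exact: cts_at_id.
  - apply: (@cts_at_comp _ _ _ (fun g => ev g 0) (orig j)); first exact: cev.
    exact: (origin_cts (th _)).
  - exact: (cts_comp cev (@weight_cts j)).
  - by move=> g'; exact: tgt_orig.
  - by move=> g'; exact: weight_le1.
(* Outside the collar the origin is not known to be continuous, but the [- 1] in [weight] makes the
   weight vanish near [g], where the step is then the identity. *)
apply: (@cts_at_near _ _ id); last exact: cts_at_id.
pose f (g : path_space R X) := (layer j).2%:R * t (layer j).1 (ev g 0).
have cf : continuous f.
  move=> g'; apply: (@cts_at_mul R _ (fun=> (layer j).2%:R)).
    exact: cts_at_cst.
  exact: (cts_comp cev (collar_weight_cts (th _))).
have fg : f g < 1 by apply: le_lt_trans ltr01; rewrite /f mulr_ge0_le0.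
have : nbhs g [set g' | f g' < 1] := cf g _ (lt_nbhsl fg).
apply: filterS => g' /= fg'; rewrite /step.
have -> : weight j (ev g' 0) = 0 by rewrite /weight cl01_le0// subr_le0 ltW.
by rewrite push0// tgt_orig.
Qed.

(** Higher numbers act first: in [steps j.+1] the step [j] precedes all others, so if its weight is
    [1] it erases the representative at once. *)
Fixpoint steps n (g : path_space R X) : path_space R X :=
  if n is m.+1 then steps m (step m g) else g.

Lemma steps_cts n : continuous (steps n).
Proof.
elim: n => [|n IH] /= g; first exact: cts_at_id.
exact: (cts_comp (@step_cts n) IH).
Qed.

Lemma steps_class n g : path_class (steps n g) = path_class g.
Proof. by elim: n g => //= n IH g; rewrite IH step_class. Qed.

(* a step of weight [1] only depends on the class, so that it forgets the
   previous (higher numbered) steps *)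
Lemma steps_eq i j g g' : weight i (ev g 0) = 1 -> (i <= j)%N ->
  path_class g = path_class g' -> steps i.+1 g = steps j.+1 g'.
Proof.
move=> wi; elim: j g' => [|j IH] g' ij gg'.
  move: ij wi; rewrite leqn0 => /eqP -> wi /=.
  have e : ev g' 0 = ev g 0 by rewrite -!src_path gg'.
  by rewrite !step1 ?e// gg'.
move: ij; rewrite leq_eqVlt => /predU1P[ij|ij].
  have e : ev g' 0 = ev g 0 by rewrite -!src_path gg'.
  rewrite -[LHS]/(steps i (step i g)) -[RHS]/(steps j.+1 (step j.+1 g')) -ij.
  by rewrite !step1 ?e// gg'.
rewrite [RHS]/=; apply: IH => //.
by rewrite step_class.
Qed.

Definition glue_index (x : X) : nat := projT1 (cid (weight1_ex x)).

Lemma glue_indexP x : weight (glue_index x) x = 1.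
Proof.
by rewrite /glue_index; case: cid => j /= /nbhs_singleton.
Qed.

(** [rep] and [glue_index] are arbitrary choices; by [steps_eq] the result depends neither on the
    representative nor on which index of weight [1] is taken. *)
Definition glued (b : Pi R X) : path_space R X :=
  steps (glue_index (src b)).+1 (rep b).

Lemma gluedK b : path_class (glued b) = b.
Proof. by rewrite steps_class repK. Qed.

Lemma glued_near j b : weight j (src b) = 1 ->
  glued b = steps j (via_origin sigma (orig j (src b)) b).
Proof.
move=> wj; have wi := glue_indexP (src b).
have -> : glued b = steps j.+1 (rep b).
  rewrite /glued; have [ij|/ltnW ji] := leqP (glue_index (src b)) j.
    exact: steps_eq.
  by apply/esym; exact: steps_eq.
by rewrite /= step1// repK.
Qed.

Lemma glued_cts : continuous glued.
Proof.
move=> b; have [j wj] := weight1_ex (src b).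
have wjb := nbhs_singleton wj.
apply: (@cts_at_near _ _
  (fun b => steps j (via_origin sigma (orig j (src b)) b))).
  have : nbhs b [set c | weight j (src c) = 1] := src_cts nb wj.
  by apply: filterS => c /= wc; rewrite (glued_near wc).
apply: (@cts_at_comp _ _ _ (fun b => via_origin sigma (orig j (src b)) b)
  (steps j)); last exact: steps_cts.
have tb : 0 < t (layer j).1 (src b) := weight1_pos wjb.
apply: (@via_origin_cts _ _ sigma sigma_cts sigmaK _ (fun b => orig j (src b)) id).
- apply: (@cts_at_comp _ _ _ (@src R X) (orig j)); first exact: src_cts.
  exact: (origin_cts (th _)).
(* A move of the source inside the collar is absorbed by the origin, by [origin_mul]; what remains
   is a move of the end, as the whisker topology allows. *)
- apply/whisker_cts_atP => V oV /=.
  rewrite tgt_pmul ?tgt_orig// => Vb.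
  have [|U [nU Ub Ut]] := @nb (src b) [set x | 0 < t (layer j).1 x].
    exact: (collar_weight_cts (th _) (lt_nbhsr tb)).
  have [|V' [nV' Vb' V'V]] := @nb (tgt b) V.
    exact: open_nbhs_nbhs.
  apply: filterS (Pi_nbhs nU nV' Ub Vb') => c [d1 [d2 [Ud1 Vd2 td1 sd2 ->]]].
  have bd2 : tgt b = src d2 by [].
  exists d2; split => //; first exact: PV_sub Vd2.
  have od : pmul (orig j (src d1)) d1 = orig j (src b).
    by rewrite -td1; apply: (origin_mul (th _)); exact: PV_sub Ud1.
  have d1b : tgt (pmul d1 b) = src d2 by rewrite tgt_pmul.
  have od1 : tgt (orig j (src d1)) = src d1 by exact: tgt_orig.
  rewrite !src_pmul// (@pmulA _ _ _ (pmul d1 b) d2)// ?src_pmul//.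
  by rewrite (@pmulA _ _ _ d1 b)// od.
- by move=> c; exact: tgt_orig.
Qed.

End gluing.

Lemma aspherical_section {R : realType} {X : topologicalType}
    (cw : CW_structure R X) (x0 : X) : aspherical R X ->
  exists s : Pi R X -> path_space R X,
    continuous s /\ forall b, path_class (s b) = b.
Proof.
move=> [_ pin]; have col := CW_collared cw x0.
have nb := collared_nice_basis col.
have [lpc [t [h [th pos]]]] := col.
have [sigma [csigma sigmaK]] :=
  path_section cw nb (fun n x n2 => pin n x n2) x0.
exists (glued th pos sigma); split; first exact: glued_cts.
by move=> b; exact: gluedK.
Qed.

(** * Products *)

Section products.
Context {R : realType} {X Y : topologicalType}.

Lemma pair_cts {T : topologicalType} (f : T -> X) (g : T -> Y) :
  continuous f -> continuous g -> continuous (fun t => (f t, g t)).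
Proof. by move=> cf cg t; apply: cts_at_pair; [exact: cf|exact: cg]. Qed.

Lemma cls_pair (f g : R -> X) (f' g' : R -> Y) :
  continuous f -> continuous g -> continuous f' -> continuous g' ->
  cls f = cls g -> cls f' = cls g' ->
  cls (fun s => (f s, f' s)) = cls (fun s => (g s, g' s)).
Proof.
move=> cf cg cf' cg' /path_class_homotopy[H [cH H0 H1 Ht]].
move=> /path_class_homotopy[K [cK K0 K1 Kt]].
have e (u : R -> X) (u' : R -> Y) : continuous u -> continuous u' ->
    cls (fun s => (u s, u' s)) = cls (fun s => (ev (mkp u) s, ev (mkp u') s)).
  move=> cu cu'; apply: cls_eq => [||s s0 s1]; first exact: pair_cts.
    by apply: pair_cts; exact: ev_cts.
  by rewrite !ev_mkp// cl01_id.
rewrite (e f)// (e g)//.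
have -> : (fun s => (ev (mkp f) s, ev (mkp f') s)) =
    fun s => (H (s, 0), K (s, 0)) by apply/funext => s; rewrite H0 K0.
have -> : (fun s => (ev (mkp g) s, ev (mkp g') s)) =
    fun s => (H (s, 1), K (s, 1)) by apply/funext => s; rewrite H1 K1.
apply: (@cls_homotopy R _ (fun p => (H p, K p))) => [|u _ _|u _ _].
- exact: pair_cts.
- by rewrite !(Ht _).1 !(Kt _).1.
- by rewrite !(Ht _).2 !(Kt _).2.
Qed.

Lemma fst_cts : continuous (@fst X Y). Proof. by move=> p; exact: cts_at_fst. Qed.
Lemma snd_cts : continuous (@snd X Y). Proof. by move=> p; exact: cts_at_snd. Qed.

(** Homotopies of the two coordinates pair up to one in the product. *)
Lemma Pimap_pair_inj (b c : Pi R (X * Y)%type) :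
  Pimap fst b = Pimap fst c -> Pimap snd b = Pimap snd c -> b = c.
Proof.
have [f cf ->] := cls_surj b; have [g cg ->] := cls_surj c.
rewrite !Pimap_cls//; [|exact: snd_cts|exact: snd_cts|exact: fst_cts|exact: fst_cts].
move=> e1 e2.
have eta (u : R -> X * Y) : u = fun s => ((u s).1, (u s).2).
  by apply/funext => s; case: (u s).
rewrite (eta f) (eta g); apply: cls_pair => //.
- exact: cts_comp cf fst_cts.
- exact: cts_comp cg fst_cts.
- exact: cts_comp cf snd_cts.
- exact: cts_comp cg snd_cts.
Qed.

(** Paths are paired coordinatewise, and uniqueness of a class with given ends is checked on the two
    projections. *)
Lemma nice_setX (U : set X) (V : set Y) :
  nice R U -> nice R V -> nice R (U `*` V).
Proof.
move=> /niceP[oU [x Ux] pU uU] /niceP[oV [y Vy] pV uV]; apply/niceP; split.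
- have := oU; have := oV; rewrite !openE => nV nU [u v] /= [Uu Vv].
  by exists (U, V) => //=; split; [exact: nU|exact: nV].
- by exists (x, y).
- move=> [u v] [u' v'] /= [Uu Vv] [Uu' Vv'].
  have [b [f [cf fU ->]] []] := pU u u' Uu Uu'; rewrite src_cls// tgt_cls// => f0 f1.
  have [c [g [cg gV ->]] []] := pV v v' Vv Vv'; rewrite src_cls// tgt_cls// => g0 g1.
  have cfg := pair_cts cf cg.
  exists (cls (fun s => (f s, g s))).
    by exists (fun s => (f s, g s)); split => // s; split; [exact: fU|exact: gV].
  by rewrite src_cls// tgt_cls// f0 f1 g0 g1.
- move=> b c Wb Wc sbc tbc.
  have fstW d : PV (U `*` V) d -> PV U (Pimap fst d).
    by move=> Wd; apply: PV_Pimap fst_cts _; apply: PV_sub Wd => -[u v] [].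
  have sndW d : PV (U `*` V) d -> PV V (Pimap snd d).
    by move=> Wd; apply: PV_Pimap snd_cts _; apply: PV_sub Wd => -[u v] [].
  apply: Pimap_pair_inj; [apply: uU|apply: uV].
  + exact: fstW.
  + exact: fstW.
  + by rewrite !src_Pimap ?sbc//; exact: fst_cts.
  + by rewrite !tgt_Pimap ?tbc//; exact: fst_cts.
  + exact: sndW.
  + exact: sndW.
  + by rewrite !src_Pimap ?sbc//; exact: snd_cts.
  + by rewrite !tgt_Pimap ?tbc//; exact: snd_cts.
Qed.

Lemma nice_basis_prod : nice_basis R X -> nice_basis R Y ->
  nice_basis R (X * Y)%type.
Proof.
move=> nbX nbY [x y] W [[A B] /= [Ax By] ABW].
have [U [nU Ux UA]] := nbX x A Ax; have [V [nV Vy VB]] := nbY y B By.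
exists (U `*` V); split => //; first exact: nice_setX.
by apply: subset_trans ABW => -[u v] [/UA Au /VB Bv].
Qed.

End products.

Lemma set_type_map_cts {T S : topologicalType} (A : set T) (B : set S)
    (f : T -> S) : continuous f -> (forall x, A x -> B (f x)) ->
  exists2 g : A -> B, continuous g & forall x, set_val (g x) = f (set_val x).
Proof.
move=> cf AB.
have gB (x : A) : f (set_val x) \in B by rewrite inE; apply: AB; exact: set_valP.
pose g (x : A) : B := exist (fun y => y \in B) _ (gB x).
exists g; last by move=> x; rewrite /g set_valE.
apply: continuous_comp_initial.
rewrite (_ : _ \o _ = fun x : A => f (set_val x)).
  apply: cts_comp cf; exact: initial_continuous.
by apply/funext => x /=; rewrite /g set_valE.
Qed.

Section covers.
Context {R : realType} {X Y : topologicalType}.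

(** The cover is pulled back along the second projection, with the same index set; [s] supplies the
    first coordinate of each section and the given section the second. *)
Lemma asphericity_cover_prod (s : Pi R X -> path_space R X) k :
  nice_basis R X -> nice_basis R Y ->
  continuous s -> (forall b, path_class (s b) = b) ->
  asphericity_cover R Y k -> asphericity_cover R (X * Y)%type k.
Proof.
move=> nbX nbY cs sK [U [oU cU sU]].
have nbXY := nice_basis_prod nbX nbY.
have cp1 := Pimap_cts nbXY (@fst_cts X Y).
have cp2 := Pimap_cts nbXY (@snd_cts X Y).
exists (fun j => Pimap snd @^-1` U j); split => [j||j].
- by move/continuousP: cp2; apply; exact: oU.
- rewrite -subTset => b _.
  have [j _ Uj] : (\bigcup_j U j) (Pimap snd b) by rewrite cU.
  by exists j.
have [sj [csj sjK]] := sU j.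
have [p cp pE] := @set_type_map_cts _ _ (Pimap snd @^-1` U j) (U j) _ cp2
  (fun x Ax => Ax).
pose g (b : (Pimap snd @^-1` U j : set (Pi R (X * Y)%type))) (r : R) :=
  (ev (s (Pimap fst (set_val b))) r, ev (sj (p b)) r).
have cg b : continuous (g b) by apply: pair_cts; exact: ev_cts.
exists (fun b => mkp (g b)); split => [b|].
  apply: mkp_cts_at => // r; apply: cts_at_pair.
    apply: path_cts_at; last exact: cts_at_snd.
    apply: (@cts_at_comp _ _ _ fst
      (fun b => s (Pimap fst (set_val b)))); first exact: cts_at_fst.
    apply: (cts_comp (f := fun b => Pimap fst (set_val b)) _ cs).
    by apply: cts_comp cp1; exact: initial_continuous.
  apply: path_cts_at; last exact: cts_at_snd.
  apply: (@cts_at_comp _ _ _ fst (fun b => sj (p b))); first exact: cts_at_fst.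
  exact: (cts_comp cp csj).
apply/funext => b /=; apply: Pimap_pair_inj.
  rewrite -/(cls (g b)) Pimap_cls//; last exact: fst_cts.
  by rewrite -[RHS]sK -cls_ev.
rewrite -/(cls (g b)) Pimap_cls//; last exact: snd_cts.
have := congr1 (fun f => f (p b)) sjK; rewrite /= pE => <-.
by rewrite -cls_ev.
Qed.

(** The cover is restricted to the slice at [x0], and the sections are projected back to [Y]. *)
Lemma asphericity_cover_factor (x0 : X) k : nice_basis R Y ->
  asphericity_cover R (X * Y)%type k -> asphericity_cover R Y k.
Proof.
move=> nbY [U [oU cU sU]].
have ci : continuous (fun y : Y => (x0, y)).
  by apply: pair_cts => y; [exact: cts_at_cst|exact: cts_at_id].
have cPi := Pimap_cts nbY ci.
exists (fun j => Pimap (fun y => (x0, y)) @^-1` U j); split => [j||j].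
- by move/continuousP: cPi; apply; exact: oU.
- rewrite -subTset => b _.
  have [j _ Uj] : (\bigcup_j U j) (Pimap (fun y => (x0, y)) b) by rewrite cU.
  by exists j.
have [sj [csj sjK]] := sU j.
have [p cp pE] := @set_type_map_cts _ _ (Pimap (fun y => (x0, y)) @^-1` U j)
  (U j) _ cPi (fun x Ax => Ax).
have csnd b : continuous (fun r : R => (ev (sj (p b)) r).2).
  by apply: cts_comp (@snd_cts X Y); exact: ev_cts.
exists (fun b => mkp (fun r => (ev (sj (p b)) r).2)); split => [b|].
  apply: mkp_cts_at => // r.
  apply: (@cts_at_comp _ _ _
    (fun q : (Pimap (fun y => (x0, y)) @^-1` U j : set (Pi R Y)) * R =>
      ev (sj (p q.1)) q.2) snd); last exact: cts_at_snd.
  apply: path_cts_at; last exact: cts_at_snd.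
  apply: (@cts_at_comp _ _ _ fst (fun b => sj (p b))); first exact: cts_at_fst.
  exact: (cts_comp cp csj).
apply/funext => b /=.
rewrite -/(cls _) -(Pimap_path _ (@snd_cts X Y)).
have := congr1 (fun f => f (p b)) sjK; rewrite /= pE => ->.
have [f cf fE] := cls_surj (set_val b); rewrite fE.
by rewrite !Pimap_cls//; [exact: snd_cts|exact: cts_comp cf ci].
Qed.

End covers.

Theorem proposition6p12 (R : realType) (X Y : topologicalType)
    (cwX : CW_structure R X) (cwY : CW_structure R Y)
    (conX : connected_space X) (aspX : aspherical R X)
    (finX : locally_finite cwX \/ countable_CW cwX)
    (conY : connected_space Y)
    (finY : locally_finite cwY \/ countable_CW cwY) :
  asphericity_complexity R (X * Y)%type = asphericity_complexity R Y.
Proof.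
have [[x0 _] _] := conX; have [[y0 _] _] := conY.
have nbX := collared_nice_basis (CW_collared cwX x0).
have nbY := collared_nice_basis (CW_collared cwY y0).
have [s [cs sK]] := aspherical_section cwX x0 aspX.
have e : asphericity_cover R (X * Y)%type = asphericity_cover R Y.
  apply/funext => k; apply/propext; split.
    exact: asphericity_cover_factor.
  exact: asphericity_cover_prod.
by rewrite /asphericity_complexity e.
Qed.
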